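(* Assume that: (A1) for every $t\ge0$, the set $F_t^{-1}(\xi)=\{\zeta\in\mathbb{R}^p:F_t(\zeta)=\xi\}$ is nonempty for all $\xi\in{\rm im}\,(C,D_{\rm e})$; (A3) for every $t\ge0$ and every $\xi\in{\rm im}\,(C,D_{\rm e})$, the set $f(t,F_t^{-1}(\xi))=\{f(t,\zeta):\zeta\in F_t^{-1}(\xi)\}$ is convex; for all compact sets $K\subset\mathbb{R}^p$, there exists $\varphi\in L^1_{\rm loc}(\mathbb{R}_+,\mathbb{R}_+)$ such that $\sup_{\xi\in K}\|f(t,\xi)\|\le\varphi(t)$ for all $t\ge0$; and, for all compact sets $T\subset\mathbb{R}_+$, there exist $\rho>0$ and $c>0$ such that $c\|D\|<1$ and $$\sup_{\|\xi\|\ge\rho}\frac{\|f(t,\xi)\|}{\|\xi\|}\le c\quad\text{for a.e. }t\in T.$$ Then $\tilde{\mathcal B}(S^f,t_0)=\mathcal B(S^f,t_0)$ for all $t_0\ge0$ (that is, (L) is forward complete). Furthermore, for all $v\in L^\infty_{\rm loc}(\mathbb{R}_+,\mathbb{R}^{m_{\rm e}})$, $t_0\ge0$ and $x^0\in\mathbb{R}^n$, there exists $(v,x,y)\in\mathcal B(S^f,t_0)$ such that $x(t_0)=x^0$.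
   Context: Setting. $\mathbb{R}_+=[0,\infty)$; norms on $\mathbb{R}^k$ are Euclidean and matrix norms are the induced operator norms. Let $n,m,m_{\rm e},p$ be positive integers, $A\in\mathbb{R}^{n\times n}$, $B\in\mathbb{R}^{n\times m}$, $B_{\rm e}\in\mathbb{R}^{n\times m_{\rm e}}$, $C\in\mathbb{R}^{p\times n}$, $D\in\mathbb{R}^{p\times m}$, $D_{\rm e}\in\mathbb{R}^{p\times m_{\rm e}}$, and let $f:\mathbb{R}_+\times\mathbb{R}^p\to\mathbb{R}^m$ be a Caratheodory function, i.e. $f(t,\cdot)$ is continuous for every $t\ge0$ and $f(\cdot,\xi)$ is measurable for every $\xi\in\mathbb{R}^p$. The Lur'e system $S^f$, also called (L), is $$\dot x(t)=Ax(t)+Bf(t,y(t))+B_{\rm e}v(t),\qquad y(t)=Cx(t)+Df(t,y(t))+D_{\rm e}v(t).$$ Write $(f\circ y)(t):=f(t,y(t))$ and $F_t(\xi):=\xi-Df(t,\xi)$ for $t\ge0$, $\xi\in\mathbb{R}^p$. ${\rm im}\,(C,D_{\rm e})\subset\mathbb{R}^p$ is the image of the block matrix $(C,D_{\rm e})\in\mathbb{R}^{p\times(n+m_{\rm e})}$. $F_t$ need not be invertible; $F_t^{-1}(\xi)$ is the fibre of $\xi$. Trajectories. For $0\le t_0<\tau\le\infty$, a pre-trajectory of (L) on $[t_0,\tau)$ is a triple $(v,x,y)\in L^\infty_{\rm loc}(\mathbb{R}_+,\mathbb{R}^{m_{\rm e}})\times W^{1,1}_{\rm loc}([t_0,\tau),\mathbb{R}^n)\times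 L^1_{\rm loc}([t_0,\tau),\mathbb{R}^p)$ such that $f\circ y\in L^1_{\rm loc}([t_0,\tau),\mathbb{R}^m)$ and both equations of (L) hold for a.e. $t\in[t_0,\tau)$ (''loc'' refers to compact subintervals of $[t_0,\tau)$; elements of $W^{1,1}_{\rm loc}$ are identified with locally absolutely continuous functions). It is maximally defined if there is no pre-trajectory $(v,\tilde x,\tilde y)$ on some $[t_0,\tilde\tau)$ with $\tilde\tau>\tau$ and $(\tilde x,\tilde y)|_{[t_0,\tau)}=(x,y)$. $\tilde{\mathcal B}(S^f,t_0)$ denotes the set of all maximally defined pre-trajectories with initial time $t_0$; $\mathcal B(S^f,t_0)$ denotes the set of all trajectories on $[t_0,\infty)$, i.e. pre-trajectories on $[t_0,\tau)$ with $\tau=\infty$. (L) is forward complete if $\tilde{\mathcal B}(S^f,t_0)=\mathcal B(S^f,t_0)$ for every $t_0\ge0$. *)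

(* Defs.v *)
From HB Require Import structures.
From mathcomp Require Import all_boot all_order all_algebra.
From mathcomp Require Import all_classical all_reals all_analysis.
Set Implicit Arguments.
Unset Strict Implicit.
Unset Printing Implicit Defensive.
Import Order.TTheory GRing.Theory Num.Theory.
Import numFieldNormedType.Exports.
Local Open Scope classical_set_scope.
Local Open Scope ring_scope.

(* Functions defined on a subset J of the real line are represented by total
   functions on R whose values outside J are irrelevant.
   "Measurable" means Lebesgue measurable: the sigma-algebra on R is the one of
   the completed Lebesgue measure, not the Borel one of lebesgue_measure. *)

Notation lebesgueType R := (caratheodory_type ((@wlength R idfun)^*)%mu).
Notation lebesgue := completed_lebesgue_measure.

Definition enorm (R : realType) (k : nat) (u : 'cV[R]_k) : R :=
  Num.sqrt (\sum_i u i ord0 ^+ 2).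

Definition opnorm (R : realType) (k l : nat) (M : 'M[R]_(k, l)) : R :=
  sup [set enorm (M *m u) | u in [set u : 'cV[R]_l | enorm u <= 1]].

Section function_spaces.
Context {R : realType} {k : nat}.
Implicit Types (J : set R) (x : R -> 'cV[R]_k).

Definition vmeasurable J x : Prop :=
  forall i, measurable_fun (J : set (lebesgueType R))
    (fun t : lebesgueType R => x t i ord0).

Definition L1loc J (g : R -> R) : Prop :=
  forall a b : R, `[a, b] `<=` J ->
    lebesgue.-integrable (`[a, b]%classic : set (lebesgueType R))
      (fun t : lebesgueType R => (g t)%:E).

Definition vL1loc J x : Prop := forall i, L1loc J (fun t => x t i ord0).

Definition Linftyloc J x : Prop :=
  forall a b : R, `[a, b] `<=` J ->
    vmeasurable `[a, b] x /\
    exists M : R, {ae lebesgue, forall t : lebesgueType R,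
      (`[a, b]%classic : set R) t -> enorm (x t) <= M}.

Definition abs_continuous (a b : R) x : Prop :=
  forall e : R, 0 < e -> exists2 d : R, 0 < d &
    forall (N : nat) (s t : 'I_N -> R),
      (forall i, a <= s i /\ s i <= t i /\ t i <= b) ->
      trivIset [set: 'I_N] (fun i => `]s i, t i[%classic) ->
      \sum_i (t i - s i) < d ->
      \sum_i enorm (x (t i) - x (s i)) < e.

(* The locally absolutely continuous representatives of the elements of
   W^{1,1}_loc(J, R^k), for J an interval *)
Definition W11loc J x : Prop :=
  forall a b : R, `[a, b] `<=` J -> abs_continuous a b x.

End function_spaces.

Definition nonnegR (R : realType) : set R := [set t | 0 <= t].
Arguments nonnegR {R}.

Definition caratheodory_fun (R : realType) (p m : nat)
    (f : R -> 'cV[R]_p -> 'cV[R]_m) : Prop :=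
  (forall t, 0 <= t -> continuous (f t)) /\
  (forall xi, vmeasurable nonnegR (fun t => f t xi)).

Section lure_system.
Context {R : realType} {n m me p : nat}.
Context (A : 'M[R]_n) (B : 'M[R]_(n, m)) (Be : 'M[R]_(n, me)).
Context (C : 'M[R]_(p, n)) (D : 'M[R]_(p, m)) (De : 'M[R]_(p, me)).
Context (f : R -> 'cV[R]_p -> 'cV[R]_m).
Implicit Types (v : R -> 'cV[R]_me) (x : R -> 'cV[R]_n) (y : R -> 'cV[R]_p).

Definition lureF (t : R) (xi : 'cV[R]_p) : 'cV[R]_p := xi - D *m f t xi.

Definition lure_im : set 'cV[R]_p := range (mulmx (row_mx C De)).

Definition lure_A1 : Prop := forall t, 0 <= t -> forall xi, lure_im xi ->
  lureF t @^-1` [set xi] !=set0.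

Definition lure_A3 : Prop := forall t, 0 <= t -> forall xi, lure_im xi ->
  convex_set (f t @` (lureF t @^-1` [set xi]) : set (convex_lmodType 'cV[R]_m)).

Definition tint (t0 : R) (tau : \bar R) : set R := [set t | t0 <= t /\ (t%:E < tau)%E].

Definition lure_equations v x y (t : R) : Prop :=
  is_derive t (1 : R) x (A *m x t + B *m f t (y t) + Be *m v t) /\
  y t = C *m x t + D *m f t (y t) + De *m v t.

Definition pre_trajectory (t0 : R) (tau : \bar R) v x y : Prop :=
  [/\ 0 <= t0, (t0%:E < tau)%E, Linftyloc nonnegR v &
  [/\ W11loc (tint t0 tau) x, vL1loc (tint t0 tau) y,
      vL1loc (tint t0 tau) (fun t => f t (y t)) &
      {ae lebesgue, forall t : lebesgueType R,
        tint t0 tau t -> lure_equations v x y t}]].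

(* As an element of L^1_loc, y is only determined almost everywhere. *)
Definition maximally_defined (t0 : R) (tau : \bar R) v x y : Prop :=
  ~ exists tau' x' y', [/\ (tau < tau')%E, pre_trajectory t0 tau' v x' y',
      forall t, tint t0 tau t -> x' t = x t &
      {ae lebesgue, forall t : lebesgueType R, tint t0 tau t -> y' t = y t}].

(* The end time of the interval of definition is part of the data, since it
   cannot be read off from the total functions x and y. *)
Definition maximal_behaviour (t0 : R) :
    set (\bar R * (R -> 'cV[R]_me) * (R -> 'cV[R]_n) * (R -> 'cV[R]_p)) :=
  [set w | let: (tau, v, x, y) := w in
    pre_trajectory t0 tau v x y /\ maximally_defined t0 tau v x y].

Definition behaviour (t0 : R) :
    set (\bar R * (R -> 'cV[R]_me) * (R -> 'cV[R]_n) * (R -> 'cV[R]_p)) :=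
  [set w | let: (tau, v, x, y) := w in
    tau = +oo%E /\ pre_trajectory t0 tau v x y].

Definition forward_complete : Prop :=
  forall t0, 0 <= t0 -> maximal_behaviour t0 = behaviour t0.

End lure_system.

(* Main.v *)
Require Import Defs.
From mathcomp Require Import all_boot all_order all_algebra.
From mathcomp Require Import all_classical all_reals all_analysis.
From mathcomp Require Import measurable_realfun lra ring.
Import Order.TTheory GRing.Theory Num.Theory.
Import numFieldNormedType.Exports.
Set Implicit Arguments.
Unset Strict Implicit.
Unset Printing Implicit Defensive.
Local Open Scope classical_set_scope.
Local Open Scope ring_scope.

(** With w(t) = f(t, y(t)) the output equation reads y = C x + D w + De v, and the
    system becomes the differential inclusion
        x' = A x + B w + Be v,    w(t) in W(t, x(t)),
        W(t, x) = {w | w = f(t, C x + De v(t) + D w)}.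
    A1 says that W(t, x) is nonempty, A3 that it is convex, and it is closed since
    f(t, .) is continuous.  Because c * opnorm D < 1, a vector w which satisfies
    |w - f(t, xi + D w)| <= 1 is bounded by phi(t) + K |xi| for almost all t, with phi
    locally integrable ([uniform_growth]); the bound also covers approximate solutions of
    w = f(t, xi + D w).

    Existence on a compact interval ([existence]).  The equation in which the state on
    the right-hand side is delayed by 1/(k+1), and w(t) is a vector of residual smaller
    than 1/(k+1), is solved step by step, because the right-hand side depends on the past
    only ([approximate_solutions]).  The vector w(t) is the first one in an enumeration
    of the rational vectors that has a small residual, which makes it measurable in t.
    The growth bound and Gronwall's argument bound all the states and give them a common
    modulus of continuity, so a subsequence converges at every time
    ([ascoli_subsequence]).  The inputs w_k are merely dominated by an integrable
    function; instead of weak compactness in L^1, suitable convex combinations of their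
    tails converge almost everywhere ([komlos]).  Such combinations remain close to
    W(t, x(t)) since this set is convex, and the integral equation, being affine in w,
    survives as well: the limit is a solution.

    Local solutions are then pasted into a global one ([global_existence]).  If a
    pre-trajectory lives on [t0, tau[ with tau finite, Gronwall's inequality bounds x,
    hence w is integrable up to tau, x has a limit there and a global solution started
    from this limit extends the pre-trajectory ([extend_trajectory]); so a maximally
    defined one has tau = +oo.

    All this is done with the integral form of the equation.  It is equivalent to the
    almost everywhere form by the two halves of the fundamental theorem of calculus for
    the Lebesgue integral, [lint_derive] and [ftc2]; the latter rests on the fact that an
    absolutely continuous function with zero derivative almost everywhere is constant
    ([scalar_ac_derive0_cst]). *)

(** * The completed Lebesgue measure *)

Section completed_measure.
Context {R : realType}.
Notation LR := (lebesgueType R).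
Notation mu := (@completed_lebesgue_measure R).
Implicit Types (a b c t : R) (g h : R -> R).

Lemma borel_lebesgue (A : set R) :
  measurable (A : set (measurableTypeR R)) -> measurable (A : set LR).
Proof. by move=> mA; apply: sub_caratheodory. Qed.

Lemma itv_lebesgue (i : interval R) : measurable ([set` i] : set LR).
Proof. by apply: borel_lebesgue; exact: measurable_itv. Qed.

Lemma mu_itv (x y : bool) a b : a <= b ->
  mu ([set` Interval (BSide x a) (BSide y b)] : set LR) = (b - a)%:E.
Proof.
move=> ab; have -> : mu ([set` Interval (BSide x a) (BSide y b)] : set LR)
  = lebesgue_measure [set` Interval (BSide x a) (BSide y b)] by [].
rewrite lebesgue_measure_itv/= lte_fin.
move: ab; rewrite le_eqVlt => /predU1P[->|->]; last by rewrite EFinB.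
by rewrite ltxx subrr.
Qed.

Lemma mu_set1 a : mu ([set a] : set LR) = 0%E.
Proof. exact: lebesgue_measure_set1. Qed.

Lemma borel_fun_lebesgue g :
  measurable_fun (setT : set (measurableTypeR R)) g ->
  measurable_fun (setT : set LR) (g : LR -> R).
Proof.
move=> mg _ Y mY; apply: borel_lebesgue.
by have := mg measurableT Y mY.
Qed.

(** The sublevel set of g at a rational level is a Borel set up to a subset of a Borel
    null set; off the union NN of these countably many null sets, g is Borel. *)
Lemma borel_modificationT g :
  measurable_fun (setT : set LR) (g : LR -> R) ->
  exists2 h : R -> R, measurable_fun (setT : set (measurableTypeR R)) h &
    {ae mu, forall t : LR, h t = g t}.
Proof.
move=> mg.
have /choice[B /choice[N BN]] (q : rat) : exists B, exists N : set R,
   [/\ measurable (B : set (measurableTypeR R)),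
    measurable (N : set (measurableTypeR R)), lebesgue_measure N = 0%E,
    B `<=` [set t | g t < ratr q] & [set t | g t < ratr q] `<=` B `|` N].
  have := mg measurableT `]-oo, ratr q[%classic (measurable_itv _).
  rewrite setTI => mgq.
  have : (completed_algebra_gen (@lebesgue_measure R)).-sigma.-measurable
     (g @^-1` `]-oo, ratr q[%classic).
    by rewrite completed_caratheodory_measurable.
  rewrite g_sigma_completed_algebra_genE => -[B mB [M [N [mN N0 MN]]] BMg].
  exists B, N; split => //.
    by move=> t Bt; have : (B `|` M) t by [left]; rewrite BMg/= in_itv.
  have -> : [set t | g t < ratr q] = g @^-1` `]-oo, ratr q[%classic.
    by apply/seteqP; split=> t /=; rewrite in_itv.
  by rewrite -BMg => t [|/MN]; [left|right].
pose NN := \bigcup_q N q.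
have mNN : measurable (NN : set (measurableTypeR R)).
  by apply: bigcupT_measurable_rat => q; have [] := BN q.
have NN0 : mu NN = 0%E.
  apply: (@negligibleP _ _ _ mu _ (borel_lebesgue mNN)).1.
  rewrite /NN (_ : \bigcup_q N q =
    \bigcup_k (if unpickle k is Some q then N q else set0)); last first.
    apply/seteqP; split => [t [q _ Nt]|t [k _]].
      by exists (pickle q); [exact: I|rewrite pickleK; exact: Nt].
    by case: unpickle => [q Nt|[]]; exists q; [exact: I|exact: Nt].
  apply: negligible_bigcup => k; case: unpickle => [q|]; last exact: negligible_set0.
  have [_ mN N0 _ _] := BN q.
  by exists (N q); split => //; exact: borel_lebesgue.
exists (fun t => if t \in NN then 0 else g t); last first.
  exists NN; split => //; first exact: borel_lebesgue.
  by move=> t /=; case: ifPn => // /set_mem.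
apply: (measurability _ (RGenInftyO.measurableE R)) => _ [_ [x ->] <-].
rewrite setTI.
rewrite [X in measurable X](_ : _ = \bigcup_q
   (if ratr q < x then (B q `\` NN) `|` (if 0 < (ratr q : R) then NN else set0) else set0)).
  apply: bigcupT_measurable_rat => q; case: ifP => // _.
  have [mB _ _ _ _] := BN q.
  by apply: measurableU; [exact: measurableD|case: ifP].
apply/seteqP; split => t /=.
  rewrite in_itv/=; case: ifPn => [/set_mem NNt x0|/negP NNt gtx].
    have [q] := rat_in_itvoo x0; rewrite in_itv/= => /andP[q0 qx].
    by exists q => //; rewrite qx; right; rewrite q0.
  have [q] := rat_in_itvoo gtx; rewrite in_itv/= => /andP[q0 qx].
  exists q => //; rewrite qx; left; split; last by move/mem_set.
  have [_ _ _ _ /(_ t q0) [//|Nt]] := BN q.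
  by case: NNt; apply/mem_set; exists q.
move=> [q _]; case: ifP => // qx [[Bt NNt]|]; rewrite in_itv/=.
  case: ifPn => [/set_mem //|_]; apply: lt_trans qx.
  by have [_ _ _ + _] := BN q; apply.
case: ifP => // q0 NNt; rewrite ifT; last exact: mem_set.
exact: lt_trans qx.
Qed.

Lemma borel_modification g (D : set R) : measurable (D : set LR) ->
  measurable_fun (D : set LR) (g : LR -> R) ->
  exists2 h : R -> R, measurable_fun (setT : set (measurableTypeR R)) h &
    {ae mu, forall t : LR, D t -> h t = g t}.
Proof.
move=> mD /(measurable_restrictT (g : LR -> R) mD) /borel_modificationT[h mh hg].
exists h => //; apply: filterS hg => t /= -> Dt.
by rewrite patchE mem_set.
Qed.

(** A null set of the completed measure lies in a Borel null set, to which outer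
    regularity applies. *)
Lemma open_cover_negligible (N : set R) (e : R) : 0 < e ->
  mu.-negligible (N : set LR) ->
  exists2 U : set R, open U & N `<=` U /\ (mu U < e%:E)%E.
Proof.
move=> e0 [M [mM M0 NM]].
have : (completed_algebra_gen (@lebesgue_measure R)).-sigma.-measurable M.
  by rewrite completed_caratheodory_measurable.
rewrite g_sigma_completed_algebra_genE => -[B mB [A [A' [mA' A'0 AA']]] BAM].
have B0 : lebesgue_measure B = 0%E.
  apply/eqP; rewrite eq_le measure_ge0 andbT -[leRHS]M0.
  apply: (@le_measure _ _ _ mu); rewrite ?inE//; first exact: borel_lebesgue.
  by rewrite -BAM; exact: subsetUl.
have BA0 : lebesgue_measure (B `|` A') = 0%E.
  by apply: null_set_setU.
have [|||U [oU BU mU]] := @lebesgue_regularity_outer R (B `|` A') e.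
- exact: measurableU.
- by apply: (@le_lt_trans _ _ 0%E) => //; rewrite -BA0.
- by [].
exists U => //; split.
  apply: subset_trans NM _; rewrite -BAM; apply: subset_trans BU.
  exact: setUS.
apply: le_lt_trans mU.
have mX : measurable ((B `|` A') : set (measurableTypeR R)) by exact: measurableU.
have mU' : measurable (U : set (measurableTypeR R)) by exact: open_measurable.
have -> : mu U = lebesgue_measure U by [].
rewrite -[in leLHS](setDUK BU) setUC measureU//; last 2 first.
- exact: measurableD.
- by rewrite setDE -setIA (setIC (~` _)) setICr setI0.
by rewrite -[leRHS]adde0; apply: leeD => //; rewrite -BA0.
Qed.

End completed_measure.

(** * Integrals over compact intervals *)

Section absolute_continuity_of_the_integral.
Context d (T : measurableType d) {R : realType} (mu : {measure set T -> \bar R}).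

(** Truncating |g| at level n leaves a remainder whose integral over all of D is small,
    while the truncated part contributes at most n times the measure of A. *)
Lemma integral_abs_continuous (D : set T) (g : T -> R) (e : R) :
  measurable D -> mu.-integrable D (EFin \o g) -> 0 < e ->
  exists2 d : R, 0 < d & forall A : set T, measurable A ->
    A `<=` D -> (mu A < d%:E)%E ->
    (\int[mu]_(t in A) `|g t|%:E < e%:E)%E.
Proof.
move=> mD ig e0.
have /measurable_EFinP mg := measurable_int mu ig.
pose gn (n : nat) (t : T) : R := Num.min `|g t| n%:R.
have mng : measurable_fun D (fun t => `|g t|) by exact: measurableT_comp.
have mgn n : measurable_fun D (gn n) by apply: measurable_minr.
have gn0 n t : 0 <= `|g t| - gn n t by rewrite subr_ge0 ge_min lexx.
have mdn n : measurable_fun D (fun t => `|g t| - gn n t) by exact: measurable_funB.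
have gn_ge0 n t : 0 <= gn n t by rewrite /gn le_min normr_ge0/=.
have ing : mu.-integrable D (fun t => `|g t|%:E) by exact: integrable_abse ig.
have cv0 : (\int[mu]_(t in D) (`|g t| - gn n t)%:E)%E @[n --> \oo] --> (\int[mu]_(t in D) (0%:E))%E.
  apply: (fun a b c d e => let: And3 _ _ h := @dominated_convergence _ T R mu D mD
     (fun n t => (`|g t| - gn n t)%:E) (fun=> 0%:E) (fun t => `|g t|%:E) a b c d e in h) => //.
  - by move=> n; exact/measurable_EFinP.
  - apply: aeW => t _; apply: cvg_near_cst.
    near=> n; rewrite /gn min_l ?subrr//.
    by near: n; exact: nbhs_infty_ger.
  - apply: aeW => t n _; rewrite lee_fin ger0_norm// lerBlDr lerDl//.
rewrite integral0 in cv0.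
have e20 : 0 < e / 2 by rewrite divr_gt0.
have idn n : mu.-integrable D (fun t => (`|g t| - gn n t)%:E).
  apply: le_integrable ing => //; first exact/measurable_EFinP.
  move=> t _; rewrite lee_fin normr_id ger0_norm// lerBlDr lerDl//.
have /fine_cvgP[_ /cvgrPdist_lt/(_ _ e20)[n _ /(_ n (leqnn n))/=]] := cv0.
rewrite sub0r normrN ger0_norm; last first.
  by apply/fine_ge0/integral_ge0 => t _; rewrite lee_fin.
rewrite -lte_fin fineK; last exact: integrable_fin_num.
move=> ne2.
exists (e / 2 / n.+1%:R) => [|A mA AD muA]; first by rewrite !divr_gt0.
have mgA (k : T -> R) : measurable_fun D k -> measurable_fun A (fun t => (k t)%:E).
  by move=> mk; apply/measurable_EFinP; apply: measurable_funS mk.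
have -> : (\int[mu]_(t in A) `|g t|%:E =
  \int[mu]_(t in A) ((`|g t| - gn n t)%:E + (gn n t)%:E))%E.
  by apply: eq_integral => t _; rewrite -EFinD subrK.
rewrite ge0_integralD//; last 4 first.
- by move=> t _; rewrite lee_fin.
- exact: mgA.
- by move=> t _; rewrite lee_fin.
- exact: mgA.
apply: (@le_lt_trans _ _ (\int[mu]_(t in D) (`|g t| - gn n t)%:E + (e / 2)%:E)%E); last first.
  by rewrite [ltRHS](_ : _ = (e / 2)%:E + (e / 2)%:E)%E ?lteD2rE// -EFinD -splitr.
apply: leeD.
- apply: ge0_subset_integral => //; first exact/measurable_EFinP.
  by move=> t _; rewrite lee_fin.
apply: (@le_trans _ _ (\int[mu]_(t in A) (n%:R)%:E)%E).
  apply: ge0_le_integral => //.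
  - by move=> t _; rewrite lee_fin.
  - exact: mgA.
  - by move=> t _; rewrite lee_fin /gn ge_min lexx orbT.
rewrite integral_cst//.
apply: (@le_trans _ _ (n.+1%:R%:E * (e / 2 / n.+1%:R)%:E)%E).
  apply: lee_pmul => //; last exact: ltW.
  by rewrite lee_fin ler_nat.
by rewrite -EFinM lee_fin mulrC mulfVK.
Unshelve. all: by end_near. Qed.

End absolute_continuity_of_the_integral.

Section interval_integral.
Context {R : realType}.
Notation LR := (lebesgueType R).
Notation mu := (@completed_lebesgue_measure R).
Implicit Types (a b c t : R) (g h : R -> R).

Definition intg a b g : Prop :=
  mu.-integrable (`[a, b]%classic : set LR) (fun t : LR => (g t)%:E).

Definition lint a b g : R := Rintegral mu (`[a, b]%classic : set LR) g.

Definition lmfun a b g : Prop :=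
  measurable_fun (`[a, b]%classic : set LR) (g : LR -> R).

Lemma measurable_cc a b : measurable (`[a, b]%classic : set LR).
Proof. exact: itv_lebesgue. Qed.

Lemma intg_lmfun a b g : intg a b g -> lmfun a b g.
Proof. by move=> /(measurable_int mu)/measurable_EFinP. Qed.

Lemma subset_cc a b a' b' : a <= a' -> b' <= b -> `[a', b'] `<=` `[a, b].
Proof.
move=> aa bb t /=; rewrite !in_itv/= => /andP[at' tb].
by rewrite (le_trans aa at')(le_trans tb bb).
Qed.

Lemma intgS a b a' b' g : a <= a' -> b' <= b -> intg a b g -> intg a' b' g.
Proof.
move=> aa bb.
exact: (integrableS (measurable_cc a b) (measurable_cc a' b') (subset_cc aa bb)).
Qed.

Lemma intgD a b g h : intg a b g -> intg a b h -> intg a b (fun t => g t + h t).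
Proof. by move=> ig ih; exact: (integrableD (measurable_cc a b) ig ih). Qed.

Lemma intgB a b g h : intg a b g -> intg a b h -> intg a b (fun t => g t - h t).
Proof. by move=> ig ih; exact: (integrableB (measurable_cc a b) ig ih). Qed.

Lemma intgZ a b k g : intg a b g -> intg a b (fun t => k * g t).
Proof. by move=> ig; exact: (integrableZl (measurable_cc a b) k ig). Qed.

Lemma intg_norm a b g : intg a b g -> intg a b (fun t => `|g t|).
Proof. by move=> ig; exact: (integrable_abse ig). Qed.

Lemma mu_cc_lty a b : (mu (`[a, b]%classic : set LR) < +oo)%E.
Proof.
have [ab|ba] := leP a b; first by rewrite mu_itv// ltry.
by rewrite set_itv_ge ?measure0// bnd_simp -ltNge.
Qed.

Lemma intg_gt a b g : b < a -> intg a b g.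
Proof.
move=> ba; have -> : intg a b g = (mu.-integrable (set0 : set LR) (fun t : LR => (g t)%:E)).
  by rewrite /intg set_itv_ge// bnd_simp -ltNge.
exact: integrable_set0.
Qed.

Lemma intg_bounded a b g M : lmfun a b g ->
  (forall t, a <= t -> t <= b -> `|g t| <= M) -> intg a b g.
Proof.
move=> mg gM; apply: (measurable_bounded_integrable (measurable_cc a b) (mu_cc_lty a b) mg).
exists M; split; first exact: num_real.
move=> x Mx t /=; rewrite in_itv/= => /andP[at' tb].
exact: le_trans (gM _ at' tb) (ltW Mx).
Qed.

Lemma intg_cst a b k : intg a b (cst k).
Proof. by apply: (@intg_bounded _ _ _ `|k|) => //; exact: measurable_cst. Qed.

Lemma ae_lmfun a b g h : lmfun a b g ->
  {ae mu, forall t : LR, `[a, b]%classic t -> g t = h t} -> lmfun a b h.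
Proof.
move=> /measurable_EFinP mg gh; apply/measurable_EFinP.
apply: (ae_measurable_fun completed_lebesgue_measure_is_complete) mg.
by apply: filterS gh => t gh /gh /= ->.
Qed.

Lemma le_intg a b g h : lmfun a b g -> intg a b h ->
  {ae mu, forall t : LR, `[a, b]%classic t -> `|g t| <= h t} -> intg a b g.
Proof.
move=> mg ih gh; apply/integrableP; split; first exact/measurable_EFinP.
have /integrableP[mh] := ih; apply: le_lt_trans.
have mg' := (measurable_EFinP _ (g : LR -> R)).2 mg.
apply: (@ae_ge0_le_integral _ LR R mu `[a, b]%classic (measurable_cc a b)).
- by move=> t _; exact: abse_ge0.
- exact: measurableT_comp mg'.
- by move=> t _; exact: abse_ge0.
- exact: measurableT_comp mh.
- apply: filterS gh => t gh abt; rewrite lee_fin; apply: le_trans (gh abt) _.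
  exact: ler_norm.
Qed.

Lemma ae_intg a b g h : intg a b g ->
  {ae mu, forall t : LR, `[a, b]%classic t -> g t = h t} -> intg a b h.
Proof.
move=> ig gh; apply: le_intg (intg_norm ig) _.
  exact: ae_lmfun (intg_lmfun ig) gh.
by apply: filterS gh => t gh /gh ->.
Qed.

Lemma ae_lint a b g h : lmfun a b g ->
  {ae mu, forall t : LR, `[a, b]%classic t -> g t = h t} ->
  lint a b g = lint a b h.
Proof.
move=> mg gh.
have mg' := (measurable_EFinP _ (g : LR -> R)).2 mg.
have mh' := (measurable_EFinP _ (h : LR -> R)).2 (ae_lmfun mg gh).
have gh' : ae_eq mu (`[a, b]%classic : set LR) (EFin \o (g : LR -> R)) (EFin \o (h : LR -> R)).
  by apply: filterS gh => t gh /gh /= ->.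
by have := ae_eq_integral _ _ (measurable_cc a b) mg' mh' gh'; rewrite /lint /Rintegral => /= ->.
Qed.

Lemma eq_lint a b g h : (forall t, a <= t -> t <= b -> g t = h t) ->
  lint a b g = lint a b h.
Proof.
move=> gh; apply: eq_Rintegral => t /set_mem /=; rewrite in_itv/= => /andP[? ?].
exact: gh.
Qed.

Lemma eq_intg a b g h : (forall t, a <= t -> t <= b -> g t = h t) ->
  intg a b g -> intg a b h.
Proof.
move=> gh; apply: (eq_integrable (measurable_cc a b)) => // t /set_mem /=.
by rewrite in_itv/= => /andP[? ?]; rewrite gh.
Qed.

Lemma lintD a b g h : intg a b g -> intg a b h ->
  lint a b (fun t => g t + h t) = lint a b g + lint a b h.
Proof. by move=> ig ih; exact: (RintegralD (measurable_cc a b) ig ih). Qed.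

Lemma lintB a b g h : intg a b g -> intg a b h ->
  lint a b (fun t => g t - h t) = lint a b g - lint a b h.
Proof. by move=> ig ih; exact: (RintegralB (measurable_cc a b) ig ih). Qed.

Lemma lintZ a b k g : intg a b g -> lint a b (fun t => k * g t) = k * lint a b g.
Proof. by move=> ig; exact: (RintegralZl _ (measurable_cc a b) ig). Qed.

Lemma lint_cst a b k : a <= b -> lint a b (cst k) = k * (b - a).
Proof. move=> ab; rewrite /lint (Rintegral_cst _ (measurable_cc a b)) -[b - a]/(fine (b - a)%:E).
by congr (_ * fine _); exact: mu_itv. Qed.

Lemma lint_ge0 a b g : (forall t, a <= t -> t <= b -> 0 <= g t) -> 0 <= lint a b g.
Proof.
move=> g0; apply: Rintegral_ge0 => t /=; rewrite in_itv/= => /andP[? ?].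
exact: g0.
Qed.

Lemma le_lint a b g h : intg a b g -> intg a b h ->
  {ae mu, forall t : LR, `[a, b]%classic t -> g t <= h t} ->
  lint a b g <= lint a b h.
Proof.
move=> ig ih gh; pose m t := Num.min (g t) (h t).
have gm : {ae mu, forall t : LR, `[a, b]%classic t -> g t = m t}.
  by apply: filterS gh => t gh /gh ght; rewrite /m min_l.
rewrite (ae_lint (intg_lmfun ig) gm).
apply: (le_Rintegral (measurable_cc a b) (ae_intg ig gm) ih).
by move=> t _; rewrite /m ge_min lexx orbT.
Qed.

Lemma lint_norm a b g : intg a b g -> `|lint a b g| <= lint a b (fun t => `|g t|).
Proof. by move=> ig; exact: (le_normr_Rintegral (measurable_cc a b) ig). Qed.

Lemma lint_point a g : lint a a g = 0.
Proof.
rewrite /lint /Rintegral set_itv1.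
have m1 : measurable ([set a] : set LR) by rewrite -set_itv1; exact: itv_lebesgue.
have e : measurable_fun ([set a] : set LR) (fun t : LR => (g t)%:E).
  exact: measurable_fun_set1.
by rewrite (null_set_integral m1 e (mu_set1 a)).
Qed.

Lemma lint_empty a b g : b <= a -> lint a b g = 0.
Proof.
rewrite le_eqVlt => /predU1P[->|ba]; first exact: lint_point.
by rewrite /lint set_itv_ge ?Rintegral_set0// bnd_simp -ltNge.
Qed.

Lemma lint_split c a b g : a <= c -> c <= b -> intg a b g ->
  lint a b g = lint a c g + lint c b g.
Proof.
move=> ac cb ig.
have E : `[a, b]%classic = `[a, c]%classic `|` `]c, b]%classic.
  by rewrite -itv_bndbnd_setU// bnd_simp.
have D : [disjoint `[a, c]%classic & `]c, b]%classic].
  apply/disj_setPS => t [/=]; rewrite !in_itv/= => /andP[_ tc] /andP[ct _].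
  by move: ct; rewrite ltNge tc.
have iE : mu.-integrable (`[a, c]%classic `|` `]c, b]%classic : set LR)
  (EFin \o (g : LR -> R)) by rewrite -E.
rewrite {1}/lint E (Rintegral_setU (measurable_cc a c) (itv_lebesgue _) iE D).
congr (_ + _).
have E2 : `[c, b]%classic = [set c] `|` `]c, b]%classic.
  by rewrite setU1itv// bnd_simp.
have D2 : [disjoint [set c] & `]c, b]%classic].
  apply/disj_setPS => t [/= ->]; rewrite !in_itv/= => /andP[ct _].
  by rewrite ltxx in ct.
have iE2 : mu.-integrable ([set c] `|` `]c, b]%classic : set LR)
  (EFin \o (g : LR -> R)) by rewrite -E2; exact: intgS ig.
have m1 : measurable ([set c] : set LR) by rewrite -set_itv1; exact: itv_lebesgue.
rewrite /lint E2 (Rintegral_setU m1 (itv_lebesgue _) iE2 D2).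
suff -> : Rintegral mu ([set c] : set LR) g = 0 by rewrite add0r.
by rewrite -(lint_point c g) /lint set_itv1.
Qed.

Lemma lint_dct a b (g_ : nat -> R -> R) g h :
  (forall n, lmfun a b (g_ n)) -> lmfun a b g -> intg a b h ->
  {ae mu, forall t : LR, `[a, b]%classic t -> g_ ^~ t @ \oo --> g t} ->
  (forall n, {ae mu, forall t : LR, `[a, b]%classic t -> `|g_ n t| <= h t}) ->
  lint a b (g_ n) @[n --> \oo] --> lint a b g.
Proof.
move=> mg_ mg ih cg gh.
have mE_ n : measurable_fun (`[a, b]%classic : set LR) (fun t : LR => (g_ n t)%:E).
  by apply/measurable_EFinP; exact: mg_.
have mE : measurable_fun (`[a, b]%classic : set LR) (fun t : LR => (g t)%:E).
  by apply/measurable_EFinP; exact: mg.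
have cE : {ae mu, forall t : LR, `[a, b]%classic t ->
    (fun n => (g_ n t)%:E) @ \oo --> (g t)%:E}.
  apply: filterS cg => t cg abt; apply: cvg_EFin (cg abt); exact: nearW.
have gE : {ae mu, forall (t : LR) n, `[a, b]%classic t -> (`|(g_ n t)%:E| <= (h t)%:E)%E}.
  by apply: filterS (ae_foralln gh) => t gh' n abt; rewrite lee_fin; exact: gh'.
have [ig _ cv] := dominated_convergence (measurable_cc a b) mE_ mE cE ih gE.
apply: fine_cvg.
by rewrite /lint/Rintegral fineK ?(integrable_fin_num (measurable_cc a b) ig).
Qed.

Lemma cont_lmfun a b g : continuous g -> lmfun a b g.
Proof.
move=> cg; apply: measurable_funTS; apply: borel_fun_lebesgue.
exact: continuous_measurable_fun.
Qed.

Lemma lint_abs_cont a b g (e : R) : intg a b g -> 0 < e ->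
  exists2 d : R, 0 < d & forall A : set R, measurable (A : set LR) ->
    A `<=` `[a, b] -> (mu A < d%:E)%E ->
    (\int[mu]_(t in (A : set LR)) `|g t|%:E < e%:E)%E.
Proof. by move=> ig e0; exact: (integral_abs_continuous (measurable_cc a b) ig e0). Qed.

End interval_integral.

(** * Absolute continuity and the fundamental theorem of calculus *)

Section scalar_absolute_continuity.
Context {R : realType}.
Notation LR := (lebesgueType R).
Notation mu := (@completed_lebesgue_measure R).
Implicit Types (a b c : R) (g h x : R -> R).

(** [abs_continuous] for real-valued functions; a vector-valued function is absolutely
    continuous when its coordinates are ([abs_continuous_coord]). *)
Definition scalar_ac a b x : Prop := forall e : R, 0 < e -> exists2 d : R, 0 < d &
  forall (N : nat) (s t : 'I_N -> R),
    (forall i, a <= s i /\ s i <= t i /\ t i <= b) ->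
    trivIset [set: 'I_N] (fun i => `]s i, t i[%classic) ->
    \sum_i (t i - s i) < d -> \sum_i `|x (t i) - x (s i)| < e.

Lemma integral_oo a b g : a <= b -> intg a b g -> (forall t, 0 <= g t) ->
  (\int[mu]_(t in (`]a, b[%classic : set LR)) (g t)%:E = (lint a b g)%:E)%E.
Proof.
move=> ab ig g0.
rewrite /lint /Rintegral fineK; last exact: (integrable_fin_num (measurable_cc a b) ig).
pose N : set LR := [set a] `|` [set b].
have m1 c : measurable ([set c] : set LR) by rewrite -set_itv1; exact: itv_lebesgue.
have mN : measurable N by apply: measurableU; exact: m1.
have N0 : mu N = 0%E by exact: (null_set_setU (m1 a) (m1 b) (mu_set1 a) (mu_set1 b)).
rewrite (negligible_integral mN (measurable_cc a b) ig N0).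
congr (integral _ _ _); apply/seteqP; split => t /=; rewrite !in_itv/=.
  move=> /andP[at_ tb]; rewrite !ltW//; split => // -[]/= E.
    by rewrite E ltxx in at_.
  by rewrite E ltxx in tb.
move=> [/andP[at_ tb] /not_orP[ta t_b]].
by rewrite !lt_neqAle at_ tb !andbT eq_sym; apply/andP; split; apply/eqP.
Qed.

Lemma measure_disjoint_oo N (s t : 'I_N -> R) : (forall i, s i <= t i) ->
  trivIset [set: 'I_N] (fun i => `]s i, t i[%classic) ->
  mu (\big[setU/set0]_(i < N) (`]s i, t i[%classic : set LR)) =
  (\sum_i (t i - s i))%:E.
Proof.
move=> st tI; rewrite (measure_bigsetU_ord mu predT (fun i => itv_lebesgue _) tI).
by rewrite -sumEFin; apply: eq_bigr => i _; exact: mu_itv.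
Qed.

(** The absolute continuity of the integral, applied to the union of the intervals. *)
Lemma lint_disjoint_small a b g (e : R) : intg a b g -> 0 < e ->
  exists2 d : R, 0 < d &
  forall (N : nat) (s t : 'I_N -> R),
    (forall i, a <= s i /\ s i <= t i /\ t i <= b) ->
    trivIset [set: 'I_N] (fun i => `]s i, t i[%classic) ->
    \sum_i (t i - s i) < d -> \sum_i lint (s i) (t i) (fun r => `|g r|) < e.
Proof.
move=> ig e0; have [d d0 H] := lint_abs_cont ig e0.
exists d => // N s t st tI dst.
pose A : set LR := \big[setU/set0]_(i < N) (`]s i, t i[%classic : set LR).
have mA : measurable A by apply: bigsetU_measurable => i _; exact: itv_lebesgue.
have Aab : A `<=` `[a, b].
  move=> r; rewrite /A -bigcup_seq => -[i _] /=; rewrite !in_itv/=.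
  move=> /andP[sr rt]; have [asi [_ tb]] := st i.
  by rewrite (le_trans asi (ltW sr)) (le_trans (ltW rt) tb).
have /(H A mA Aab) : (mu A < d%:E)%E.
  by rewrite measure_disjoint_oo// => i; have [_ []] := st i.
have tA : trivIset [set` index_enum 'I_N] (fun i => `]s i, t i[%classic : set LR).
  exact: sub_trivIset tI.
have mgA : measurable_fun A (fun r : LR => `|g r|%:E).
  apply: measurable_funS (measurable_cc a b) Aab _.
  by apply/measurable_EFinP; exact: (intg_lmfun (intg_norm ig)).
have gA0 r : A r -> (0 <= `|g r|%:E)%E by rewrite lee_fin.
rewrite (ge0_integral_bigsetU mu (fun i => itv_lebesgue _) (index_enum_uniq _) tA mgA gA0).
rewrite (eq_bigr (fun i => (lint (s i) (t i) (fun r => `|g r|))%:E)).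
  by rewrite sumEFin lte_fin.
move=> i _; have [asi [sti tib]] := st i; apply: integral_oo => //.
exact/intg_norm/(intgS asi tib ig).
Qed.

Lemma lint_itv a s t b g : a <= s -> s <= t -> t <= b -> intg a b g ->
  lint a t g - lint a s g = lint s t g.
Proof.
move=> as_ st tb ig.
have -> : lint a t g = lint a s g + lint s t g.
  by apply: (lint_split as_ st); apply: intgS ig.
by rewrite addrAC subrr add0r.
Qed.

Lemma scalar_ac_lint a b g : intg a b g -> scalar_ac a b (fun t => lint a t g).
Proof.
move=> ig e e0; have [d d0 H] := lint_disjoint_small ig e0.
exists d => // N s t st tI /(H _ _ _ st tI); apply: le_lt_trans.
apply: ler_sum => i _; have [asi [sti tib]] := st i.
rewrite (lint_itv asi sti tib ig); apply: lint_norm; exact: intgS ig.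
Qed.

Lemma scalar_acB a b x y : scalar_ac a b x -> scalar_ac a b y -> scalar_ac a b (fun t => x t - y t).
Proof.
move=> sx sy e e0; have e20 : 0 < e / 2 by rewrite divr_gt0.
have [d d0 H] := sx _ e20; have [d' d'0 H'] := sy _ e20.
exists (Num.min d d') => [|N s t st tI]; first by rewrite lt_min d0.
rewrite lt_min => /andP[/(H _ _ _ st tI) h /(H' _ _ _ st tI) h'].
rewrite (splitr e); apply: le_lt_trans (ltrD h h').
rewrite -big_split/=; apply: ler_sum => i _.
rewrite (_ : _ - _ = (x (t i) - x (s i)) - (y (t i) - y (s i))); last by ring.
exact: ler_normB.
Qed.

End scalar_absolute_continuity.

Section differentiation_of_the_integral.
Context {R : realType}.
Notation LR := (lebesgueType R).
Notation mu := (@completed_lebesgue_measure R).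
Implicit Types (a b c : R) (g h x : R -> R).

(** The identity is measurable from the completed sigma-algebra to the Borel one and
    pushes the completed measure to the Borel one. *)
Lemma lebesgue_integral_borel (D : set R) h :
  measurable (D : set (measurableTypeR R)) ->
  measurable_fun (setT : set (measurableTypeR R)) h ->
  mu.-integrable (D : set LR) (EFin \o (h : LR -> R)) ->
  lebesgue_measure.-integrable D (EFin \o h) /\
  Rintegral lebesgue_measure D h = Rintegral mu (D : set LR) h.
Proof.
move=> mD mh ih.
pose phi : LR -> measurableTypeR R := idfun.
have mphi : measurable_fun (setT : set LR) phi.
  by move=> _ Y mY; rewrite setTI; exact: borel_lebesgue.
have mh' := (measurable_EFinP _ _).2 mh.
split.
  exact: (integrable_pushforward mphi mh' ih mD).
congr fine; exact: (integral_pushforward mphi mh' ih mD).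
Qed.

Lemma ae_lebesgue_completed (P : R -> Prop) :
  {ae (@lebesgue_measure R), forall t, P t} -> {ae mu, forall t : LR, P t}.
Proof.
by move=> [N [mN N0 PN]]; exists N; split => //; exact: borel_lebesgue.
Qed.

Lemma aeS (P Q : R -> Prop) : {ae mu, forall t : LR, P t} ->
  (forall t, P t -> Q t) -> {ae mu, forall t : LR, Q t}.
Proof.
move=> aP PQ.
exact: (@filterS _ _ (ae_filter_ringOfSetsType mu) P Q PQ aP).
Qed.

Lemma ae2 (P Q S : R -> Prop) : {ae mu, forall t : LR, P t} ->
  {ae mu, forall t : LR, Q t} -> (forall t, P t -> Q t -> S t) ->
  {ae mu, forall t : LR, S t}.
Proof.
move=> aP aQ PQS.
exact: (@filterS2 _ _ (ae_filter_ringOfSetsType mu) P Q S PQS aP aQ).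
Qed.

(** Lebesgue's differentiation theorem for a Borel function that agrees with g almost
    everywhere, and hence has the same indefinite integral. *)
Lemma lint_derive a b g : intg a b g ->
  {ae mu, forall t : LR, `]a, b[%classic t ->
    is_derive (t : R) (1 : R) (fun s => lint a s g) (g t)}.
Proof.
move=> ig.
have [h mh hg] := borel_modification (measurable_cc a b) (intg_lmfun ig).
pose H := h \_ (`[a, b]%classic : set R).
have mH : measurable_fun (setT : set (measurableTypeR R)) H.
  apply/(measurable_restrictT _ _).1; first exact: measurable_itv.
  exact: measurable_funS mh.
have gH : {ae mu, forall t : LR, `[a, b]%classic t -> g t = H t}.
  by apply: filterS hg => t hg abt; rewrite /H patchE mem_set// hg.
have iH : intg a b H := ae_intg ig gH.
have [iHl _] := lebesgue_integral_borel (measurable_itv _) mH iH.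
have mcc y : measurable (`[a, y]%classic : set (measurableTypeR R)) by exact: measurable_itv.
have iHT : lebesgue_measure.-integrable setT (EFin \o H).
  rewrite (_ : EFin \o H = (EFin \o h) \_ `[a, b]%classic); last by rewrite restrict_EFin.
  apply/(integrable_mkcond _ (mcc b)).1.
  apply: eq_integrable iHl; first exact: mcc.
  by move=> t tab; rewrite /H/= patchE tab.
have lH : locally_integrable setT H.
  by apply: open_integrable_locally => //; exact: openT.
have iHy y : lebesgue_measure.-integrable `[a, y] (EFin \o H).
  by apply: integrableS iHT => //; exact: mcc.
have ftc := FTC1 iHy lH.
have {}ftc := ae_lebesgue_completed ftc.
apply: (ae2 ftc gH) => t /= ftct gHt; rewrite in_itv/= => /andP[at_ tb].
have ate : (a%:E < t%:E)%E by rewrite lte_fin.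
have [dF F't] := ftct ate.
rewrite gHt; last by rewrite /= in_itv/= !ltW.
pose F s : R := Rintegral lebesgue_measure `[a, s]%classic H.
have dF' : is_derive t (1 : R) F (H t).
  by rewrite -F't derive1E; exact: derivableP.
apply: (near_eq_is_derive _ dF').
have : \forall s \near t, s \in `]a, b[ by apply: near_in_itvoo; rewrite in_itv/= at_.
apply: filterS => s; rewrite in_itv/= => /andP[as_ sb].
have iHs : intg a s H by exact: intgS (lexx a) (ltW sb) iH.
have [_ E] := lebesgue_integral_borel (mcc s) mH iHs.
rewrite /F E; apply/esym; apply: ae_lint.
  exact: intg_lmfun (intgS (lexx a) (ltW sb) ig).
by apply: filterS gH => r + ars; apply; apply: subset_cc ars => //; exact: ltW.
Qed.

End differentiation_of_the_integral.

Section zero_derivative.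
Context {R : realType}.
Notation LR := (lebesgueType R).
Notation mu := (@completed_lebesgue_measure R).
Implicit Types (a b c : R) (g h x : R -> R).

(** A certificate that h varies little between a and s: the increment is at most
    e (s - a), up to increments over finitely many ordered intervals [l i, r i] in U. *)
Definition chained (e : R) (U : set R) h a (s : R) : Prop :=
  exists (N : nat) (l r : nat -> R),
  [/\ forall i, (i < N)%N -> [/\ a <= l i, l i <= r i & r i <= s],
      forall i j, (i < j)%N -> (j < N)%N -> r i <= l j,
      forall i, (i < N)%N -> `[l i, r i] `<=` U &
      `|h s - h a| <= e * (s - a) + \sum_(i < N) `|h (r i) - h (l i)|].

Lemma chained_step e U h a s s' : 0 < e -> a <= s -> s <= s' -> chained e U h a s ->
  `|h s' - h s| <= e * (s' - s) \/ `[s, s'] `<=` U -> chained e U h a s'.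
Proof.
move=> e0 as_ ss' [N [l [r [H1 H2 H3 H4]]]] [small|sU].
  exists N, l, r; split => //.
    by move=> i /H1[? ? rs]; split => //; exact: le_trans ss'.
  have -> : h s' - h a = (h s' - h s) + (h s - h a) by ring.
  apply: le_trans (ler_normD _ _) _; apply: le_trans (lerD small H4) _.
  by rewrite addrA -mulrDr addrA subrK.
exists N.+1, (fun i => if (i < N)%N then l i else s), (fun i => if (i < N)%N then r i else s').
split.
- move=> i; rewrite ltnS => iN; case: ifPn => [/H1[? ? rs]|_]; split => //.
  exact: le_trans ss'.
- move=> i j ij; rewrite ltnS => jN; rewrite (leq_trans ij jN).
  case: ifPn => [jN'|_]; first exact: H2.
  by have [] := H1 _ (leq_trans ij jN).
- move=> i; rewrite ltnS => iN; case: ifPn => [/H3//|_] //.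
- rewrite big_ord_recr/= ltnn (eq_bigr (fun i : 'I_N => `|h (r i) - h (l i)|)); last first.
    by move=> i _; rewrite ltn_ord.
  have -> : h s' - h a = (h s' - h s) + (h s - h a) by ring.
  apply: le_trans (ler_normD _ _) _.
  rewrite addrA addrC; apply: lerD => //; apply: le_trans H4 _.
  by rewrite lerD2r ler_pM2l// lerB.
Qed.

(** The interval must be allowed to contain c in its interior: in the supremum argument
    below, the point already reached is merely known to lie close to c on its left. *)
Lemma is_derive0_straddle h c (e : R) : 0 < e -> is_derive c (1 : R) h 0 ->
  exists2 d : R, 0 < d & forall s s', s <= c -> c <= s' ->
    c - d < s -> s' < c + d -> `|h s' - h s| <= e * (s' - s).
Proof.
move=> e0 [dh h'].
have cv : (fun k => k^-1 *: (h (k *: (1 : R) + c) - h c)) @ 0^' --> 'D_1 h c by exact: dh.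
rewrite h' in cv; have /cvgrPdist_le/(_ _ e0) := cv.
rewrite /= => /nbhs_ballP[d /= d0 H]; exists d => //.
have near_c r : c - d < r -> r < c + d -> `|h r - h c| <= e * `|r - c|.
  move=> cr rc; have [->|rnc] := eqVneq r c; first by rewrite !subrr normr0 mulr0.
  have rc0 : r - c != 0 by rewrite subr_eq0.
  have := H (r - c); rewrite /ball/= sub0r normrN ltr_norml.
  move=> /(_ _ rc0); rewrite sub0r normrN scaler1 subrK normrM normfV.
  rewrite mulrC ler_pdivrMr ?normr_gt0//; apply.
  by apply/andP; split; lra.
move=> s s' sc cs' ds s'd.
have -> : h s' - h s = (h s' - h c) - (h s - h c) by ring.
apply: le_trans (ler_normB _ _) _.
apply: le_trans (lerD (near_c _ _ _) (near_c _ _ _)) _; [lra|lra|lra|lra|].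
rewrite -mulrDr ler_pM2l// [`|s' - c|]ger0_norm ?subr_ge0//.
rewrite [`|s - c|]ler0_norm ?subr_le0//; lra.
Qed.

(** The points of ]a, b[ where h' is not 0, together with a and b, lie in an open set U
    of small measure.  Any point c of [a, b] can be crossed at cost e times the length
    crossed if h' = 0 at c, and inside U otherwise; so the supremum of the s with a
    certificate [chained] is reached and equals b.  The increments over the intervals
    in U add up to less than e by absolute continuity.  This compactness argument plays
    the part of Vitali's covering theorem. *)
Lemma scalar_ac_derive0_cst a b h : a <= b -> scalar_ac a b h ->
  {ae mu, forall t : LR, `]a, b[%classic t -> is_derive (t : R) (1 : R) h 0} ->
  h b = h a.
Proof.
move=> ab ach ah; apply/eqP; rewrite -subr_eq0 -normr_le0.
apply/ler_addgt0Pr => e' e'0; rewrite add0r.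
pose e := e' / (b - a + 1).
have ba0 : 0 < b - a + 1 by rewrite ltr_wpDl ?subr_ge0.
have e0 : 0 < e by rewrite divr_gt0.
have [d d0 Hd] := ach e e0.
have [U oU [EU mU]] : exists2 U : set R, open U & (~` [set t | `]a, b[%classic t ->
   is_derive (t : R) (1 : R) h 0] `|` [set a] `|` [set b] `<=` U) /\ (mu U < d%:E)%E.
  apply: open_cover_negligible => //.
  have n1 r : mu.-negligible ([set r] : set LR).
    by exists [set r]; split; [rewrite -set_itv1; exact: itv_lebesgue|exact: mu_set1|].
  exact: negligibleU (negligibleU ah (n1 a)) (n1 b).
have gauge c : a <= c -> c <= b -> exists2 n : R, 0 < n & forall s s', s <= c -> c <= s' ->
    c - n < s -> s' < c + n -> `|h s' - h s| <= e * (s' - s) \/ `[s, s'] `<=` U.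
  move=> ac cb; have [cU|cU] := pselect (U c).
    have /nbhs_ballP[n /= n0 nU] : nbhs c U by exact: open_nbhs_nbhs.
    exists n => // s s' sc cs' ns s'n; right => t /=; rewrite in_itv/= => /andP[st ts'].
    by apply: nU; rewrite /ball/= ltr_norml; apply/andP; split; lra.
  have abc : is_derive c (1 : R) h 0.
    apply: contrapT => nd; apply: cU; apply: EU.
    have [->|ca] := eqVneq c a; first by left; right.
    have [->|cb'] := eqVneq c b; first by right.
    left; left => /= H; apply/nd/H; rewrite in_itv/=.
    by rewrite !lt_neqAle ac cb cb' eq_sym ca.
  have [n n0 Hn] := is_derive0_straddle e0 abc.
  by exists n => // s s' sc cs' ns s'n; left; exact: Hn.
pose S := [set s | [/\ a <= s, s <= b & chained e U h a s]].
have Sa : S a.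
  split => //; exists 0%N, (fun=> a), (fun=> a); split => //.
  by rewrite big_ord0 !subrr normr0 mulr0 addr0.
have ubS : ubound S b by move=> s [].
have supS : has_sup S by split; [exists a|exists b].
pose c := sup S.
have ac : a <= c by apply: ub_le_sup => //; exists b.
have cb : c <= b by apply: ge_sup => //; exists a.
have [n n0 Hn] := gauge c ac cb.
have [s [as_ sb Ps] cs] := sup_adherent n0 supS.
have sc : s <= c by apply: ub_le_sup; [exists b|split].
pose s' := Num.min b (c + n / 2).
have cs' : c <= s' by rewrite /s' le_min cb lerDl divr_ge0// ltW.
have s'n : s' < c + n by rewrite /s' gt_min; apply/orP; right; lra.
have Ps' : chained e U h a s'.
  by apply: (chained_step e0 _ _ Ps) => //; [exact: le_trans sc cs'|exact: Hn].
have Ss' : S s' by split => //; [exact: le_trans ac cs'|rewrite /s' ge_min lexx].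
have s'c : s' <= c by apply: ub_le_sup => //; exists b.
have s'b : s' = b.
  by move: s'c; rewrite /s' ge_min => /orP[bc|]; [rewrite min_l//; lra|lra].
rewrite s'b in Ps' *.
have [N [l [r [H1 H2 H3 H4]]]] := Ps'.
apply: le_trans H4 _.
apply: (@le_trans _ _ (e * (b - a) + e)); last first.
  by rewrite -{2}[e]mulr1 -mulrDr /e mulfVK// gt_eqF.
rewrite lerD2l; apply: ltW.
have tI : trivIset [set: 'I_N] (fun i => `]l i, r i[%classic).
  apply/trivIsetP => i j _ _; wlog ij : i j / (i < j)%N => [H|_].
    by rewrite neq_ltn => /orP[ij|ji]; [|rewrite setIC]; apply: H => //;
      rewrite neq_ltn ?ij ?ji ?orbT.
  apply/seteqP; split => // t /=; rewrite !in_itv/= => -[/andP[_ tr] /andP[lt _]].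
  have := H2 _ _ ij (ltn_ord j); lra.
apply: (Hd N (fun i => l i) (fun i => r i)) => //.
  by move=> i; have [] := H1 _ (ltn_ord i).
rewrite -lte_fin -measure_disjoint_oo//; last by move=> i; have [] := H1 _ (ltn_ord i).
apply: le_lt_trans mU; apply: le_measure; rewrite ?inE.
- by apply: bigsetU_measurable => i _; exact: itv_lebesgue.
- by apply: borel_lebesgue; exact: open_measurable.
- rewrite -bigcup_seq => t [i _ /=]; rewrite in_itv/= => /andP[lt tr].
  by apply: (H3 _ (ltn_ord i)); rewrite /= in_itv/= !ltW.
Qed.

(** x and the indefinite integral of g differ by a function of zero derivative. *)
Lemma ftc2 a b t x g : a <= t -> t <= b -> scalar_ac a b x -> intg a b g ->
  {ae mu, forall t : LR, `]a, b[%classic t -> is_derive (t : R) (1 : R) x (g t)} ->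
  x t = x a + lint a t g.
Proof.
move=> at_ tb sx ig dx.
have sS y : scalar_ac a b y -> scalar_ac a t y.
  move=> sy e e0; have [d d0 H] := sy e e0; exists d => // N s r sr.
  by apply: H => i; have [? [? ?]] := sr i; split => //; split => //; exact: le_trans tb.
pose h s := x s - lint a s g.
suff : h t = h a by rewrite /h lint_point subr0 => <-; rewrite subrK.
apply: scalar_ac_derive0_cst => //; first exact: sS (scalar_acB sx (scalar_ac_lint ig)).
apply: (ae2 dx (lint_derive ig)) => s /= xs gs sat.
have sab : s \in `]a, b[.
  by move: sat; rewrite !in_itv/= => /andP[-> /=] /lt_le_trans; exact.
rewrite -(subrr (g s)); exact: is_deriveB (xs sab) (gs sab).
Qed.

End zero_derivative.

(** * Norms on column vectors *)

Section norms.
Context {R : realType}.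

Lemma coord_le k (x : 'cV[R]_k) i : `|x i ord0| <= `|x|.
Proof.
rewrite [leRHS]/Num.Def.normr/= mx_normrE.
exact: (le_bigmax _ (fun ij : 'I_k * 'I_1 => `|x ij.1 ij.2|) (i, ord0)).
Qed.

Lemma cV_norm_le k (x : 'cV[R]_k) (e : R) : 0 <= e ->
  (forall i, `|x i ord0| <= e) -> `|x| <= e.
Proof.
move=> e0 H; rewrite [leLHS]/Num.Def.normr/= mx_normrE.
by apply: bigmax_le => // -[i j] _ /=; rewrite ord1.
Qed.

Lemma mulmx_norm_le k l (M : 'M[R]_(k, l)) (x : 'cV[R]_l) :
  `|M *m x| <= (l%:R * `|M|) * `|x|.
Proof.
apply: cV_norm_le => [|i]; first by rewrite !mulr_ge0.
rewrite mxE; apply: le_trans (ler_norm_sum _ _ _) _.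
rewrite -mulrA mulr_natl -[leRHS](_ : \sum_(j < l) (`|M| * `|x|) = _); last first.
  by rewrite sumr_const card_ord.
apply: ler_sum => j _; rewrite normrM; apply: ler_pM => //; last exact: coord_le.
rewrite [leRHS]/Num.Def.normr/= mx_normrE.
exact: (le_bigmax _ (fun ij : 'I_k * 'I_l => `|M ij.1 ij.2|) (i, j)).
Qed.

Lemma enorm_ge0 k (x : 'cV[R]_k) : 0 <= enorm x.
Proof. exact: sqrtr_ge0. Qed.

Lemma enorm_sqr k (x : 'cV[R]_k) : enorm x ^+ 2 = \sum_i x i ord0 ^+ 2.
Proof. by rewrite sqr_sqrtr// sumr_ge0// => i _; exact: sqr_ge0. Qed.

Lemma coord_enorm k (x : 'cV[R]_k) i : `|x i ord0| <= enorm x.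
Proof.
rewrite -sqrtr_sqr ler_wsqrtr// (bigD1 i)//= lerDl sumr_ge0// => j _.
exact: sqr_ge0.
Qed.

Lemma norm_enorm k (x : 'cV[R]_k) : `|x| <= enorm x.
Proof. by apply: cV_norm_le => [|i]; [exact: enorm_ge0|exact: coord_enorm]. Qed.

Lemma enormZ k (c : R) (x : 'cV[R]_k) : enorm (c *: x) = `|c| * enorm x.
Proof.
rewrite /enorm -sqrtr_sqr -sqrtrM ?sqr_ge0//; congr Num.sqrt.
by rewrite mulr_sumr; apply: eq_bigr => i _; rewrite mxE exprMn.
Qed.

Lemma enorm0_eq0 k (x : 'cV[R]_k) : enorm x = 0 -> x = 0.
Proof.
move=> x0; apply/matrixP => i j; rewrite ord1 mxE; apply/eqP.
by rewrite -normr_le0 -x0 coord_enorm.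
Qed.

Lemma enorm0 k : enorm (0 : 'cV[R]_k) = 0.
Proof. by rewrite -(scale0r 0) enormZ normr0 mul0r. Qed.

(** Cauchy-Schwarz, from the expansion of the squares (|y| x_i - |x| y_i)^2. *)
Lemma enorm_dot k (x y : 'cV[R]_k) :
  \sum_i x i ord0 * y i ord0 <= enorm x * enorm y.
Proof.
have [/enorm0_eq0 ->|x0] := eqVneq (enorm x) 0.
  by rewrite enorm0 mul0r big1// => i _; rewrite mxE mul0r.
have [/enorm0_eq0 ->|y0] := eqVneq (enorm y) 0.
  by rewrite enorm0 mulr0 big1// => i _; rewrite mxE mulr0.
have xp : 0 < enorm x by rewrite lt_neqAle eq_sym x0 enorm_ge0.
have yp : 0 < enorm y by rewrite lt_neqAle eq_sym y0 enorm_ge0.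
set a := enorm x in xp x0 *; set b := enorm y in yp y0 *.
have : \sum_i (b * x i ord0 - a * y i ord0) ^+ 2 >= 0.
  by apply: sumr_ge0 => i _; exact: sqr_ge0.
rewrite (eq_bigr (fun i => (b ^+ 2 * x i ord0 ^+ 2 + a ^+ 2 * y i ord0 ^+ 2)
   - (2 * (a * b)) * (x i ord0 * y i ord0))); last by move=> i _; ring.
rewrite sumrB big_split/= -!mulr_sumr -!enorm_sqr -/a -/b.
have -> : b ^+ 2 * a ^+ 2 + a ^+ 2 * b ^+ 2 = (2 * (a * b)) * (a * b) by ring.
by rewrite -mulrBr pmulr_rge0 ?subr_ge0// !mulr_gt0.
Qed.

Lemma enormD k (x y : 'cV[R]_k) : enorm (x + y) <= enorm x + enorm y.
Proof.
rewrite -(@ler_pXn2r _ 2)// ?nnegrE ?enorm_ge0 ?addr_ge0 ?enorm_ge0//.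
rewrite enorm_sqr (eq_bigr (fun i => (x i ord0 ^+ 2 + y i ord0 ^+ 2)
   + 2 * (x i ord0 * y i ord0))); last by move=> i _; rewrite mxE; ring.
rewrite !big_split/= -mulr_sumr -!enorm_sqr.
have := enorm_dot x y; nra.
Qed.

Lemma enorm_le_sum k (x : 'cV[R]_k) : enorm x <= \sum_i `|x i ord0|.
Proof.
have s0 : 0 <= \sum_i `|x i ord0| by exact: sumr_ge0.
rewrite -(ger0_norm s0) -sqrtr_sqr ler_wsqrtr//.
rewrite expr2 big_distrl/=; apply: ler_sum => i _.
rewrite -real_normK ?num_real// expr2; apply: ler_wpM2l => //.
by rewrite (bigD1 i)//= lerDl sumr_ge0.
Qed.

Lemma enorm_norm k (x : 'cV[R]_k) : enorm x <= k%:R * `|x|.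
Proof.
apply: le_trans (enorm_le_sum x) _; rewrite mulr_natl.
rewrite -[leRHS](_ : \sum_(j < k) `|x| = _); last by rewrite sumr_const card_ord.
by apply: ler_sum => i _; exact: coord_le.
Qed.

Lemma opnorm_ge k l (M : 'M[R]_(k, l)) (u : 'cV[R]_l) :
  enorm (M *m u) <= opnorm M * enorm u.
Proof.
have [/enorm0_eq0 ->|u0] := eqVneq (enorm u) 0.
  by rewrite mulmx0 !enorm0 mulr0.
have up : 0 < enorm u by rewrite lt_neqAle eq_sym u0 enorm_ge0.
rewrite -ler_pdivrMr// mulrC -[_^-1]ger0_norm ?invr_ge0 ?enorm_ge0// -enormZ.
apply: ub_le_sup.
  exists (k%:R * (l%:R * `|M|)) => _ [v /= v1 <-].
  apply: le_trans (enorm_norm _) _; apply: ler_wpM2l => //.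
  apply: le_trans (mulmx_norm_le _ _) _; apply: ler_piMr; first by rewrite mulr_ge0.
  exact: le_trans (norm_enorm v) v1.
exists ((enorm u)^-1 *: u); last by rewrite scalemxAr.
by rewrite /= enormZ ger0_norm ?invr_ge0 ?enorm_ge0// mulVf.
Qed.

Lemma near_norm_le (V : normedModType R) (u : V) (e : R) : 0 < e ->
  \forall v \near u, `|u - v| <= e.
Proof. by move=> e0; apply: (@cvgr_dist_le _ _ _ (nbhs u) _ id u). Qed.

(** Heine-Borel holds for row vectors, and transposition is continuous and isometric. *)
Lemma compact_cV_ball k (r : R) : compact [set w : 'cV[R]_k | `|w| <= r].
Proof.
have E : [set w : 'cV[R]_k | `|w| <= r] = trmx @` [set w : 'rV[R]_k | `|w| <= r].
  have nT (u : 'rV[R]_k) : `|u^T| <= `|u|.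
    apply: cV_norm_le => // i; rewrite mxE [leRHS]/Num.Def.normr/= mx_normrE.
    exact: (le_bigmax _ (fun ij : 'I_1 * 'I_k => `|u ij.1 ij.2|) (ord0, i)).
  have nT' (u : 'cV[R]_k) : `|u^T| <= `|u|.
    rewrite [leLHS]/Num.Def.normr/= mx_normrE; apply: bigmax_le => // -[i j] _ /=.
    rewrite mxE ord1; exact: coord_le.
  apply/seteqP; split => [w /= wr|_ [w /= wr <-]]; last exact: le_trans (nT _) wr.
  by exists w^T; [exact: le_trans (nT' _) wr|rewrite trmxK].
have cT : continuous (trmx : 'rV[R]_k -> 'cV[R]_k).
  move=> u; apply/(@cvgrPdist_le _ _ _ (nbhs u)) => e e0.
  have : \forall v \near u, `|u - v| <= e by exact: near_norm_le.
  apply: filterS => v uve.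
  rewrite -linearB/=; apply: cV_norm_le => [|i]; first exact: ltW.
  rewrite mxE; apply: le_trans uve.
  rewrite [leRHS]/Num.Def.normr/= mx_normrE.
  exact: (le_bigmax _ (fun ij : 'I_1 * 'I_k => `|(u - v) ij.1 ij.2|) (ord0, i)).
rewrite E; apply: continuous_compact; first exact: continuous_subspaceT.
apply: bounded_closed_compact.
  exists r; split; first exact: num_real.
  by move=> s rs w /= wr; exact: le_trans wr (ltW rs).
rewrite (_ : [set w | _] = (@Num.norm R 'rV[R]_k) @^-1` [set t : R | t <= r]); last first.
  by apply/seteqP; split.
by apply: closed_comp => [u _|]; [exact: norm_continuous|exact: closed_le].
Qed.

Lemma enorm_continuous k : continuous (@enorm R k).
Proof.
move=> u; apply/(@cvgrPdist_le _ _ _ (nbhs u)) => e e0.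
have e1 : 0 < e / k.+1%:R by rewrite divr_gt0.
have : \forall v \near u, `|u - v| <= e / k.+1%:R by exact: near_norm_le.
apply: filterS => v uve.
have H : `|enorm u - enorm v| <= k%:R * `|u - v|.
  apply: le_trans (_ : enorm (u - v) <= _); last exact: enorm_norm.
  have vu : enorm (u - v) = enorm (v - u) by rewrite -opprB -scaleN1r enormZ normrN1 mul1r.
  have := enormD (u - v) v; have := enormD (v - u) u; rewrite !subrK => h1 h2.
  by rewrite ler_norml; apply/andP; split; lra.
apply: le_trans H _.
apply: (@le_trans _ _ (k.+1%:R * (e / k.+1%:R))); last by rewrite mulrC mulfVK.
by apply: ler_pM => //; rewrite ler_nat.
Qed.

Lemma compact_enorm_ball k (r : R) : compact [set w : 'cV[R]_k | enorm w <= r].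
Proof.
apply: (@subclosed_compact _ _ [set w : 'cV[R]_k | `|w| <= r]); last 2 first.
- exact: compact_cV_ball.
- by move=> w /= /(le_trans (norm_enorm w)).
rewrite (_ : [set w | _] = (@enorm R k) @^-1` [set t : R | t <= r]); last by apply/seteqP; split.
by apply: closed_comp => [u _|]; [exact: enorm_continuous|exact: closed_le].
Qed.

End norms.

(** * Vector-valued integrals *)

Section vector_integral.
Context {R : realType}.
Notation LR := (lebesgueType R).
Notation mu := (@completed_lebesgue_measure R).
Implicit Types (a b c t : R).

Definition vmf k a b (x : R -> 'cV[R]_k) : Prop :=
  forall i, lmfun a b (fun t => x t i ord0).
Definition vintg k a b (x : R -> 'cV[R]_k) : Prop :=
  forall i, intg a b (fun t => x t i ord0).
Definition vint k a b (x : R -> 'cV[R]_k) : 'cV[R]_k :=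
  \col_i lint a b (fun t => x t i ord0).

Lemma vintg_vmf k a b (x : R -> 'cV[R]_k) : vintg a b x -> vmf a b x.
Proof. by move=> ix i; exact: intg_lmfun. Qed.

Lemma vintgS k a b a' b' (x : R -> 'cV[R]_k) : a <= a' -> b' <= b ->
  vintg a b x -> vintg a' b' x.
Proof. by move=> aa bb ix i; exact: intgS aa bb (ix i). Qed.

Lemma lmfunD a b (g h : R -> R) : lmfun a b g -> lmfun a b h ->
  lmfun a b (fun t => g t + h t).
Proof. by move=> mg mh; exact: (measurable_funD mg mh). Qed.

Lemma lmfunB a b (g h : R -> R) : lmfun a b g -> lmfun a b h ->
  lmfun a b (fun t => g t - h t).
Proof. by move=> mg mh; exact: (measurable_funB mg mh). Qed.

Lemma lmfunM a b (g h : R -> R) : lmfun a b g -> lmfun a b h ->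
  lmfun a b (fun t => g t * h t).
Proof. by move=> mg mh; exact: (measurable_funM mg mh). Qed.

Lemma lmfun_cst a b (c : R) : lmfun a b (fun=> c).
Proof. exact: measurable_cst. Qed.

Lemma lmfun_sum k a b (g : 'I_k -> R -> R) : (forall i, lmfun a b (g i)) ->
  lmfun a b (fun t => \sum_i g i t).
Proof.
by move=> mg; exact: (@measurable_sum _ LR R _ _ (index_enum _) (g : 'I_k -> LR -> R) mg).
Qed.

Lemma intg_sum k a b (g : 'I_k -> R -> R) : (forall i, intg a b (g i)) ->
  intg a b (fun t => \sum_i g i t) /\
  lint a b (fun t => \sum_i g i t) = \sum_i lint a b (g i).
Proof.
elim: k g => [|k IH] g ig.
  have E : (fun t => \sum_(i < 0) g i t) = (fun=> 0 : R).
    by apply/funext => t; rewrite big_ord0.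
  rewrite E big_ord0; split; first exact: intg_cst.
  have [ba|ab] := leP b a; first exact: lint_empty.
  by rewrite (lint_cst 0 (ltW ab)) mul0r.
have [i1 i2] := IH (fun i => g (widen_ord (leqnSn k) i)) (fun i => ig _).
have E : (fun t => \sum_(i < k.+1) g i t) =
    (fun t => (\sum_(i < k) g (widen_ord (leqnSn k) i) t) + g ord_max t).
  by apply/funext => t; rewrite big_ord_recr.
rewrite E big_ord_recr/= -i2; split; first exact: intgD.
exact: lintD.
Qed.

Lemma vintgD k a b (x y : R -> 'cV[R]_k) : vintg a b x -> vintg a b y ->
  vintg a b (fun t => x t + y t).
Proof.
move=> ix iy i; apply: eq_intg (intgD (ix i) (iy i)) => t _ _.
by rewrite mxE.
Qed.

Lemma vmfD k a b (x y : R -> 'cV[R]_k) : vmf a b x -> vmf a b y ->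
  vmf a b (fun t => x t + y t).
Proof.
move=> mx my i; rewrite (_ : (fun t => _) = (fun t => x t i ord0 + y t i ord0)).
  exact: lmfunD.
by apply/funext => t; rewrite mxE.
Qed.

Lemma vmfB k a b (x y : R -> 'cV[R]_k) : vmf a b x -> vmf a b y ->
  vmf a b (fun t => x t - y t).
Proof.
move=> mx my i; rewrite (_ : (fun t => _) = (fun t => x t i ord0 - y t i ord0)).
  exact: lmfunB.
by apply/funext => t; rewrite !mxE.
Qed.

Lemma vmf_cst k a b (c : 'cV[R]_k) : vmf a b (fun=> c).
Proof. by move=> i; exact: lmfun_cst. Qed.

Lemma vmf_mul k l a b (M : 'M[R]_(k, l)) (x : R -> 'cV[R]_l) : vmf a b x ->
  vmf a b (fun t => M *m x t).
Proof.
move=> mx i; rewrite (_ : (fun t => _) = (fun t => \sum_j (M i j * x t j ord0))).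
  by apply: lmfun_sum => j; apply: lmfunM => //; exact: lmfun_cst.
by apply/funext => t; rewrite mxE.
Qed.

Lemma vintg_mul k l a b (M : 'M[R]_(k, l)) (x : R -> 'cV[R]_l) : vintg a b x ->
  vintg a b (fun t => M *m x t).
Proof.
move=> ix i; rewrite (_ : (fun t => _) = (fun t => \sum_j (M i j * x t j ord0))).
  by apply: (intg_sum _).1 => j; exact: intgZ.
by apply/funext => t; rewrite mxE.
Qed.

Lemma vint_mul k l a b (M : 'M[R]_(k, l)) (x : R -> 'cV[R]_l) : vintg a b x ->
  vint a b (fun t => M *m x t) = M *m vint a b x.
Proof.
move=> ix; apply/matrixP => i j; rewrite ord1 !mxE.
rewrite (_ : (fun t => _) = (fun t => \sum_j (M i j * x t j ord0))); last first.
  by apply/funext => t; rewrite mxE.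
rewrite (intg_sum _).2 => [|i0]; last exact: intgZ.
by apply: eq_bigr => i0 _; rewrite mxE; exact: lintZ.
Qed.

Lemma vintD k a b (x y : R -> 'cV[R]_k) : vintg a b x -> vintg a b y ->
  vint a b (fun t => x t + y t) = vint a b x + vint a b y.
Proof.
move=> ix iy; apply/matrixP => i j; rewrite ord1 !mxE -(lintD (ix i) (iy i)).
by apply: eq_lint => t _ _; rewrite mxE.
Qed.

Lemma vintg_le k a b (x : R -> 'cV[R]_k) (g : R -> R) : vmf a b x -> intg a b g ->
  {ae mu, forall t : LR, `[a, b]%classic t -> `|x t| <= g t} -> vintg a b x.
Proof.
move=> mx ig xg i; apply: le_intg ig _; first exact: mx.
by apply: filterS xg => t xg /xg; apply: le_trans; exact: coord_le.
Qed.

Lemma vint_norm k a b (x : R -> 'cV[R]_k) (g : R -> R) :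
  vintg a b x -> intg a b g ->
  {ae mu, forall t : LR, `[a, b]%classic t -> `|x t| <= g t} ->
  `|vint a b x| <= lint a b g.
Proof.
move=> ix ig xg.
have xig i : {ae mu, forall t : LR, `[a, b]%classic t -> `|x t i ord0| <= g t}.
  by apply: filterS xg => t xg /xg; apply: le_trans; exact: coord_le.
have H i : lint a b (fun t => `|x t i ord0|) <= lint a b g.
  by apply: le_lint => //; exact: intg_norm.
apply: cV_norm_le => [|i]; last first.
  by rewrite mxE; apply: le_trans (H i); exact: lint_norm.
(* in dimension 0, where no coordinate is at hand, 0 <= lint a b g uses the bound *)
case: k x ix xg {xig} H => [x ix xg _|k x ix xg H]; last first.
  by apply: le_trans (H ord0); exact: lint_ge0.
have -> : 0 = lint a b (fun=> 0 : R).
  have [ba|ab] := leP b a; first by rewrite lint_empty.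
  by rewrite (lint_cst 0 (ltW ab)) mul0r.
apply: le_lint => //; first exact: intg_cst.
by apply: filterS xg => t xg /xg; exact: le_trans.
Qed.

Lemma vint_split k c a b (x : R -> 'cV[R]_k) : a <= c -> c <= b -> vintg a b x ->
  vint a b x = vint a c x + vint c b x.
Proof.
by move=> ac cb ix; apply/matrixP => i j; rewrite !mxE (lint_split ac cb (ix i)).
Qed.

Lemma vint_empty k a b (x : R -> 'cV[R]_k) : b <= a -> vint a b x = 0.
Proof. by move=> ba; apply/matrixP => i j; rewrite !mxE lint_empty. Qed.

Lemma ae_vmf k a b (x y : R -> 'cV[R]_k) : vmf a b x ->
  {ae mu, forall t : LR, `[a, b]%classic t -> x t = y t} -> vmf a b y.
Proof.
by move=> mx xy i; apply: ae_lmfun (mx i) _; apply: filterS xy => t xy /xy ->.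
Qed.

Lemma ae_vintg k a b (x y : R -> 'cV[R]_k) : vintg a b x ->
  {ae mu, forall t : LR, `[a, b]%classic t -> x t = y t} -> vintg a b y.
Proof.
by move=> mx xy i; apply: ae_intg (mx i) _; apply: filterS xy => t xy /xy ->.
Qed.

Lemma ae_vint k a b (x y : R -> 'cV[R]_k) : vmf a b x ->
  {ae mu, forall t : LR, `[a, b]%classic t -> x t = y t} ->
  vint a b x = vint a b y.
Proof.
move=> mx xy; apply/matrixP => i j; rewrite !mxE; apply: ae_lint (mx i) _.
by apply: filterS xy => t xy /xy ->.
Qed.

Lemma eq_vint k a b (x y : R -> 'cV[R]_k) :
  (forall t, a <= t -> t <= b -> x t = y t) -> vint a b x = vint a b y.
Proof.
move=> xy; apply/matrixP => i j; rewrite !mxE; apply: eq_lint => t at_ tb.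
by rewrite xy.
Qed.

Lemma abs_continuous_coord k a b (x : R -> 'cV[R]_k) : abs_continuous a b x <->
  forall i, scalar_ac a b (fun t => x t i ord0).
Proof.
split=> [ax i e e0|sx e e0].
  have [d d0 H] := ax e e0; exists d => // N s t st tI /(H _ _ _ st tI).
  apply: le_lt_trans; apply: ler_sum => j _.
  by apply: le_trans (coord_enorm _ i); rewrite !mxE.
have e1 : 0 < e / k.+1%:R by rewrite divr_gt0.
have /choice[d dP] i : exists d : R, 0 < d /\
  forall (N : nat) (s t : 'I_N -> R),
    (forall i, a <= s i /\ s i <= t i /\ t i <= b) ->
    trivIset [set: 'I_N] (fun i => `]s i, t i[%classic) ->
    \sum_i (t i - s i) < d -> \sum_j `|x (t j) i ord0 - x (s j) i ord0| < e / k.+1%:R.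
  by have [d d0 H] := sx i _ e1; exists d.
exists (\big[Num.min/1]_i d i).
  by apply: lt_bigmin => // i _; have [] := dP i.
move=> N s t st tI sd.
apply: (@le_lt_trans _ _ (\sum_(i < k) e / k.+1%:R)).
  apply: (@le_trans _ _ (\sum_j \sum_i `|x (t j) i ord0 - x (s j) i ord0|)).
    apply: ler_sum => j _; apply: le_trans (enorm_le_sum _) _.
    by apply: ler_sum => i _; rewrite !mxE.
  rewrite exchange_big/=; apply: ler_sum => i _; apply/ltW.
  have [_ H] := dP i; apply: H => //; apply: lt_le_trans sd _.
  exact: bigmin_le.
rewrite sumr_const card_ord -[ltLHS]mulr_natl.
apply: (@lt_le_trans _ _ (k.+1%:R * (e / k.+1%:R))); last by rewrite mulrC mulfVK.
by rewrite ltr_pM2r// ltr_nat.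
Qed.

Lemma is_derive_cV k (x : R -> 'cV[R]_k) (dx : 'cV[R]_k) (t : R) :
  is_derive t (1 : R) x dx <->
  forall i, is_derive t (1 : R) (fun s => x s i ord0) (dx i ord0).
Proof.
split=> [[ex <-] i|H].
  rewrite derive_mx// mxE; apply: derivableP.
  exact: (derivable_mxP x t 1).1.
have ex : derivable x t 1.
  by apply/derivable_mxP => i j; rewrite ord1; case: (H i).
split => //; rewrite derive_mx//; apply/matrixP => i j; rewrite mxE ord1.
by case: (H i).
Qed.

Lemma ae_forall_ord k (P : 'I_k -> R -> Prop) :
  (forall i, {ae mu, forall t : LR, P i t}) ->
  {ae mu, forall t : LR, forall i, P i t}.
Proof.
move=> H.
have H' : {ae mu, forall t : LR, forall n : nat, forall h : (n < k)%N, P (Ordinal h) t}.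
  apply: ae_foralln => n; have [nk|nk] := pselect (n < k)%N.
    by apply: (aeS (H (Ordinal nk))) => t Pt h; have -> : h = nk by exact: bool_irrelevance.
  by apply: aeW => t h; case: (nk h).
by apply: (aeS H') => t Pt [i hi]; exact: Pt.
Qed.

Lemma vftc1_ac k a b (x g : R -> 'cV[R]_k) : vintg a b g ->
  (forall t, a <= t -> t <= b -> x t = x a + vint a t g) -> abs_continuous a b x.
Proof.
move=> ig xE; apply/abs_continuous_coord => i e e0.
have [d d0 H] := scalar_ac_lint (ig i) e0; exists d => // N s t st tI.
move=> /(H _ _ _ st tI); apply: le_lt_trans; apply: ler_sum => j _.
have [asj [sjt tb]] := st j.
rewrite (xE (t j)) ?(xE (s j)) ?(le_trans asj)//; last exact: le_trans tb.
by rewrite !mxE opprD addrACA subrr add0r.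
Qed.

Lemma vftc1_derive k a b (x g : R -> 'cV[R]_k) : vintg a b g ->
  (forall t, a <= t -> t <= b -> x t = x a + vint a t g) ->
  {ae mu, forall t : LR, `]a, b[%classic t -> is_derive (t : R) (1 : R) x (g t)}.
Proof.
move=> ig xE.
apply: (aeS (ae_forall_ord (fun i => lint_derive (ig i)))) => t H tab; apply/is_derive_cV => i.
have Hi := H i tab.
have E : \forall s \near (t : R), x a i ord0 + lint a s (fun r => g r i ord0) = x s i ord0.
  have : \forall s \near (t : R), s \in `]a, b[ by exact: near_in_itvoo.
  apply: filterS => s; rewrite in_itv/= => /andP[as_ sb].
  by rewrite (xE s) ?ltW// !mxE.
apply: (near_eq_is_derive E).
rewrite -[g t i ord0]add0r; exact: is_deriveD (is_derive_cst _ _ _) Hi.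
Qed.

Lemma vftc2 k a b (x g : R -> 'cV[R]_k) t : a <= t -> t <= b ->
  abs_continuous a b x -> vintg a b g ->
  {ae mu, forall t : LR, `]a, b[%classic t -> is_derive (t : R) (1 : R) x (g t)} ->
  x t = x a + vint a t g.
Proof.
move=> at_ tb /abs_continuous_coord ax ig dx.
apply/matrixP => i j; rewrite ord1 !mxE.
apply: (ftc2 at_ tb (ax i) (ig i)).
by apply: filterS dx => s H /H /is_derive_cV; apply.
Qed.

End vector_integral.

(** * Almost everywhere convergence of convex combinations *)

Section ae_convergence.
Context d (T : measurableType d) {R : realType} (mu : {measure set T -> \bar R}).

(** The sum of the |f j.+1 - f j| has a finite integral, hence is finite almost
    everywhere, and there the telescoping series converges absolutely. *)
Lemma ae_cvg_of_summable_increments (D : set T) (f : nat -> T -> R) (C : R) :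
  measurable D -> 0 <= C -> (forall j, measurable_fun D (f j)) ->
  (forall j, (\int[mu]_(t in D) `|f j.+1 t - f j t|%:E <= (C / (2 ^ j.+1)%:R)%:E)%E) ->
  {ae mu, forall t, D t -> cvgn (f ^~ t)}.
Proof.
move=> mD C0 mf fC.
pose g j t := `|f j.+1 t - f j t|%:E.
have mg j : measurable_fun D (g j).
  apply/measurable_EFinP; apply: measurableT_comp => //; exact: measurable_funB.
have g0 j t : D t -> (0 <= g j t)%E by move=> _; rewrite lee_fin.
have iS : mu.-integrable D (fun t => \sum_(j <oo) g j t)%E.
  apply/integrableP; split; first by apply: ge0_emeasurable_sum => // *; exact: g0.
  rewrite (eq_integral (fun t => \sum_(j <oo) g j t)%E); last first.
    by move=> t /set_mem Dt; rewrite gee0_abs// nneseries_ge0// => *; exact: g0.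
  rewrite integral_nneseries//.
  apply: le_lt_trans (ltry C); apply: le_trans (epsilon_trick0 xpredT C0).
  by apply: lee_nneseries => [j _ _|j _]; [apply: integral_ge0 => t; exact: g0|exact: fC].
apply: filterS (integrable_ae mD iS) => t /= H Dt.
have Sfin := H Dt.
have cS : cvgn (series (telescope (f ^~ t))).
  apply: normed_cvg; apply: nondecreasing_is_cvgn.
    by apply: nondecreasing_series => *; exact: normr_ge0.
  exists (fine (\sum_(j <oo) g j t)%E) => _ [n _ <-].
  rewrite -lee_fin fineK// /series/= -sumEFin.
  by apply: nneseries_lim_ge => j _ _; exact: g0.
have -> : f ^~ t = (fun n => f 0%N t + series (telescope (f ^~ t)) n).
  by apply/funext => n; rewrite -eq_sum_telescope.
by apply: is_cvgD => //; exact: is_cvg_cst.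
Qed.

End ae_convergence.

Section komlos.
Context {R : realType}.
Notation LR := (lebesgueType R).
Notation mu := (@completed_lebesgue_measure R).
Implicit Types (a b c t : R).

(** The dyadic convex combinations of the terms of z from index N on.  Midpoints are
    enough: they are all that the parallelogram identity and the passage of convex
    constraints to the limit require. *)
Inductive tailconv {k} (z : nat -> R -> 'cV[R]_k) (N : nat) : (R -> 'cV[R]_k) -> Prop :=
| tc_base j : (N <= j)%N -> tailconv z N (z j)
| tc_mid u v : tailconv z N u -> tailconv z N v ->
    tailconv z N (fun t => 2^-1 *: (u t + v t)).

Lemma tailconvS k (z : nat -> R -> 'cV[R]_k) N M u : (N <= M)%N ->
  tailconv z M u -> tailconv z N u.
Proof.
move=> NM; elim => [j Mj|{}u v _ IHu _ IHv]; last exact: tc_mid.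
by apply: tc_base; exact: leq_trans Mj.
Qed.

Lemma tailconv_vmf k (z : nat -> R -> 'cV[R]_k) N u a b :
  (forall j, vmf a b (z j)) -> tailconv z N u -> vmf a b u.
Proof.
move=> mz; elim => [j _|{}u v _ IHu _ IHv]; first exact: mz.
move=> i; rewrite (_ : (fun t => _) = (fun t => 2^-1 * (u t i ord0 + v t i ord0))).
  by apply: lmfunM; [exact: lmfun_cst|exact: lmfunD].
by apply/funext => t; rewrite !mxE.
Qed.

(** How a constraint that is convex at each fixed time passes from the sequence to its
    combinations. *)
Lemma tailconv_ind_at k (z : nat -> R -> 'cV[R]_k) N u t (W : set 'cV[R]_k) :
  (forall p q, W p -> W q -> W (2^-1 *: (p + q))) ->
  (forall j, (N <= j)%N -> W (z j t)) -> tailconv z N u -> W (u t).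
Proof.
by move=> cW zW; elim => [j Nj|{}u v _ IHu _ IHv]; [exact: zW|exact: cW].
Qed.

Lemma ball_midpoint (V : normedModType R) (r : R) (p q : V) :
  `|p| <= r -> `|q| <= r -> `|2^-1 *: (p + q)| <= r.
Proof.
move=> pr qr; rewrite normrZ ger0_norm ?invr_ge0//.
rewrite -[leRHS](_ : 2^-1 * (r + r) = r); last by lra.
by rewrite ler_wpM2l// (le_trans (ler_normD _ _))// lerD.
Qed.

(** The square of the L^2 norm. *)
Definition energy k a b (u : R -> 'cV[R]_k) : R :=
  lint a b (fun t => \sum_i u t i ord0 ^+ 2).

Section bounded.
Context {k : nat} (a b : R) (ab : a <= b).
Implicit Types u v : R -> 'cV[R]_k.

Definition unit_bounded u := vmf a b u /\ forall t, a <= t -> t <= b -> `|u t| <= 1.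

Lemma intg_sqr_coord u M i : vmf a b u -> (forall t, a <= t -> t <= b -> `|u t| <= M) ->
  intg a b (fun t => u t i ord0 ^+ 2).
Proof.
move=> mu uM; apply: (@intg_bounded _ _ _ _ (M ^+ 2)).
  by rewrite (_ : (fun t => _) = (fun t => u t i ord0 * u t i ord0)); [exact: lmfunM|
    apply/funext => t; rewrite expr2].
move=> t at_ tb; rewrite normrX; apply: lerXn2r => //; rewrite ?nnegrE//.
  exact: le_trans (uM t at_ tb).
exact: le_trans (coord_le _ i) (uM t at_ tb).
Qed.

Lemma energy_bounded u : unit_bounded u -> 0 <= energy a b u <= k%:R * (b - a).
Proof.
move=> [mu u1]; apply/andP; split.
  by apply: lint_ge0 => t _ _; apply: sumr_ge0 => i _; exact: sqr_ge0.
rewrite -lint_cst//; apply: le_lint.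
- exact: (intg_sum (fun i => intg_sqr_coord i mu u1)).1.
- exact: intg_cst.
apply: aeW => t /=; rewrite in_itv/= => /andP[at_ tb].
rewrite -[leRHS](_ : \sum_(i < k) 1 = _); last by rewrite sumr_const card_ord.
apply: ler_sum => i _; rewrite -[leRHS](expr1n _ 2) -[leLHS]real_normK ?num_real//.
by apply: lerXn2r => //; rewrite ?nnegrE//; exact: le_trans (coord_le _ i) (u1 t at_ tb).
Qed.

Lemma energy_parallelogram u v : unit_bounded u -> unit_bounded v ->
  energy a b (fun t => u t - v t) =
  2 * energy a b u + 2 * energy a b v - 4 * energy a b (fun t => 2^-1 *: (u t + v t)).
Proof.
move=> [mu u1] [mv v1].
have iu i := intg_sqr_coord i mu u1; have iv i := intg_sqr_coord i mv v1.
have im i : intg a b (fun t => (2^-1 *: (u t + v t)) i ord0 ^+ 2).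
  apply: (@intg_sqr_coord _ 1).
    move=> j; rewrite (_ : (fun t => _) = (fun t => 2^-1 * (u t j ord0 + v t j ord0))).
      by apply: lmfunM; [exact: lmfun_cst|exact: lmfunD].
    by apply/funext => t; rewrite !mxE.
  by move=> t at_ tb; apply: ball_midpoint; [exact: u1|exact: v1].
have id i : intg a b (fun t => (u t - v t) i ord0 ^+ 2).
  apply: (@intg_sqr_coord _ 2); first exact: vmfB.
  by move=> t at_ tb; rewrite (le_trans (ler_normB _ _))// -[leRHS]/(1 + 1) lerD ?u1 ?v1.
rewrite /energy !(intg_sum _).2//.
rewrite !mulr_sumr -big_split/= -sumrB; apply: eq_bigr => i _.
rewrite -!lintZ// -lintD; [|exact: intgZ..].
rewrite -lintB; [|by apply: intgD; exact: intgZ|exact: intgZ].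
by apply: eq_lint => t _ _; rewrite !mxE; field.
Qed.

(** From r <= e + r^2 / e; this does the service of the Cauchy-Schwarz inequality. *)
Lemma coord_energy u M i (e : R) : vmf a b u ->
  (forall t, a <= t -> t <= b -> `|u t| <= M) -> 0 < e ->
  lint a b (fun t => `|u t i ord0|) <= e * (b - a) + e^-1 * energy a b u.
Proof.
move=> mu uM e0.
have iu j := intg_sqr_coord j mu uM.
have iu1 : intg a b (fun t => u t i ord0).
  apply: (@intg_bounded _ _ _ _ M); first exact: mu.
  by move=> t at_ tb; exact: le_trans (coord_le _ i) (uM t at_ tb).
have [is1 _] := intg_sum iu.
rewrite -(lint_cst _ ab) -lintZ// -lintD; [|exact: intg_cst|exact: intgZ].
apply: le_lint; [exact: intg_norm|apply: intgD; [exact: intg_cst|exact: intgZ]|].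
apply: aeW => t _ /=.
apply: (@le_trans _ _ (e + e^-1 * u t i ord0 ^+ 2)); last first.
  rewrite lerD2l ler_pM2l ?invr_gt0// (bigD1 i)//= lerDl sumr_ge0// => j _.
  exact: sqr_ge0.
rewrite -(real_normK (num_real (u t i ord0))).
set r := `|u t i ord0|; have r0 : 0 <= r by exact: normr_ge0.
rewrite -(ler_pM2l e0) mulrDr mulrA mulfV ?gt_eqF// mul1r.
have := sqr_ge0 (e - r); nra.
Qed.

Lemma tailconv_unit_bounded (z : nat -> R -> 'cV[R]_k) N u :
  (forall j, unit_bounded (z j)) -> tailconv z N u -> unit_bounded u.
Proof.
move=> uz tu; split; first by apply: (tailconv_vmf _ tu) => j; have [] := uz j.
move=> t at_ tb.
apply: (tailconv_ind_at (W := [set p | `|p| <= 1]) _ _ tu) => [p q|j _] /=.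
  exact: ball_midpoint.
by have [_] := uz j; apply.
Qed.

(** M is the limit of the infimum of the energy over the tail from N, which increases
    with N and is bounded. *)
Lemma tailconv_min_energy (z : nat -> R -> 'cV[R]_k) : (forall j, unit_bounded (z j)) ->
  exists M : R, forall (e : R) (j : nat), 0 < e -> exists N u,
   [/\ (j <= N)%N, tailconv z N u, energy a b u < M + e &
     forall v, tailconv z N v -> M - e < energy a b v].
Proof.
move=> uz.
pose S N := [set energy a b u | u in tailconv z N].
pose m N := inf (S N).
have Sne N : S N !=set0 by exists (energy a b (z N)); exists (z N) => //; exact: tc_base.
have Slb N : lbound (S N) 0.
  move=> _ [u tu <-]; by have /andP[] := energy_bounded (tailconv_unit_bounded uz tu).
have minf N : has_inf (S N) by split => //; exists 0.
have mle N v : tailconv z N v -> m N <= energy a b v.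
  by move=> tv; apply: ge_inf; [exists 0|exists v].
have mmono N N' : (N <= N')%N -> m N <= m N'.
  move=> NN'; apply: lb_le_inf => // _ [u tu <-]; apply: mle; exact: tailconvS tu.
have mub : has_ubound (range m).
  exists (k%:R * (b - a)) => _ [N _ <-].
  apply: le_trans (mle N (z N) _) _; first exact: tc_base.
  by have /andP[] := energy_bounded (uz N).
have msup : has_sup (range m) by split => //; exists (m 0%N); exists 0%N.
exists (sup (range m)) => e j e0.
have [_ [N0 _ <-] MN0] := sup_adherent e0 msup.
pose N := maxn j N0.
have [_ [u tu <-] uN] := inf_adherent e0 (minf N).
exists N, u; split; first exact: leq_maxl; first exact: tu.
- by apply: lt_le_trans uN _; rewrite lerD2r; apply: ub_le_sup => //; exists N.
- move=> v tv; apply: lt_le_trans (MN0) _; apply: le_trans (mle _ _ tv).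
  by apply: mmono; exact: leq_maxr.
Qed.

(** A theorem of Komlos type.  By the parallelogram identity, two elements of a tail
    whose energies nearly attain the infimum M are close in L^2, since their midpoint has
    energy at least about M as well.  With tolerances 8^-(j+1) the L^1 distances of
    successive near-minimisers are summable. *)
Lemma komlos (z : nat -> R -> 'cV[R]_k) : (forall j, unit_bounded (z j)) ->
  exists (u : nat -> R -> 'cV[R]_k) (w : R -> 'cV[R]_k),
  [/\ forall j, tailconv z j (u j), unit_bounded w &
   {ae mu, forall t : LR, `[a, b]%classic t -> forall i,
      (fun j => u j t i ord0) @ \oo --> w t i ord0}].
Proof.
move=> uz; have [M MP] := tailconv_min_energy uz.
pose q j : R := (2 ^ j.+1)%:R.
have q1 j : 1 <= q j by rewrite /q ler1n expn_gt0.
have q0 j : 0 < q j by exact: lt_le_trans (q1 j).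
have qS j : q j <= q j.+1 by rewrite /q ler_nat leq_exp2l.
(* the cube pays for the weight q j with which [coord_energy] is used below *)
pose e j : R := (q j ^+ 3)^-1.
have e0 j : 0 < e j by rewrite invr_gt0 exprn_gt0.
have eS j : e j.+1 <= e j by rewrite lef_pV2 ?posrE ?exprn_gt0// lerXn2r ?nnegrE// ltW.
have /choice[N /choice[u uP]] j := MP (e j) j (e0 j).
have tu j : tailconv z j (u j) by have [jN tu _ _] := uP j; exact: tailconvS jN tu.
have uu j : unit_bounded (u j) by exact: tailconv_unit_bounded uz (tu j).
have small j : energy a b (fun t => u j.+1 t - u j t) <= 8 * e j.
  rewrite energy_parallelogram//.
  have [_ t1 u1 m1] := uP j; have [_ t2 u2 m2] := uP j.+1.
  have : M - e j < energy a b (fun t => 2^-1 *: (u j.+1 t + u j t)).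
    have [NN|NN] := leP (N j) (N j.+1).
      by apply: m1; apply: tc_mid => //; exact: tailconvS t2.
    have := m2 _ (tc_mid t2 (tailconvS (ltnW NN) t1)).
    by have := eS j; lra.
  have := eS j; lra.
have inc i j : lint a b (fun t => `|u j.+1 t i ord0 - u j t i ord0|) <= (b - a + 8) / q j.
  have := @coord_energy (fun t => u j.+1 t - u j t) 2 i (q j)^-1.
  have mB : vmf a b (fun t => u j.+1 t - u j t) by apply: vmfB; [case: (uu j.+1)|case: (uu j)].
  move=> /(_ mB) H.
  have -> : lint a b (fun t => `|u j.+1 t i ord0 - u j t i ord0|) =
     lint a b (fun t => `|(u j.+1 t - u j t) i ord0|).
    by apply: eq_lint => t _ _; rewrite !mxE.
  apply: le_trans (H _ _) _; last 2 first.
  - by rewrite invr_gt0.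
  - rewrite invrK mulrDl mulrC lerD2l.
    apply: (@le_trans _ _ (q j * (8 * e j))); first by rewrite ler_pM2l// small.
    rewrite mulrCA ler_pM2l// /e exprS invfM mulrA mulfV ?gt_eqF// mul1r.
    rewrite lef_pV2 ?posrE ?exprn_gt0// expr2 ler_peMl// ltW//.
  move=> t at_ tb; rewrite (le_trans (ler_normB _ _))// -[leRHS]/(1 + 1).
  by apply: lerD; [case: (uu j.+1) => _|case: (uu j) => _]; apply.
have ae i : {ae mu, forall t : LR, `[a, b]%classic t -> cvgn (fun j => u j t i ord0)}.
  apply: (@ae_cvg_of_summable_increments _ LR R mu _ (fun j t => u j t i ord0) (b - a + 8)).
  - exact: measurable_cc.
  - by rewrite addr_ge0// subr_ge0.
  - by move=> j; have [mu _] := uu j; exact: mu.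
  - move=> j.
    have ii : intg a b (fun t => `|u j.+1 t i ord0 - u j t i ord0|).
      apply: intg_norm; apply: intgB.
        apply: (@intg_bounded _ _ _ _ 1); first by case: (uu j.+1) => + _; apply.
        by move=> t at_ tb; apply: le_trans (coord_le _ i) _; case: (uu j.+1) => _; apply.
      apply: (@intg_bounded _ _ _ _ 1); first by case: (uu j) => + _; apply.
      by move=> t at_ tb; apply: le_trans (coord_le _ i) _; case: (uu j) => _; apply.
    have := inc i j; rewrite -lee_fin /lint /Rintegral fineK//.
    exact: (integrable_fin_num (measurable_cc a b) ii).
have [A [mA A0 AP]] := ae_forall_ord ae.
have AP' t : ~ A t -> a <= t -> t <= b -> forall i, cvgn (fun j => u j t i ord0).
  move=> At at_ tb i; apply: contrapT => nc; apply: At; apply: AP => /= H.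
  by apply/nc/H; rewrite /= in_itv/= at_.
pose g i j t := if t \in A then 0 else u j t i ord0.
have gE i j : {ae mu, forall t : LR, `[a, b]%classic t -> u j t i ord0 = g i j t}.
  exists A; split => // t /= nt; apply: contrapT => At; apply: nt => _.
  by rewrite /g ifN//; apply/negP => /set_mem.
have cg i t : a <= t -> t <= b -> cvgn (fun j => g i j t).
  move=> at_ tb; rewrite /g; have [At|At] := boolP (t \in A).
    by apply/cvg_ex; exists 0; exact: cvg_cst.
  by apply: AP' => // /mem_set; exact/negP.
exists u, (fun t => \col_i limn (fun j => g i j t)); split => //.
- split.
    move=> i; have lim_i t :
      (\col_i limn (fun j => g i j t)) i ord0 = limn (fun j => g i j t) by rewrite mxE.
    apply: (@measurable_fun_cvg _ LR R _ (fun j t => g i j t)).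
      by move=> j; apply: ae_lmfun (gE i j); case: (uu j) => + _; apply.
    move=> t; rewrite /= in_itv/= => /andP[at_ tb]; rewrite lim_i.
    exact: cg.
  move=> t at_ tb; apply: cV_norm_le => // i; rewrite mxE.
  have H : (fun j => `|g i j t|) @ \oo --> `|limn (fun j => g i j t)|.
    exact: (cvg_norm (cg i t at_ tb)).
  rewrite -(cvg_lim (@Rhausdorff R) H); apply: limr_le; first by apply/cvg_ex; eexists; exact: H.
  apply: nearW => j; rewrite /g; case: ifP => _; first by rewrite normr0.
  by apply: le_trans (coord_le _ i) _; case: (uu j) => _; apply.
- exists A; split => // t /= nt; apply: contrapT => At; apply: nt.
  rewrite in_itv/= => /andP[at_ tb] i; rewrite mxE.
  have -> : (fun j => u j t i ord0) = (fun j => g i j t).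
    by apply/funext => j; rewrite /g memNset.
  exact: cg.
Qed.

End bounded.

End komlos.

(** * Measurable selection from a dense sequence *)

Section dense_sequence.
Context {R : realType}.

(** An enumeration of the vectors with rational entries, among which 0 fills the gaps. *)
Definition qvec k (i : nat) : 'cV[R]_k :=
  if @unpickle 'cV[rat]_k i is Some M then map_mx ratr M else 0.

Definition l1 k (x : 'cV[R]_k) : R := \sum_i `|x i ord0|.

Lemma norm_l1 k (x : 'cV[R]_k) : `|x| <= l1 x.
Proof.
apply: cV_norm_le => [|i]; first exact: sumr_ge0.
by rewrite /l1 (bigD1 i)//= lerDl sumr_ge0.
Qed.

Lemma l1_norm k (x : 'cV[R]_k) : l1 x <= k%:R * `|x|.
Proof.
rewrite mulr_natl -[leRHS](_ : \sum_(j < k) `|x| = _); last by rewrite sumr_const card_ord.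
by apply: ler_sum => i _; exact: coord_le.
Qed.

Lemma qvec_dense k (x : 'cV[R]_k) (e : R) : 0 < e -> exists i, `|x - qvec k i| < e.
Proof.
move=> e0; have e20 : 0 < e / 2 by rewrite divr_gt0.
have /choice[q qP] i : exists q : rat, `|x i ord0 - ratr q| <= e / 2.
  have [|q] := @rat_in_itvoo R (x i ord0 - e / 2) (x i ord0 + e / 2); first by lra.
  by rewrite in_itv/= => /andP[h1 h2]; exists q; rewrite ler_norml; apply/andP; split; lra.
exists (pickle (\col_i q i : 'cV[rat]_k)); rewrite /qvec pickleK.
apply: (@le_lt_trans _ _ (e / 2)); last by rewrite ltr_pdivrMr//; lra.
by apply: cV_norm_le => [|i]; [exact: ltW|rewrite !mxE].
Qed.

Lemma qvec_dense_l1 k (W : set 'cV[R]_k) (x : 'cV[R]_k) : nbhs x W -> exists i, W (qvec k i).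
Proof.
move=> /nbhs_ballP[e /= e0 eW]; have [i xi] := qvec_dense x e0.
by exists i; apply: eW; rewrite -ball_normE.
Qed.

Definition first_index (P : nat -> Prop) : nat :=
  match pselect (exists n, `[< P n >]) with
  | left h => ex_minn h
  | right _ => 0%N
  end.

Lemma first_indexP (P : nat -> Prop) : (exists n, P n) ->
  P (first_index P) /\ forall j, (j < first_index P)%N -> ~ P j.
Proof.
move=> [n Pn]; rewrite /first_index; case: pselect => [h|]; last first.
  by case; exists n; apply/asboolP.
case: ex_minnP => m /asboolP Pm mP; split => // j jm Pj.
by have := mP j; rewrite leqNgt jm => /(_ (introT (asboolP _) Pj)).
Qed.

End dense_sequence.

Section measurable_selection.
Context d (T : measurableType d) {R : realType} (D : set T) (mD : measurable D).

(** The index is constant on each of countably many measurable pieces of D. *)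
Lemma first_index_measurable (E : nat -> set T) (F : nat -> T -> R) :
  (forall i, measurable (D `&` E i)) -> (forall i, measurable_fun D (F i)) ->
  (forall t, D t -> exists i, E i t) ->
  measurable_fun D (fun t => F (first_index (fun i => E i t)) t).
Proof.
move=> mE mF ex _ Y mY.
have -> : D `&` (fun t => F (first_index (fun i => E i t)) t) @^-1` Y =
  \bigcup_i (((D `&` E i) `&` (D `&` F i @^-1` Y)) `\` \bigcup_(j in `I_i) (D `&` E j)).
  apply/seteqP; split=> [t [Dt FY]|t [i _ [[[_ Ei] [Dt FY]] nE]]].
    have [Ef Emin] := first_indexP (ex t Dt).
    exists (first_index (fun i => E i t)) => //; split => // -[j /= ji [_ Ej]].
    exact: Emin ji Ej.
  split => //=; have [Ef Emin] := first_indexP (ex t Dt).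
  suff -> : first_index (fun i => E i t) = i by [].
  apply/eqP; rewrite eqn_leq; apply/andP; split; rewrite leqNgt; apply/negP => lt.
    exact: Emin lt Ei.
  by apply: nE; exists (first_index (fun i => E i t)).
apply: bigcupT_measurable => i; apply: measurableD.
  by apply: measurableI; [exact: mE|exact: mF].
by apply: bigcup_measurable => j _; exact: mE.
Qed.

Lemma measurable_l1_lt k (x : T -> 'cV[R]_k) (e : R) :
  (forall i, measurable_fun D (fun t => x t i ord0)) ->
  measurable (D `&` [set t | l1 (x t) < e]).
Proof.
move=> mx; have ml : measurable_fun D (fun t => l1 (x t)).
  apply: (@measurable_sum _ T R _ _ (index_enum _) (fun i t => `|x t i ord0|)) => i.
  exact: measurableT_comp.
have := ml mD `]-oo, e[%classic (measurable_itv _).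
by rewrite (_ : _ @^-1` _ = [set t | l1 (x t) < e]).
Qed.

(** xi is the pointwise limit of functions with countably many values: the first rational
    vector closer than 1/(n+1).  Continuity of phi t carries the limit through. *)
Lemma caratheodory_comp p (phi : T -> 'cV[R]_p -> R) (xi : T -> 'cV[R]_p) :
  (forall t, D t -> continuous (phi t)) ->
  (forall z, measurable_fun D (phi ^~ z)) ->
  (forall i, measurable_fun D (fun t => xi t i ord0)) ->
  measurable_fun D (fun t => phi t (xi t)).
Proof.
move=> cphi mphi mxi.
pose E n i : set T := [set t | l1 (xi t - qvec p i) < n.+1%:R^-1].
pose g n t := phi t (qvec p (first_index (fun i => E n i t))).
have exE n t : exists i, E n i t.
  have e0 : 0 < (n.+1%:R^-1 / p.+1%:R : R) by rewrite divr_gt0.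
  have [i xi_i] := qvec_dense (xi t) e0; exists i; rewrite /E/=.
  apply: le_lt_trans (l1_norm _) _.
  apply: (@le_lt_trans _ _ (p%:R * (n.+1%:R^-1 / p.+1%:R))).
    by apply: ler_wpM2l => //; exact: ltW.
  by rewrite mulrCA -[ltRHS]mulr1 ltr_pM2l// ltr_pdivrMr// mul1r ltr_nat.
apply: (@measurable_fun_cvg _ T R D g).
  move=> n; apply: (@first_index_measurable (E n) (fun i t => phi t (qvec p i))) => //.
  move=> i; apply: (@measurable_l1_lt _ (fun t => xi t - qvec p i)) => j.
  rewrite (_ : (fun t => _) = (fun t => xi t j ord0 - qvec p i j ord0)); last first.
    by apply/funext => t; rewrite !mxE.
  by apply: measurable_funB.
move=> t Dt.
suff H : (fun n => qvec p (first_index (fun i => E n i t))) @ \oo --> xi t.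
  exact: (cvg_comp _ _ H (cphi t Dt (xi t))).
apply/cvgrPdist_lt => e e0; near=> n.
have [+ _] := first_indexP (exE n t); rewrite /E/= => H.
apply: le_lt_trans (norm_l1 _) _; apply: lt_trans H _.
near: n; exact: (near_infty_natSinv_lt (PosNum e0)).
Unshelve. all: by end_near. Qed.

End measurable_selection.

(** * Equicontinuous sequences *)

Section ascoli.
Context {R : realType} {k : nat}.

(** Limits along an ultrafilter exist at all times at once.  The index sg N is then chosen
    so that x (sg N) is 1/(N+1)-close to the limit at the first N+1 rational times, and
    the common modulus of continuity given by g carries the convergence to every time. *)
Lemma ascoli_subsequence (x : nat -> R -> 'cV[R]_k) (M : R) (g : R -> R) :
  continuous g -> (forall j t, `|x j t| <= M) ->
  (forall j s t, `|x j t - x j s| <= `|g t - g s|) ->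
  exists (sg : nat -> nat) (y : R -> 'cV[R]_k),
  [/\ forall j, (j <= sg j)%N, forall t, (fun j => x (sg j) t) @ \oo --> y t,
      forall t, `|y t| <= M & forall s t, `|y t - y s| <= `|g t - g s|].
Proof.
move=> cg xM xg.
have [U [UU oU]] := ultraFilterLemma (eventually_filter : ProperFilter (nbhs \oo)).
have UF : ProperFilter U by exact: ultra_proper.
have /choice[y yP] : forall t : R, exists y : 'cV[R]_k, (fun j => x j t) @ U --> y.
  move=> t.
  have inball : ((fun j => x j t) @ U) [set w : 'cV[R]_k | `|w| <= M].
    by apply: (@filterE _ U) => j; exact: (xM j t).
  have PF : ProperFilter ((fun j => x j t) @ U) by exact: fmap_proper_filter.
  have [y [_ yc]] := @compact_cV_ball R k M _ PF inball.
  exists y => V Vy.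
  have [//|nV] := in_ultra_setVsetC ((fun j => x j t) @^-1` V) UU.
  by have [z []] := yc (~` V) V nV Vy.
have yM t : `|y t| <= M.
  by apply: (cvgr_to_le (cvg_norm (yP t))); apply: filterE => j; exact: xM.
have yg s t : `|y t - y s| <= `|g t - g s|.
  apply: (cvgr_to_le (cvg_norm (cvgB (yP t) (yP s)))).
  by apply: filterE => j; exact: xg.
pose q i : R := qvec 1 i ord0 ord0.
have /choice[sg sgP] N : exists j, (N <= j)%N /\
    forall i : 'I_N.+1, `|x j (q i) - y (q i)| <= N.+1%:R^-1.
  apply: (@filter_ex _ U); apply: filterI; first by apply: oU; exists N.
  apply: filter_forall => i.
  have N0 : 0 < N.+1%:R^-1 :> R by rewrite invr_gt0.
  by have /cvgrPdist_le/(_ _ N0) := yP (q i); apply: filterS => j; rewrite distrC.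
exists sg, y; split => //; first by move=> j; have [] := sgP j.
move=> t; apply/cvgrPdist_lt => e e0.
have e4 : 0 < e / 4 by rewrite divr_gt0.
have /cvgrPdist_lt/(_ _ e4)/nbhs_ballP[r /= r0 rg] := cg t.
have [i qi] := qvec_dense (const_mx t : 'cV[R]_1) r0.
have tq : `|t - q i| < r.
  by apply: le_lt_trans qi; apply: le_trans (coord_le _ ord0); rewrite !mxE.
have gq : `|g t - g (q i)| < e / 4 by apply: rg.
near=> N.
have iN : (i < N.+1)%N by rewrite ltnS; near: N; exact: nbhs_infty_ge.
have [_ /(_ (Ordinal iN))/= xy] := sgP N.
have N4 : N.+1%:R^-1 < e / 4 by near: N; exact: (near_infty_natSinv_lt (PosNum e4)).
have -> : y t - x (sg N) t = (y t - y (q i)) - (x (sg N) (q i) - y (q i))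
    - (x (sg N) t - x (sg N) (q i)).
  by apply/matrixP => a b; rewrite !mxE; ring.
apply: le_lt_trans (ler_normB _ _) _.
apply: le_lt_trans (lerD (ler_normB _ _) (xg _ _ _)) _.
apply: le_lt_trans (lerD (lerD (yg (q i) t) xy) (lexx _)) _.
have := ltrD (ltrD gq N4) gq; move=> h; apply: lt_trans h _; lra.
Unshelve. all: by end_near. Qed.

End ascoli.

(** * Indefinite integrals as functions on the whole line *)

Section clamp.
Context {R : realType}.
Notation LR := (lebesgueType R).
Notation mu := (@completed_lebesgue_measure R).
Implicit Types (a b c t : R).

Lemma continuous_intg a b (g : R -> R) : continuous g -> intg a b g.
Proof.
move=> cg; have [ab|ba] := leP a b; last exact: intg_gt.
have [s _ sM] := EVT_max ab (continuous_subspaceT (fun t => cvg_norm (cg t))).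
apply: (@intg_bounded _ _ _ _ `|g s|); first exact: cont_lmfun.
by move=> r ar rb; apply: sM; rewrite in_itv/= ar.
Qed.

Lemma lint_expR (al a t : R) : a <= t ->
  intg a t (fun r => al * expR (al * (r - a))) /\
  lint a t (fun r => al * expR (al * (r - a))) = expR (al * (t - a)) - 1.
Proof.
move=> at_; pose F s : R := expR (al * (s - a)).
have dF s : is_derive s (1 : R) F (al * expR (al * (s - a))).
  have d1 : is_derive s (1 : R) (fun s : R => al * (s - a)) al.
    have := @is_deriveZ R R^o R^o (fun s : R => s - a) al s 1 1.
    rewrite /GRing.scale/= mulr1; apply.
    rewrite -[X in is_derive _ _ _ X]subr0; apply: is_deriveB.
  have := @is_derive1_comp R expR (fun s : R => al * (s - a)) s _ _ (is_derive_expR _) d1.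
  by rewrite mulrC.
have cF : continuous F.
  move=> s; apply: (@continuous_comp _ _ _ (fun s : R => al * (s - a)) expR).
    by apply: cvgM; [exact: cvg_cst|apply: cvgB; [exact: cvg_id|exact: cvg_cst]].
  exact: continuous_expR.
have cf : continuous (fun r : R => al * expR (al * (r - a))).
  by move=> s; apply: cvgM; [exact: cvg_cst|exact: cF].
have mf : measurable_fun (setT : set (measurableTypeR R)) (fun r : R => al * expR (al * (r - a))).
  exact: continuous_measurable_fun.
have ii : intg a t (fun r => al * expR (al * (r - a))) by exact: continuous_intg.
split => //.
have E0 : F a = 1 by rewrite /F subrr mulr0 expR0.
move: at_; rewrite le_eqVlt => /predU1P[<-|at_].
  by rewrite lint_point subrr mulr0 expR0 subrr.
have [_ E] := lebesgue_integral_borel (measurable_itv `[a, t]) mf ii.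
rewrite /lint -E /Rintegral (@continuous_FTC2 R _ F)//.
- by rewrite -EFinB/= E0.
- exact: continuous_subspaceT.
- split.
  + by move=> s _; case: (dF s).
  + exact/cvg_at_right_filter/cF.
  + exact/cvg_at_left_filter/cF.
- by move=> s _; rewrite derive1E; case: (dF s).
Qed.

(** Composing with [clamp a b] freezes a function outside [a, b], so that continuity on
    [a, b] becomes continuity on the line. *)
Definition clamp a b t : R := Num.max a (Num.min b t).

Section clamp_lemmas.
Context (a b : R) (ab : a <= b).

Lemma clamp_ge t : a <= clamp a b t.
Proof. by rewrite /clamp le_max lexx. Qed.

Lemma clamp_le t : clamp a b t <= b.
Proof. by rewrite /clamp ge_max ab ge_min lexx. Qed.

Lemma clamp_id t : a <= t -> t <= b -> clamp a b t = t.
Proof. by move=> at_ tb; rewrite /clamp min_r// max_r. Qed.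

Lemma clamp_low t : t <= a -> clamp a b t = a.
Proof. by move=> ta; rewrite /clamp max_l// ge_min ta orbT. Qed.

Lemma clamp_mono s t : s <= t -> clamp a b s <= clamp a b t.
Proof.
move=> st; rewrite /clamp ge_max !le_max lexx/=; apply/orP; right.
by rewrite le_min !ge_min lexx st orbT.
Qed.

Lemma clamp_lip s t : `|clamp a b s - clamp a b t| <= `|s - t|.
Proof.
wlog st : s t / s <= t => [H|].
  have [/H//|/ltW/H] := leP s t.
  by rewrite distrC [in leRHS]distrC.
rewrite distrC [in leRHS]distrC !ger0_norm ?subr_ge0 ?clamp_mono//.
rewrite /clamp.
have [h1|h1] := leP b t; have [h2|h2] := leP b s;
  try (have [h3|h3] := leP a b); try (have [h4|h4] := leP a s);
  try (have [h5|h5] := leP a t); lra.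
Qed.

Lemma scalar_ac_clamp_continuous (h : R -> R) : scalar_ac a b h ->
  continuous (fun t => h (clamp a b t)).
Proof.
move=> sh s; apply/cvgrPdist_lt => e e0.
have [d d0 H] := sh e e0.
have /nbhs_ballP : exists2 r, 0 < r & ball s r `<=`
    (fun t => `|h (clamp a b s) - h (clamp a b t)| < e); last exact.
exists d => // t; rewrite /ball/= => st.
pose l (_ : 'I_1) := Num.min (clamp a b s) (clamp a b t).
pose r (_ : 'I_1) := Num.max (clamp a b s) (clamp a b t).
have := H 1%N l r; rewrite !big_ord1.
have rl : r ord0 - l ord0 = `|clamp a b s - clamp a b t|.
  by rewrite /r /l; have [?|?] := leP (clamp a b s) (clamp a b t);
    [rewrite ler0_norm|rewrite gtr0_norm]; lra.
rewrite rl => H'; apply: le_lt_trans (H' _ _ _).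
- by rewrite /r /l; have [?|?] := leP (clamp a b s) (clamp a b t);
    rewrite ?lexx// distrC.
- move=> ?; split; first by rewrite /l le_min !clamp_ge.
  split; last by rewrite /r ge_max !clamp_le.
  by apply: (@le_trans _ _ (clamp a b s)); rewrite /l /r ?ge_min ?lexx// le_max lexx.
- by apply/trivIsetP => i j _ _ /eqP[]; exact: (etrans (ord1 i) (esym (ord1 j))).
- exact: le_lt_trans (clamp_lip _ _) st.
Qed.

Context (g : R -> R) (ig : intg a b g).

Definition primitive t : R := lint a (clamp a b t) g.

Lemma primitive_continuous : continuous primitive.
Proof. exact: scalar_ac_clamp_continuous (scalar_ac_lint ig). Qed.

Lemma primitive_sub s t : s <= t ->
  primitive t - primitive s = lint (clamp a b s) (clamp a b t) g.
Proof.
move=> st; apply: lint_itv (clamp_ge s) (clamp_mono st) (clamp_le t) ig.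
Qed.

End clamp_lemmas.
End clamp.

(** * Approximate solutions of an inclusion, with delay *)

Section approximation.
Context {R : realType} {n m : nat} (a b : R) (ab : a <= b).
Context (A : 'M[R]_n) (B : 'M[R]_(n, m)) (beta : R -> 'cV[R]_n).
Context (res : R -> 'cV[R]_n -> 'cV[R]_m -> 'cV[R]_m) (phi : R -> R) (K : R).
Context (x0 : 'cV[R]_n).
Notation LR := (lebesgueType R).
Notation mu := (@completed_lebesgue_measure R).

(** The inclusion in abstract form: res t x w measures how far w is from being an
    admissible input at (t, x), and W(t, x) is its set of zeros in w.  The growth condition
    bears on approximate zeros, since the construction produces no others. *)
Record residual : Prop := Residual {
  res_beta : vintg a b beta;
  res_phi : intg a b phi;
  res_K : 0 <= K;
  res_meas : forall xi w, vmf a b xi -> vmf a b (fun t => res t (xi t) w);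
  res_cont : forall t, a <= t -> t <= b ->
    continuous (fun xw : 'cV[R]_n * 'cV[R]_m => res t xw.1 xw.2);
  res_ex : forall t x, a <= t -> t <= b -> exists w, res t x w = 0;
  res_conv : forall t x w w', a <= t -> t <= b -> res t x w = 0 -> res t x w' = 0 ->
    res t x (2^-1 *: (w + w')) = 0;
  res_bound : forall t x w, a <= t -> t <= b -> `|res t x w| <= 1 ->
    `|w| <= phi t + K * `|x|
}.

Context (Hres : residual).

(** Rational vectors with residual below e exist by continuity, and picking the first one
    gives a measurable choice. *)
Definition sel (e t : R) (x : 'cV[R]_n) : 'cV[R]_m :=
  qvec m (first_index (fun i => l1 (res t x (qvec m i)) < e)).

Lemma growth_ge0 t : a <= t -> t <= b -> 0 <= phi t.
Proof.
move=> at_ tb; have [w w0] := res_ex Hres 0 at_ tb.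
have := res_bound Hres at_ tb (_ : `|res t 0 w| <= 1).
by rewrite w0 normr0 => /(_ ler01); rewrite normr0 mulr0 addr0; exact: le_trans.
Qed.

Lemma sel_ex e t x : 0 < e -> a <= t -> t <= b ->
  exists i, l1 (res t x (qvec m i)) < e.
Proof.
move=> e0 at_ tb; have [w w0] := res_ex Hres x at_ tb.
have e1 : 0 < e / m.+1%:R by rewrite divr_gt0.
have cw : (fun w' => res t x w') @ w --> res t x w.
  have p : (fun w' : 'cV[R]_m => (x, w')) @ w --> (x, w).
    by apply: (@cvg_pair _ _ _ (nbhs w) (nbhs x) (nbhs w)); [exact: cvg_cst|exact: cvg_id].
  exact: (cvg_comp _ _ p (@res_cont Hres t at_ tb (x, w))).
have /cvgrPdist_lt/(_ _ e1) : (fun w' => res t x w') @ w --> res t x w by [].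
move=> /qvec_dense_l1[i]; rewrite w0 sub0r normrN => H; exists i.
apply: le_lt_trans (l1_norm _) _.
apply: (@le_lt_trans _ _ (m%:R * (e / m.+1%:R))); first by apply: ler_wpM2l => //; exact: ltW.
by rewrite mulrCA -[ltRHS]mulr1 ltr_pM2l// ltr_pdivrMr// mul1r ltr_nat.
Qed.

Lemma selP e t x : 0 < e -> a <= t -> t <= b -> `|res t x (sel e t x)| < e.
Proof.
move=> e0 at_ tb; have [H _] := first_indexP (sel_ex x e0 at_ tb).
exact: le_lt_trans (norm_l1 _) H.
Qed.

Lemma sel_bound e t x : 0 < e -> e <= 1 -> a <= t -> t <= b ->
  `|sel e t x| <= phi t + K * `|x|.
Proof.
move=> e0 e1 at_ tb; apply: (res_bound Hres at_ tb).
by apply/ltW; apply: lt_le_trans e1; exact: selP.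
Qed.

Lemma sel_vmf e xi : 0 < e -> vmf a b xi -> vmf a b (fun t => sel e t (xi t)).
Proof.
move=> e0 mxi c.
apply: (@first_index_measurable _ LR R `[a, b]%classic (measurable_cc a b)
  (fun i => [set t | l1 (res t (xi t) (qvec m i)) < e]) (fun i _ => qvec m i c ord0)).
- move=> i; apply: (measurable_l1_lt (T := LR) (measurable_cc a b)).
  exact: (res_meas Hres).
- by move=> i; exact: measurable_cst.
- by move=> t /=; rewrite in_itv/= => /andP[at_ tb]; exact: sel_ex.
Qed.

Definition coefA : R := n%:R * `|A|.
Definition coefB : R := m%:R * `|B|.
Definition rate : R := coefA + coefB * K.
Definition forcing (t : R) : R := coefB * phi t + l1 (beta t).
Definition start_bound : R := `|x0| + lint a b forcing.
(** The majorant of Gronwall's inequality.  It is the solution of b' = rate b that starts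
    from [start_bound], which makes the Picard operator below preserve it. *)
Definition bound (t : R) : R := start_bound * expR (rate * (clamp a b t - a)).
Definition sup_bound : R := start_bound * expR (rate * (b - a)).
(** It dominates the derivative of all approximate solutions, so that its primitive
    [modulus] is a common modulus of continuity. *)
Definition speed (t : R) : R := rate * sup_bound + forcing t.
Definition modulus : R -> R := primitive a b speed.

Lemma coefA_ge0 : 0 <= coefA. Proof. exact: mulr_ge0. Qed.
Lemma coefB_ge0 : 0 <= coefB. Proof. exact: mulr_ge0. Qed.
Lemma rate_ge0 : 0 <= rate.
Proof. by rewrite addr_ge0 ?coefA_ge0 ?mulr_ge0 ?(res_K Hres). Qed.

Lemma forcing_ge0 t : a <= t -> t <= b -> 0 <= forcing t.
Proof.
move=> at_ tb; rewrite addr_ge0//; first by rewrite mulr_ge0 ?coefB_ge0 ?growth_ge0.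
exact: sumr_ge0.
Qed.

Lemma intg_forcing : intg a b forcing.
Proof.
apply: intgD; first exact: intgZ (res_phi Hres).
exact: (intg_sum (fun i => intg_norm (res_beta Hres i))).1.
Qed.

Lemma start_bound_ge : `|x0| <= start_bound.
Proof. by rewrite lerDl lint_ge0//; exact: forcing_ge0. Qed.

Lemma start_bound_ge0 : 0 <= start_bound. Proof. exact: le_trans start_bound_ge. Qed.

Lemma bound_mono s t : s <= t -> bound s <= bound t.
Proof.
move=> st; rewrite ler_wpM2l ?start_bound_ge0// ler_expR ler_wpM2l ?rate_ge0//.
by rewrite lerD2r clamp_mono.
Qed.

Lemma bound_le_sup t : bound t <= sup_bound.
Proof.
rewrite ler_wpM2l ?start_bound_ge0// ler_expR ler_wpM2l ?rate_ge0// lerD2r.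
exact: clamp_le.
Qed.

Lemma intg_speed : intg a b speed.
Proof. by apply: intgD; [exact: intg_cst|exact: intg_forcing]. Qed.

Definition delay (k : nat) : R := k.+1%:R^-1.
Lemma delay_gt0 k : 0 < delay k. Proof. by rewrite invr_gt0. Qed.
Lemma delay_le1 k : delay k <= 1.
Proof. by rewrite invf_le1// ler1n. Qed.

Definition majorized (xi : R -> 'cV[R]_n) :=
  (forall i, continuous (fun t => xi t i ord0)) /\ forall t, `|xi t| <= bound t.

Definition delayed_rhs k (xi : R -> 'cV[R]_n) (r : R) : 'cV[R]_n :=
  A *m xi (r - delay k) + B *m sel (delay k) r (xi (r - delay k)) + beta r.

Lemma majorized_shift k xi : majorized xi -> vmf a b (fun r => xi (r - delay k)).
Proof.
move=> [cxi _] i; apply: cont_lmfun => t.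
apply: (@continuous_comp _ _ _ (fun r : R => r - delay k) (fun t => xi t i ord0)).
  by apply: cvgB; [exact: cvg_id|exact: cvg_cst].
exact: cxi.
Qed.

Lemma delayed_rhs_vmf k xi : majorized xi -> vmf a b (delayed_rhs k xi).
Proof.
move=> gxi; apply: vmfD; last exact: vintg_vmf (res_beta Hres).
apply: vmfD; apply: vmf_mul; first exact: majorized_shift.
by apply: sel_vmf; [exact: delay_gt0|exact: majorized_shift].
Qed.

Lemma delayed_rhs_le k xi t : majorized xi -> a <= t -> t <= b ->
  `|delayed_rhs k xi t| <= rate * bound t + forcing t.
Proof.
move=> [_ bxi] at_ tb.
have xib : `|xi (t - delay k)| <= bound t.
  apply: le_trans (bxi _) _; apply: bound_mono.
  by rewrite lerBlDr lerDl ltW// delay_gt0.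
rewrite /delayed_rhs; apply: le_trans (ler_normD _ _) _.
rewrite /forcing addrA; apply: lerD; last exact: norm_l1.
apply: le_trans (ler_normD _ _) _.
apply: (@le_trans _ _ (coefA * bound t + coefB * (phi t + K * bound t))).
  apply: lerD; apply: le_trans (mulmx_norm_le _ _) _.
    by rewrite ler_wpM2l ?coefA_ge0.
  rewrite ler_wpM2l ?coefB_ge0//.
  apply: le_trans (sel_bound _ (delay_gt0 k) (delay_le1 k) at_ tb) _.
  by rewrite lerD2l ler_wpM2l ?(res_K Hres).
by rewrite /rate; apply/eqP/eqP; lra.
Qed.

Lemma delayed_rhs_intg k xi : majorized xi -> vintg a b (delayed_rhs k xi).
Proof.
move=> gxi; apply: (vintg_le (delayed_rhs_vmf k gxi) intg_speed).
apply: aeW => t /=; rewrite in_itv/= => /andP[at_ tb].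
apply: le_trans (delayed_rhs_le k gxi at_ tb) _.
by rewrite lerD2r ler_wpM2l ?rate_ge0// bound_le_sup.
Qed.

(** Through the delay, the value at t depends on xi before t - delay k only: the iterates
    become stationary on intervals of growing length ([iterate_stable]). *)
Definition delayed_picard k (xi : R -> 'cV[R]_n) (t : R) : 'cV[R]_n :=
  x0 + vint a (clamp a b t) (delayed_rhs k xi).

(** The integral of rate * bound is bound - start_bound, and start_bound already contains
    the integral of [forcing]. *)
Lemma majorized_picard k xi : majorized xi -> majorized (delayed_picard k xi).
Proof.
move=> gxi; split=> [i|t].
  rewrite (_ : (fun t => _) =
      (fun t => x0 i ord0 + primitive a b (fun r => delayed_rhs k xi r i ord0) t)).
    move=> t; apply: cvgD; first exact: cvg_cst.
    exact: (primitive_continuous ab (delayed_rhs_intg k gxi i)).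
  by apply/funext => t; rewrite !mxE.
have ct := clamp_le ab t; have ac := clamp_ge a b t.
set c := clamp a b t in ct ac *.
have [ie le_] := lint_expR rate ac.
have ih : intg a c forcing := intgS (lexx a) ct intg_forcing.
apply: le_trans (ler_normD _ _) _.
have : `|vint a c (delayed_rhs k xi)| <=
    lint a c (fun r => start_bound * (rate * expR (rate * (r - a))) + forcing r).
  apply: vint_norm.
  - exact: vintgS (lexx a) ct (delayed_rhs_intg k gxi).
  - by apply: intgD => //; exact: intgZ.
  apply: aeW => r /=; rewrite in_itv/= => /andP[ar rc].
  have rb := le_trans rc ct.
  apply: le_trans (delayed_rhs_le k gxi ar rb) _; rewrite lerD2r /bound clamp_id//.
  by rewrite mulrCA.
rewrite lintD//; last exact: intgZ.
rewrite lintZ// le_ => H; apply: le_trans (lerD (lexx _) H) _.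
have Hle : lint a c forcing <= lint a b forcing.
  rewrite (lint_split ac ct intg_forcing) lerDl lint_ge0// => r cr rb.
  by apply: forcing_ge0 => //; exact: le_trans cr.
rewrite /bound -/c mulrBr mulr1 {2}/start_bound.
lra.
Qed.

Lemma picard_modulus_le k xi s t : majorized xi -> s <= t ->
  `|delayed_picard k xi t - delayed_picard k xi s| <= `|modulus t - modulus s|.
Proof.
move=> gxi st.
have iG := delayed_rhs_intg k gxi.
have cs := clamp_ge a b s; have cst := clamp_mono a b st; have ct := clamp_le ab t.
have -> : delayed_picard k xi t - delayed_picard k xi s =
    vint (clamp a b s) (clamp a b t) (delayed_rhs k xi).
  rewrite /delayed_picard (vint_split cs cst (vintgS (lexx a) ct iG)).
  by rewrite addrA [LHS]addrAC subrr add0r.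
rewrite /modulus (primitive_sub ab intg_speed st); apply: le_trans (ler_norm _).
apply: vint_norm.
- exact: vintgS cs ct iG.
- exact: intgS cs ct intg_speed.
apply: aeW => r /=; rewrite in_itv/= => /andP[sr rt].
have ar := le_trans cs sr; have rb := le_trans rt ct.
apply: le_trans (delayed_rhs_le k gxi ar rb) _.
by rewrite lerD2r ler_wpM2l ?rate_ge0// bound_le_sup.
Qed.

Lemma picard_modulus k xi s t : majorized xi ->
  `|delayed_picard k xi t - delayed_picard k xi s| <= `|modulus t - modulus s|.
Proof.
move=> gxi; have [st|ts] := leP s t; first exact: picard_modulus_le.
have E1 := distrC (delayed_picard k xi t) (delayed_picard k xi s).
have E2 := distrC (modulus t) (modulus s).
rewrite E1 E2; exact: (picard_modulus_le k gxi (ltW ts)).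
Qed.

Lemma majorized_cst : majorized (fun=> x0).
Proof.
split=> [i t|t]; first exact: cvg_cst.
apply: le_trans start_bound_ge _; rewrite -[leLHS]mulr1 ler_wpM2l ?start_bound_ge0//.
rewrite -expR0 ler_expR mulr_ge0 ?rate_ge0// subr_ge0; exact: clamp_ge.
Qed.

Definition iterate k j := iter j (delayed_picard k) (fun=> x0).

Lemma majorized_iterate k j : majorized (iterate k j).
Proof. by elim: j => [|j IH]; [exact: majorized_cst|exact: majorized_picard]. Qed.

Lemma picard_causal k X Y t : (forall r, r <= Num.max a t - delay k -> X r = Y r) ->
  delayed_picard k X t = delayed_picard k Y t.
Proof.
move=> XY; suff H : vint a (clamp a b t) (delayed_rhs k X) = vint a (clamp a b t) (delayed_rhs k Y).
  exact: (congr1 (fun z => x0 + z) H).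
apply: eq_vint => r ar rt.
suff E : X (r - delay k) = Y (r - delay k) by rewrite /delayed_rhs E.
apply: XY; rewrite lerD2r; apply: le_trans rt _.
rewrite /clamp ge_max; apply/andP; split; first by rewrite le_max lexx.
by rewrite ge_min; apply/orP; right; rewrite le_max lexx orbT.
Qed.

Lemma iterate_stable k j t : t <= a + j%:R * delay k ->
  iterate k j.+1 t = iterate k j t.
Proof.
elim: j t => [|j IH] t.
  rewrite mul0r addr0 => ta; change (delayed_picard k (fun=> x0) t = x0).
  by rewrite /delayed_picard clamp_low// vint_empty// addr0.
move=> tj; change (delayed_picard k (iterate k j.+1) t = delayed_picard k (iterate k j) t).
apply: picard_causal => r rt; apply: IH; apply: le_trans rt _.
rewrite lerBlDr ge_max; apply/andP; split.
  by rewrite -addrA lerDl addr_ge0 ?mulr_ge0// ltW// delay_gt0.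
by apply: le_trans tj _; rewrite -natr1 mulrDl mul1r addrA.
Qed.

(** As many iterations as there are delays in [a, b]: a fixed point on [a, b]. *)
Definition approx_x k := iterate k (Num.truncn ((b - a) * k.+1%:R)).+1.
Definition approx_w k (r : R) : 'cV[R]_m := sel (delay k) r (approx_x k (r - delay k)).

Lemma approx_x_eq k t : a <= t -> t <= b ->
  approx_x k t = x0 + vint a t (delayed_rhs k (approx_x k)).
Proof.
move=> at_ tb; rewrite {1}/approx_x -iterate_stable; last first.
  apply: le_trans tb _; rewrite -lerBlDl /delay -ler_pdivrMr// invrK.
  by apply/ltW; rewrite truncnS_gt.
change (delayed_picard k (approx_x k) t = x0 + vint a t (delayed_rhs k (approx_x k))).
by rewrite /delayed_picard clamp_id.
Qed.

Lemma approx_x_modulus k s t : `|approx_x k t - approx_x k s| <= `|modulus t - modulus s|.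
Proof. by apply: picard_modulus; exact: majorized_iterate. Qed.

Lemma approx_x_le k t : `|approx_x k t| <= sup_bound.
Proof.
apply: le_trans (bound_le_sup t).
by have [_] := majorized_iterate k (Num.truncn ((b - a) * k.+1%:R)).+1; apply.
Qed.

Lemma approx_w_vmf k : vmf a b (approx_w k).
Proof. by apply: sel_vmf; [exact: delay_gt0|apply: majorized_shift; exact: majorized_iterate]. Qed.

Lemma approx_w_le k t : a <= t -> t <= b -> `|approx_w k t| <= phi t + K * sup_bound.
Proof.
move=> at_ tb; apply: le_trans (sel_bound _ (delay_gt0 k) (delay_le1 k) at_ tb) _.
by rewrite lerD2l ler_wpM2l ?(res_K Hres)// approx_x_le.
Qed.

Lemma approx_w_res k t : a <= t -> t <= b ->
  `|res t (approx_x k (t - delay k)) (approx_w k t)| < delay k.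
Proof. by move=> at_ tb; apply: selP => //; exact: delay_gt0. Qed.

(** The state is evaluated at the delayed time in the equation and in the residual
    alike; the modulus of continuity makes the delay harmless in the limit. *)
Lemma approximate_solutions : exists (M : R) (G : R -> R)
  (xs : nat -> R -> 'cV[R]_n) (ws : nat -> R -> 'cV[R]_m),
  [/\ 0 <= M, continuous G, forall k t, `|xs k t| <= M,
      forall k s t, `|xs k t - xs k s| <= `|G t - G s| &
  forall k,
   [/\ vmf a b (fun r => xs k (r - delay k)), vmf a b (ws k),
      forall t, a <= t -> t <= b -> `|ws k t| <= phi t + K * M,
      forall t, a <= t -> t <= b -> `|res t (xs k (t - delay k)) (ws k t)| < delay k &
      forall t, a <= t -> t <= b -> xs k t = x0 + vint a t
        (fun r => A *m xs k (r - delay k) + B *m ws k r + beta r)]].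
Proof.
exists sup_bound, modulus, approx_x, approx_w; split.
- by rewrite mulr_ge0 ?start_bound_ge0 ?expR_ge0.
- exact: (primitive_continuous ab intg_speed).
- exact: approx_x_le.
- exact: approx_x_modulus.
move=> k; split.
- exact/majorized_shift/majorized_iterate.
- exact: approx_w_vmf.
- exact: approx_w_le.
- exact: approx_w_res.
- exact: approx_x_eq.
Qed.

End approximation.

(** * Solutions of the inclusion on a compact interval *)

Section limits.
Context {R : realType}.
Notation LR := (lebesgueType R).
Notation mu := (@completed_lebesgue_measure R).

Lemma cvg_coordP k (T : Type) (F : set_system T) {FF : Filter F}
    (f : T -> 'cV[R]_k) (l : 'cV[R]_k) :
  f @ F --> l <-> forall i, (fun t => f t i ord0) @ F --> l i ord0.
Proof.
split=> [fl i|H].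
  exact: (cvg_comp _ _ fl (@coord_continuous _ _ _ i ord0 l)).
apply/cvgrPdist_le => e e0.
have : \forall j \near F, forall i, `|l i ord0 - f j i ord0| <= e.
  by apply: filter_forall => i; have /cvgrPdist_le/(_ _ e0) := H i.
apply: filterS => j Hj; apply: cV_norm_le => [|i]; first exact: ltW.
by rewrite !mxE.
Qed.

Lemma vint_dct k a b (g_ : nat -> R -> 'cV[R]_k) (g : R -> 'cV[R]_k) (h : R -> R) :
  (forall j, vmf a b (g_ j)) -> vmf a b g -> intg a b h ->
  (forall j t, a <= t -> t <= b -> `|g_ j t| <= h t) ->
  {ae mu, forall t : LR, `[a, b]%classic t -> (fun j => g_ j t) @ \oo --> g t} ->
  (fun j => vint a b (g_ j)) @ \oo --> vint a b g.
Proof.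
move=> mg_ mg ih gh cg; apply/cvg_coordP => i.
rewrite mxE (_ : (fun j => _) = (fun j => lint a b (fun t => g_ j t i ord0))); last first.
  by apply/funext => j; rewrite mxE.
apply: (@lint_dct R a b (fun j t => g_ j t i ord0) _ h (fun j => mg_ j i) (mg i) ih).
- by apply: (aeS cg) => t H /H /cvg_coordP; apply.
- move=> j; apply: aeW => t /=; rewrite in_itv/= => /andP[at_ tb].
  exact: le_trans (coord_le _ i) (gh j t at_ tb).
Qed.

Lemma vintZ k a b (c : R) (x : R -> 'cV[R]_k) : vintg a b x ->
  vintg a b (fun t => c *: x t) /\ vint a b (fun t => c *: x t) = c *: vint a b x.
Proof.
move=> ix.
have E : (fun t => c *: x t) = (fun t => c%:M *m x t).
  by apply/funext => t; rewrite mul_scalar_mx.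
by rewrite E; split; [exact: vintg_mul|rewrite vint_mul// mul_scalar_mx].
Qed.

Lemma mulmx_continuous k l (M : 'M[R]_(k, l)) :
  continuous (mulmx M : 'cV[R]_l -> 'cV[R]_k).
Proof.
move=> u; apply/(@cvgrPdist_le _ _ _ (nbhs u)) => e e0.
set c := l%:R * `|M|; have c0 : 0 <= c by rewrite mulr_ge0.
have e1 : 0 < e / (c + 1) by rewrite divr_gt0// ltr_wpDl.
apply: filterS (near_norm_le u e1) => v uv.
rewrite -mulmxBr; apply: le_trans (mulmx_norm_le _ _) _; rewrite -/c.
apply: (@le_trans _ _ ((c + 1) * (e / (c + 1)))); last first.
  by rewrite mulrC mulfVK// gt_eqF// ltr_wpDl.
by apply: ler_pM => //; rewrite lerDl.
Qed.

Lemma lmfun_inv1norm a b (g : R -> R) : lmfun a b g ->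
  lmfun a b (fun t => (1 + `|g t|)^-1).
Proof.
move=> mg.
have c : continuous (fun s : R => (1 + `|s|)^-1).
  move=> s; apply: cvgV; first by rewrite gt_eqF// ltr_pwDl.
  by apply: cvgD; [exact: cvg_cst|apply: cvg_norm; exact: cvg_id].
exact: (measurableT_comp (continuous_measurable_fun c) mg).
Qed.

End limits.

Section existence.
Context {R : realType} {n m : nat} (a b : R) (ab : a <= b).
Context (A : 'M[R]_n) (B : 'M[R]_(n, m)) (beta : R -> 'cV[R]_n).
Context (res : R -> 'cV[R]_n -> 'cV[R]_m -> 'cV[R]_m) (phi : R -> R) (K : R).
Context (x0 : 'cV[R]_n).
Notation LR := (lebesgueType R).
Notation mu := (@completed_lebesgue_measure R).
Context (Hres : residual a b beta res phi K).

(** On the ball of radius r, inputs with small residual at states near y are e-close to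
    zeros of res t y.  Each w of the ball either is such a zero or has a residual that
    stays away from 0 nearby, and finitely many neighbourhoods cover the ball. *)
Lemma tube (t : R) (x : nat -> 'cV[R]_n) (y : 'cV[R]_n) (d : nat -> R) (r e : R) :
  a <= t -> t <= b -> x @ \oo --> y -> d @ \oo --> (0 : R) -> 0 < e ->
  \forall j \near \oo, forall w : 'cV[R]_m, `|w| <= r -> `|res t (x j) w| < d j ->
    exists2 p, res t y p = 0 & `|w - p| <= e.
Proof.
move=> at_ tb xy d0 e0.
have [cov _] := compact_near_coveringP [set w : 'cV[R]_m | `|w| <= r].
have := cov (@compact_cV_ball R m r) nat \oo (fun j w => `|res t (x j) w| < d j ->
    exists2 p, res t y p = 0 & `|w - p| <= e) _.
apply => w _.
have [w0|w0] := eqVneq (res t y w) 0.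
  exists ([set w' | `|w - w'| <= e], setT).
    split => /=; [exact: (near_norm_le w e0)|exact: filterT].
  by move=> [w' j] /= [ww' _] _; exists w => //; rewrite distrC.
pose eta := `|res t y w| / 2.
have eta0 : 0 < eta by rewrite divr_gt0// normr_gt0.
have /cvgrPdist_lt/(_ _ eta0) := @res_cont _ _ _ _ _ _ _ _ _ Hres t at_ tb (y, w).
move=> [[U V] /= [Uy Vw] UV].
have Ux : \forall j \near \oo, U (x j) by exact: xy Uy.
have dj : \forall j \near \oo, d j < eta.
  have /cvgrPdist_lt/(_ _ eta0) := d0; apply: filterS => j.
  by rewrite sub0r normrN; apply: le_lt_trans; exact: ler_norm.
exists (V, [set j | U (x j) /\ d j < eta]).
  by split => //; exact: filterI.
move=> [w' j] /= [Vw' [Uxj djeta]] small.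
have := UV (x j, w') (conj Uxj Vw') => /= H.
have H2 := ler_distD (res t (x j) w') (res t y w) 0.
rewrite !subr0 in H2.
have : `|res t y w| = eta + eta by rewrite -splitr.
by move: H2; lra.
Qed.

(** The inputs, divided by their integrable bound om, are unit bounded, so [komlos]
    applies.  The two conditions on the limit are stable under midpoints, hence pass to
    the convex combinations: closeness of B * (integral of the input) to its limit value,
    and closeness of the input to the convex set of zeros of res t (x t). *)
Lemma existence : exists (x : R -> 'cV[R]_n) (w : R -> 'cV[R]_m),
  [/\ vintg a b x, vintg a b w, x a = x0,
   forall t, a <= t -> t <= b ->
     x t = x0 + vint a t (fun r => A *m x r + B *m w r + beta r) &
   {ae mu, forall t : LR, `[a, b]%classic t -> res t (x t) (w t) = 0}].
Proof.
have [M [G [xs [ws [M0 cG xsM xsG P]]]]] := approximate_solutions ab A B x0 Hres.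
have [sg [x [sgj cx xM xG]]] := ascoli_subsequence cG xsM xsG.
pose d j : R := delay (sg j).
pose X j := xs (sg j); pose W j := ws (sg j).
have d0 : d @ \oo --> (0 : R).
  apply/cvgrPdist_lt => e e0; near=> j.
  rewrite sub0r normrN ger0_norm; last by rewrite ltW// delay_gt0.
  apply: (@le_lt_trans _ _ j.+1%:R^-1); last first.
    by near: j; exact: (near_infty_natSinv_lt (PosNum e0)).
  by rewrite lef_pV2 ?posrE// ler_nat ltnS.
have cXd t : (fun j => X j (t - d j)) @ \oo --> x t.
  have ctd : (fun j => t - d j) @ \oo --> t.
    by rewrite -[X in _ --> X]subr0; apply: cvgB => //; exact: cvg_cst.
  have cGd := cvg_comp _ _ ctd (cG t).
  apply/cvgrPdist_lt => e e0; have e2 : 0 < e / 2 by rewrite divr_gt0.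
  have /cvgrPdist_lt/(_ _ e2) h1 := cx t.
  have /cvgrPdist_lt/(_ _ e2) h2 := cGd.
  near=> j.
  have -> : x t - X j (t - d j) = (x t - X j t) + (X j t - X j (t - d j)) by rewrite addrA subrK.
  apply: le_lt_trans (ler_normD _ _) _; rewrite (splitr e); apply: ltrD.
    by near: j; exact: h1.
  by apply: le_lt_trans (xsG _ _ _) _; near: j; exact: h2.
have cxi i : continuous (fun t => x t i ord0).
  move=> t; apply/cvgrPdist_lt => e e0.
  have /cvgrPdist_lt/(_ _ e0) := cG t; apply: filterS => s; apply: le_lt_trans.
  by apply: le_trans (xG s t); apply: le_trans (coord_le _ i); rewrite !mxE.
have mx : vmf a b x by move=> i; exact: cont_lmfun.
have ix : vintg a b x.
  by apply: (vintg_le mx (intg_cst a b M)); apply: aeW => t _; exact: xM.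
pose om (t : R) : R := 1 + `|phi t + K * M|.
have om0 t : 0 < om t by rewrite ltr_pwDl.
have iom : intg a b om.
  apply: intgD; first exact: intg_cst.
  by apply: intg_norm; apply: intgD; [exact: res_phi Hres|exact: intg_cst].
have Wom j t : a <= t -> t <= b -> `|W j t| <= om t.
  move=> at_ tb; have [_ _ /(_ t at_ tb) H _ _] := P (sg j).
  apply: le_trans H _; apply: le_trans (ler_norm _) _; rewrite lerDr//.
pose z j (t : R) := (om t)^-1 *: W j t.
have omz j t : om t *: z j t = W j t.
  by rewrite scalerA mulfV ?scale1r// gt_eqF.
have uz j : unit_bounded a b (z j).
  split.
    move=> i; rewrite (_ : (fun t => _) = (fun t => (om t)^-1 * W j t i ord0)).
      apply: lmfunM; last by have [_ + _ _ _] := P (sg j); apply.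
      apply: lmfun_inv1norm; apply: intg_lmfun.
      by apply: intgD; [exact: res_phi Hres|exact: intg_cst].
    by apply/funext => t; rewrite mxE.
  move=> t at_ tb; rewrite normrZ gtr0_norm ?invr_gt0// mulrC ler_pdivrMr// mul1r.
  exact: Wom.
have [u [wh [tu [mwh wh1] cu]]] := komlos ab uz.
have uu j : unit_bounded a b (u j) by exact: tailconv_unit_bounded uz (tu j).
pose w t := om t *: wh t.
have scale_vmf (y : R -> 'cV[R]_m) : vmf a b y -> vmf a b (fun t => om t *: y t).
  move=> my i; rewrite (_ : (fun t => _) = (fun t => om t * y t i ord0)).
    by apply: lmfunM; [exact: intg_lmfun iom|exact: my].
  by apply/funext => t; rewrite mxE.
have scale_le (y : R -> 'cV[R]_m) t : `|y t| <= 1 -> `|om t *: y t| <= om t.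
  by move=> y1; rewrite normrZ gtr0_norm// ler_piMr// ltW.
have scale_intg (y : R -> 'cV[R]_m) : unit_bounded a b y -> vintg a b (fun t => om t *: y t).
  move=> [my y1]; apply: (vintg_le (scale_vmf _ my) iom); apply: aeW => t /=.
  by rewrite in_itv/= => /andP[at_ tb]; apply: scale_le; exact: y1.
have iw : vintg a b w by apply: scale_intg.
have cu' : {ae mu, forall t : LR, `[a, b]%classic t -> (fun j => u j t) @ \oo --> wh t}.
  by apply: (aeS cu) => t H tab; apply/cvg_coordP => i; exact: H.
exists x, w.
have eqn t : a <= t -> t <= b ->
    x t = x0 + vint a t (fun r => A *m x r + B *m w r + beta r).
  move=> at_ tb.
  have sub (k : nat) (y : R -> 'cV[R]_k) : vintg a b y -> vintg a t y by exact: vintgS.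
  have suba (Q : R -> Prop) : {ae mu, forall r : LR, `[a, b]%classic r -> Q r} ->
      {ae mu, forall r : LR, `[a, t]%classic r -> Q r}.
    by move=> H; apply: (aeS H) => r + art; apply; apply: subset_cc art.
  have ibeta := sub _ _ (res_beta Hres).
  (* what the integral of B w must be for the equation to hold *)
  pose Y := x t - x0 - (vint a t (fun r => A *m x r) + vint a t beta).
  have iXd j : vintg a b (fun r => X j (r - d j)).
    have [mXd _ _ _ _] := P (sg j).
    by apply: (vintg_le mXd (intg_cst a b M)); apply: aeW => r _; exact: xsM.
  have iW j : vintg a b (W j).
    have [_ mW _ _ _] := P (sg j); apply: (vintg_le mW iom).
    by apply: aeW => r /=; rewrite in_itv/= => /andP[ar rb]; exact: Wom.
  have iXt j := sub _ _ (iXd j).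
  have iWt j := sub _ _ (iW j).
  have ixt := sub _ _ ix.
  have iwt := sub _ _ iw.
  have cBW : (fun j => B *m vint a t (W j)) @ \oo --> Y.
    have E j : B *m vint a t (W j) =
       X j t - x0 - (A *m vint a t (fun r => X j (r - d j)) + vint a t beta).
      have [_ _ _ _ /(_ t at_ tb) Ex] := P (sg j); rewrite [X j t]Ex.
      rewrite vintD; [|by apply: vintgD; apply: vintg_mul; [exact: iXt|exact: iWt]|exact: ibeta].
      rewrite vintD; [|by apply: vintg_mul; exact: iXt|by apply: vintg_mul; exact: iWt].
      rewrite (vint_mul A (iXt j)) (vint_mul B (iWt j)).
      by rewrite [x0 + _]addrC addrK opprD addrACA subrr addr0 [_ + B *m _]addrC addrK.
    rewrite (_ : (fun j => _) = (fun j => X j t - x0 -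
        (A *m vint a t (fun r => X j (r - d j)) + vint a t beta))); last first.
      by apply/funext => j; exact: E.
    rewrite /Y (vint_mul A ixt).
    apply: cvgB; first by apply: cvgB; [exact: cx|exact: cvg_cst].
    apply: cvgD; last exact: cvg_cst.
    have cvX : (fun j => vint a t (fun r => X j (r - d j))) @ \oo --> vint a t x.
      apply: (vint_dct _ _ (intg_cst a t M)).
      - by move=> j; exact: vintg_vmf.
      - exact: vintg_vmf.
      - by move=> j r _ _; exact: xsM.
      - by apply: aeW => r _; exact: cXd.
    exact: (cvg_comp _ _ cvX (@mulmx_continuous _ _ _ A _)).
  suff YE : Y = B *m vint a t w.
    rewrite vintD; [|by apply: vintgD; exact: vintg_mul|exact: ibeta].
    rewrite vintD; [|exact: vintg_mul..].
    rewrite (vint_mul B iwt).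
    by rewrite -YE /Y; apply/matrixP => i j; rewrite !mxE; ring.
  pose Q (y : R -> 'cV[R]_m) := vint a t (fun r => om r *: y r).
  have cQ : (fun j => B *m Q (u j)) @ \oo --> B *m vint a t w.
    have H : (fun j => Q (u j)) @ \oo --> vint a t w.
      apply: (vint_dct _ _ (intgS (lexx a) tb iom)).
      - by move=> j; apply: vintg_vmf; apply: sub; exact: scale_intg.
      - exact: vintg_vmf.
      - move=> j r ar rt; apply: scale_le; have [_ H] := uu j.
        by apply: H => //; exact: le_trans tb.
      - apply: suba; apply: (aeS cu') => r H rab.
        by apply: cvgZr; exact: H.
    exact: (cvg_comp _ _ H (@mulmx_continuous _ _ _ B _)).
  have Qmid y y' : unit_bounded a b y -> unit_bounded a b y' ->
      Q (fun r => 2^-1 *: (y r + y' r)) = 2^-1 *: (Q y + Q y').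
    move=> uy uy'; have i1 := sub _ _ (scale_intg _ uy); have i2 := sub _ _ (scale_intg _ uy').
    rewrite /Q -(vintD i1 i2) -((vintZ 2^-1 (vintgD i1 i2)).2).
    apply: eq_vint => r _ _ /=.
    by apply/matrixP => i j; rewrite !mxE; ring.
  apply/eqP; rewrite -subr_eq0 -normr_le0; apply/ler_addgt0Pr => e e0; rewrite add0r.
  have e2 : 0 < e / 2 by rewrite divr_gt0.
  have /cvgrPdist_le/(_ _ e2)[N _ HN] := cBW.
  have tail y : tailconv z N y -> `|Y - B *m Q y| <= e / 2.
    elim=> [j Nj|{}y y' ty IHy ty' IHy'].
      suff -> : Q (z j) = vint a t (W j) by exact: HN.
      by apply: eq_vint => r _ _; exact: omz.
    rewrite Qmid; [|exact: tailconv_unit_bounded ty|exact: tailconv_unit_bounded ty'].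
    rewrite (_ : Y - _ = 2^-1 *: ((Y - B *m Q y) + (Y - B *m Q y'))); last first.
      rewrite -scalemxAr mulmxDr.
      move: (B *m Q y) (B *m Q y') => p q.
      by apply/matrixP => i j; rewrite !mxE; field.
    exact: (ball_midpoint IHy IHy').
  have /cvgrPdist_le/(_ _ e2)[N' _ HN'] := cQ.
  pose j := maxn N N'.
  have h1 := tail _ (tailconvS (leq_maxl N N') (tu j)).
  have h2 := HN' j (leq_maxr N N').
  rewrite (_ : Y - _ = (Y - B *m Q (u j)) - (B *m vint a t w - B *m Q (u j))); last first.
    by rewrite opprB addrA subrK.
  by apply: le_trans (ler_normB _ _) _; rewrite (splitr e); exact: lerD.
split => //.
  by rewrite eqn// vint_empty// addr0.
apply: (aeS cu') => t H tab; have Ht := H tab; move: tab.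
rewrite /= in_itv/= => /andP[at_ tb].
have cw : (fun j => om t *: u j t) @ \oo --> w t by apply: cvgZr.
have near_zero (e : R) : 0 < e -> exists2 p, res t (x t) p = 0 & `|w t - p| <= e.
  move=> e0; have e2 : 0 < e / 2 by rewrite divr_gt0.
  have [N _ HN] := tube (om t) at_ tb (cXd t) d0 e2.
  have /cvgrPdist_le/(_ _ e2)[N' _ HN'] := cw.
  pose j := maxn N N'.
  pose We : set 'cV[R]_m := [set q | exists2 p, res t (x t) p = 0 & `|om t *: q - p| <= e / 2].
  have [p p0 pe] : We (u j t).
    apply: (tailconv_ind_at _ _ (tailconvS (leq_maxl N N') (tu j))).
      move=> q q' [p p0 pq] [p' p'0 pq'].
      exists (2^-1 *: (p + p')); first exact: (res_conv Hres at_ tb p0 p'0).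
      rewrite (_ : _ - _ = 2^-1 *: ((om t *: q - p) + (om t *: q' - p'))).
        exact: (ball_midpoint pq pq').
      by apply/matrixP => i i'; rewrite !mxE; ring.
    move=> l Nl; rewrite /We/= omz.
    apply: (HN l Nl); first exact: Wom.
    by have [_ _ _ + _] := P (sg l); apply.
  exists p => //; rewrite (_ : w t - p = (w t - om t *: u j t) + (om t *: u j t - p)); last first.
    by rewrite addrA subrK.
  apply: le_trans (ler_normD _ _) _; rewrite (splitr e); apply: lerD => //.
  by apply: HN'; exact: leq_maxr.
apply/eqP/negPn/negP => rn0.
have r0 : 0 < `|res t (x t) (w t)| by rewrite normr_gt0.
have := @res_cont _ _ _ _ _ _ _ _ _ Hres t at_ tb (x t, w t).
move=> /cvgrPdist_lt/(_ _ r0)[[U V] /= [Ux Vw] UV].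
have /nbhs_ballP[e /= e0 eV] := Vw.
have e2 : 0 < e / 2 by rewrite divr_gt0.
have [p p0 pe] := near_zero _ e2.
have Vp : V p.
  apply: eV; rewrite -ball_normE /ball_/=; apply: le_lt_trans pe _.
  by rewrite ltr_pdivrMr//; lra.
have := UV (x t, p) (conj (nbhs_singleton Ux) Vp) => /=.
by rewrite p0 subr0 ltxx.
Unshelve. all: by end_near. Qed.

End existence.

(** * The inclusion of a Lur'e system *)

Section growth.
Context {R : realType} {n m me p : nat}.
Context (C : 'M[R]_(p, n)) (D : 'M[R]_(p, m)) (De : 'M[R]_(p, me)).
Context (f : R -> 'cV[R]_p -> 'cV[R]_m).
Notation LR := (lebesgueType R).
Notation mu := (@completed_lebesgue_measure R).

(** The contribution of D w to the growth of f is absorbed in the left-hand side, since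
    c * opnorm D < 1.  Where the argument of f is small, the bound M applies instead of
    the linear one. *)
Lemma fixed_point_bound (t rho c M : R) (xi : 'cV[R]_p) (w : 'cV[R]_m) :
  0 < c -> c * opnorm D < 1 ->
  (forall z, enorm z <= rho -> enorm (f t z) <= M) ->
  (forall z, rho <= enorm z -> enorm (f t z) <= c * enorm z) -> 0 <= M ->
  `|w - f t (xi + D *m w)| <= 1 ->
  `|w| <= (m%:R + M + c * p%:R * `|xi|) / (1 - c * opnorm D).
Proof.
move=> c0 cD small large M0 wf.
have k0 : 0 < 1 - c * opnorm D by rewrite subr_gt0.
rewrite ler_pdivlMr//.
have ff z : enorm (f t z) <= M + c * enorm z.
  have [h|h] := leP (enorm z) rho.
    by apply: le_trans (small _ h) _; rewrite lerDl mulr_ge0 ?enorm_ge0// ltW.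
  by apply: le_trans (large _ (ltW h)) _; rewrite lerDr.
have h1 : enorm w <= enorm (w - f t (xi + D *m w)) + enorm (f t (xi + D *m w)).
  by have := enormD (w - f t (xi + D *m w)) (f t (xi + D *m w)); rewrite subrK.
have h2 : enorm (w - f t (xi + D *m w)) <= m%:R.
  by apply: le_trans (enorm_norm _) _; rewrite ler_piMr.
have h3 := ff (xi + D *m w).
have h4 : c * enorm (xi + D *m w) <= c * (p%:R * `|xi|) + c * opnorm D * enorm w.
  rewrite -mulrA -mulrDr ler_pM2l//; apply: le_trans (enormD _ _) _.
  by apply: lerD; [exact: enorm_norm|exact: opnorm_ge].
have h5 : enorm w * (1 - c * opnorm D) <= m%:R + M + c * p%:R * `|xi| by lra.
by apply: le_trans h5; rewrite ler_pM2r//; exact: norm_enorm.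
Qed.

Context (f_caratheodory : caratheodory_fun f).
Context (A1 : lure_A1 C D De f) (A3 : lure_A3 C D De f).
Context (f_loc_bounded : forall K : set 'cV[R]_p, compact K ->
    exists phi : R -> R,
      [/\ forall t, 0 <= t -> 0 <= phi t,
          L1loc nonnegR phi &
          forall t, 0 <= t ->
            (ereal_sup [set (enorm (f t xi))%:E | xi in K] <= (phi t)%:E)%E]).
Context (f_growth : forall T : set R, compact T -> T `<=` nonnegR ->
    exists rho c : R,
      [/\ 0 < rho, 0 < c, c * opnorm D < 1 &
          {ae lebesgue, forall t : lebesgueType R, T t ->
            (ereal_sup [set (enorm (f t xi) / enorm xi)%:E
                       | xi in [set xi : 'cV[R]_p | (rho <= enorm xi)%R]]
             <= c%:E)%E}]).

Lemma cc_nonneg (a b : R) : 0 <= a -> `[a, b] `<=` nonnegR.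
Proof. by move=> a0 t /=; rewrite in_itv/= => /andP[/(le_trans a0)]. Qed.

(** [fixed_point_bound] at almost every time, with the same rho and c on all of [a, b]. *)
Lemma uniform_growth (a b : R) : 0 <= a -> exists (phi : R -> R) (K : R),
  [/\ intg a b phi, 0 <= K, forall t, a <= t -> t <= b -> 1 <= phi t &
   {ae mu, forall t : LR, `[a, b]%classic t -> forall xi (w : 'cV[R]_m),
      `|w - f t (xi + D *m w)| <= 1 -> `|w| <= phi t + K * `|xi|}].
Proof.
move=> a0.
have [rho [c [rho0 c0 cD ae]]] := f_growth (@segment_compact R a b) (@cc_nonneg a b a0).
have [phi [phi0 iphi fphi]] := f_loc_bounded (@compact_enorm_ball R p rho).
have k0 : 0 < 1 - c * opnorm D by rewrite subr_gt0.
exists (fun t => 1 + ((m%:R / (1 - c * opnorm D)) + (1 - c * opnorm D)^-1 * phi t)),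
  (c * p%:R / (1 - c * opnorm D)); split.
- apply: intgD; first exact: intg_cst.
  apply: intgD; first exact: intg_cst.
  by apply: intgZ; exact: (iphi a b (@cc_nonneg a b a0)).
- by rewrite divr_ge0 ?mulr_ge0// ltW.
- move=> t at_ tb; rewrite lerDl addr_ge0// ?divr_ge0 ?mulr_ge0 ?invr_ge0//; try exact: ltW.
  by apply: phi0; exact: le_trans at_.
apply: (aeS ae) => t gr tab xi w wf.
have t0 : 0 <= t by move: tab; rewrite /= in_itv/= => /andP[/(le_trans a0)].
have := @fixed_point_bound t rho c (phi t) xi w c0 cD _ _ (phi0 t t0) wf.
have k0' : 1 - c * opnorm D != 0 by rewrite gt_eqF.
move=> H; apply: le_trans (H _ _) _.
- move=> z zr; have := fphi t t0; move=> /(le_trans _); rewrite -lee_fin; apply.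
  by apply: ereal_sup_ubound; exists z.
- move=> z zr; have z0 : 0 < enorm z by exact: lt_le_trans zr.
  rewrite -ler_pdivrMr// -lee_fin; apply: le_trans (gr tab).
  by apply: ereal_sup_ubound; exists z.
- rewrite [leLHS](_ : _ = (m%:R / (1 - c * opnorm D) + (1 - c * opnorm D)^-1 * phi t
    + c * p%:R / (1 - c * opnorm D) * `|xi|)); last by field.
  by rewrite lerD2r lerDr.
Qed.

Context (v : R -> 'cV[R]_me) (Hv : Linftyloc nonnegR v).

Lemma v_vintg (a b : R) : 0 <= a -> vintg a b v.
Proof.
move=> a0; have [mv [M vM]] := Hv (@cc_nonneg a b a0).
apply: (vintg_le _ (intg_cst a b M)); first exact: mv.
by apply: (aeS vM) => t H /H; apply: le_trans; exact: norm_enorm.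
Qed.

(** At the times of the null set where the growth bound fails, the equation is replaced by
    w = 0, so that the conditions of [residual] hold at every time. *)
Definition lure_res (phi : R -> R) (K : R) (t : R) (x : 'cV[R]_n) (w : 'cV[R]_m) : 'cV[R]_m :=
  if `[< forall xi (w : 'cV[R]_m),
      `|w - f t (xi + D *m w)| <= 1 -> `|w| <= phi t + K * `|xi| >]
  then w - f t (C *m x + De *m v t + D *m w) else w.

Lemma f_comp_vmf (a b : R) (xi : R -> 'cV[R]_p) : 0 <= a -> vmf a b xi ->
  vmf a b (fun t => f t (xi t)).
Proof.
move=> a0 mxi i; have [fc fm] := f_caratheodory.
apply: (@caratheodory_comp _ LR R `[a, b]%classic (measurable_cc a b) _
   (fun t z => f t z i ord0) xi _ _ mxi).
- move=> t tab z; have t0 : 0 <= t := @cc_nonneg a b a0 t tab.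
  exact: (cvg_comp _ _ (@fc t t0 z) (@coord_continuous _ _ _ i ord0 _)).
- move=> z; apply: measurable_funS (fm z i); last exact: cc_nonneg.
  rewrite (_ : nonnegR = [set` `[(0 : R), +oo[ ]); first exact: itv_lebesgue.
  by apply/seteqP; split => t /=; rewrite in_itv/= andbT.
Qed.

(** The inputs admissible at (t, x) are the values of f t on the fibre of
    C x + De v(t) under lureF t, a vector in the image of (C, De): A1 makes them exist,
    A3 makes them a convex set. *)
Lemma lure_residual (a b : R) (beta : R -> 'cV[R]_n) : 0 <= a -> vintg a b beta ->
  exists (psi phi : R -> R) (L K : R),
   residual a b beta (lure_res psi L) phi K /\
   {ae mu, forall t : LR, `[a, b]%classic t -> forall x w,
      lure_res psi L t x w = w - f t (C *m x + De *m v t + D *m w)}.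
Proof.
move=> a0 ibeta.
have [psi [L [ipsi L0 psi1 ae]]] := uniform_growth b a0.
pose phi t := psi t + L * l1 (De *m v t).
have nC := @mulmx_norm_le R p n C.
set kC := n%:R * `|C| in nC.
have kC0 : 0 <= kC by rewrite mulr_ge0.
have good_t t : a <= t -> t <= b -> 1 <= phi t.
  move=> at_ tb; apply: le_trans (psi1 t at_ tb) _; rewrite lerDl mulr_ge0//.
  exact: sumr_ge0.
have iphi : intg a b phi.
  apply: intgD => //; apply: intgZ.
  have iDv : vintg a b (fun t => De *m v t) by apply: vintg_mul; exact: v_vintg.
  exact: (intg_sum (fun i => intg_norm (iDv i))).1.
have resE : {ae mu, forall t : LR, `[a, b]%classic t -> forall x w,
      lure_res psi L t x w = w - f t (C *m x + De *m v t + D *m w)}.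
  by apply: (aeS ae) => t H tab x w; rewrite /lure_res asboolT//; exact: H.
exists psi, phi, L, (L * kC); split => //.
have inim t x : lure_im C De (C *m x + De *m v t).
  exists (col_mx x (v t)) => //; exact: mul_row_col.
split => //.
- by rewrite mulr_ge0.
- move=> xi w mxi.
  have mf : vmf a b (fun t => w - f t (C *m xi t + De *m v t + D *m w)).
    apply: vmfB; first exact: vmf_cst.
    apply: f_comp_vmf => //; apply: vmfD; last exact: vmf_cst.
    by apply: vmfD; apply: vmf_mul => //; apply: vintg_vmf; exact: v_vintg.
  by apply: ae_vmf mf _; apply: (aeS resE) => t H /H ->.
- move=> t at_ tb [x w]; rewrite /lure_res; case: asboolP => _; last first.
    exact: cvg_snd.
  have t0 := le_trans a0 at_.
  have cC : (fun xw : 'cV[R]_n * 'cV[R]_m => C *m xw.1) @ (x, w) --> C *m x.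
    have c1 : (fun xw : 'cV[R]_n * 'cV[R]_m => xw.1) @ (x, w) --> x by exact: cvg_fst.
    exact: (cvg_comp _ _ c1 (@mulmx_continuous _ _ _ C x)).
  have cD : (fun xw : 'cV[R]_n * 'cV[R]_m => D *m xw.2) @ (x, w) --> D *m w.
    have c2 : (fun xw : 'cV[R]_n * 'cV[R]_m => xw.2) @ (x, w) --> w by exact: cvg_snd.
    exact: (cvg_comp _ _ c2 (@mulmx_continuous _ _ _ D w)).
  have cA : (fun xw : 'cV[R]_n * 'cV[R]_m => C *m xw.1 + De *m v t + D *m xw.2) @ (x, w)
      --> C *m x + De *m v t + D *m w.
    exact: (cvgD (cvgD cC (cvg_cst _)) cD).
  have [fc _] := f_caratheodory.
  have cf := cvg_comp _ _ cA (@fc t t0 _).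
  by apply: cvgB; [exact: cvg_snd|exact: cf].
- move=> t x at_ tb; rewrite /lure_res; case: asboolP => _; last by exists 0.
  have t0 := le_trans a0 at_.
  have [z zE] := A1 t0 (inim t x).
  exists (f t z); move: zE; rewrite /= /lureF => <-.
  by rewrite subrK subrr.
- move=> t x w w' at_ tb; rewrite /lure_res; case: asboolP => _; last first.
    by move=> -> ->; rewrite addr0 scaler0.
  have t0 := le_trans a0 at_.
  set eta := C *m x + De *m v t.
  have fib u : u - f t (eta + D *m u) = 0 ->
      u \in (f t @` (lureF D f t @^-1` [set eta]) : set (convex_lmodType 'cV[R]_m)).
    move=> /eqP; rewrite subr_eq0 => /eqP uE; apply/mem_set; exists (eta + D *m u); last by [].
    by rewrite /= /lureF -uE addrK.
  move=> /fib w1 /fib w2.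
  have h0 : (0 : R) <= 2^-1 by rewrite invr_ge0.
  have h1 : (2^-1 : R) <= 1 by rewrite invf_le1// ler1n.
  pose h : {i01 R} := Itv01 h0 h1.
  have := A3 t0 (inim t x) h w1 w2 => /set_mem[z zE fz].
  have {}fz : f t z = 2^-1 *: (w + w').
    rewrite fz [LHS](_ : _ = 2^-1 *: w + (1 - 2^-1) *: w')// scalerDr.
    by congr (_ + _ *: _); field.
  rewrite -fz; move: zE; rewrite /= /lureF -/eta => <-.
  by rewrite subrK subrr.
- move=> t x w at_ tb; rewrite /lure_res; case: asboolP => [good|_]; last first.
    move=> /le_trans; apply; apply: le_trans (good_t t at_ tb) _.
    by rewrite lerDl !mulr_ge0.
  move=> /good H; apply: le_trans H _; rewrite /phi -addrA lerD2l -mulrA -mulrDr.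
  apply: ler_wpM2l => //; apply: le_trans (ler_normD _ _) _; rewrite addrC.
  by apply: lerD; [exact: norm_l1|exact: nC].
Qed.

End growth.

(** * Exhaustion of half-open intervals *)

Section integrable_union.
Context d (T : measurableType d) {R : realType} (mu : {measure set T -> \bar R}).

Lemma integrable_setU_cover (A B : set T) (g : T -> \bar R) :
  measurable A -> measurable B -> mu.-integrable A g -> mu.-integrable B g ->
  mu.-integrable (A `|` B) g.
Proof.
move=> mA mB iA iB; have /integrableP[mgA gA] := iA.
have mAB : measurable (A `|` B) by exact: measurableU.
have mg : measurable_fun (A `|` B) g.
  by apply/measurable_funU => //; split => //; exact: (measurable_int mu iB).
have iBA : mu.-integrable (B `\` A) g.
  by apply: integrableS iB => //; exact: measurableD.
have /integrableP[_ gBA] := iBA.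
apply/integrableP; split => //.
have E : A `|` B = A `|` (B `\` A) by rewrite setUDr setDv setD0.
rewrite E ge0_integral_setU//.
- exact: lte_add_pinfty.
- exact: measurableD.
- by rewrite -E; apply: measurableT_comp.
- by rewrite disj_set2E setDIK.
Qed.

End integrable_union.

Section exhaustion.
Context {R : realType}.
Notation LR := (lebesgueType R).
Notation mu := (@completed_lebesgue_measure R).

Lemma intg_join a c b (g : R -> R) : a <= c -> c <= b ->
  intg a c g -> intg c b g -> intg a b g.
Proof.
move=> ac cb i1 i2.
have := integrable_setU_cover (measurable_cc a c) (measurable_cc c b) i1 i2.
apply: integrableS; [by apply: measurableU; exact: measurable_cc|exact: measurable_cc|].
move=> t /=; rewrite !in_itv/= => /andP[-> ->]; rewrite andbT.
by have [?|/ltW ?] := leP t c; [left|right].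
Qed.

Lemma ae_set1 (c : R) : {ae mu, forall t : LR, (t : R) != c}.
Proof.
exists [set c]; split.
- by rewrite -set_itv1; exact: itv_lebesgue.
- exact: mu_set1.
- by move=> t /= /negP; rewrite negbK => /eqP.
Qed.

(** The intervals [t0, q] with q rational are countably many and exhaust [t0, tau[. *)
Lemma ae_exhaust (t0 : R) (tau : \bar R) (P : R -> Prop) :
  (forall b, t0 <= b -> (b%:E < tau)%E ->
    {ae mu, forall t : LR, `[t0, b]%classic t -> P t}) ->
  {ae mu, forall t : LR, tint t0 tau t -> P t}.
Proof.
move=> H.
have K : {ae mu, forall t : LR, forall k : nat, if @unpickle rat k is Some q
    then ((ratr q : R)%:E < tau)%E -> `[t0, ratr q]%classic t -> P t else True}.
  apply: ae_foralln => k; case: unpickle => [q|]; last exact: aeW.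
  have [qtau|qtau] := boolP ((ratr q : R)%:E < tau)%E; last by apply: aeW.
  have [tq|qt] := leP t0 (ratr q).
    by apply: (aeS (H _ tq qtau)) => t.
  apply: aeW => t _ /=; rewrite in_itv/= => /andP[a b].
  by have := le_lt_trans (le_trans a b) qt; rewrite ltxx.
apply: (aeS K) => t Ht [t0t ttau].
have [q tq qtau] : exists2 q : rat, t < ratr q & ((ratr q : R)%:E < tau)%E.
  case: tau ttau {H K Ht} => [s| |//]; rewrite ?lte_fin => ts.
    by have [q] := rat_in_itvoo ts; rewrite in_itv/= => /andP[? ?]; exists q.
  have [|q] := @rat_in_itvoo R t (t + 1); first by rewrite ltrDl.
  by rewrite in_itv/= => /andP[? _]; exists q => //; rewrite ltry.
have := Ht (pickle q); rewrite pickleK => /(_ qtau); apply.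
by rewrite /= in_itv/= t0t ltW.
Qed.

Lemma lmfun_exhaust (t0 tau : R) (g : R -> R) :
  (forall b, t0 <= b -> b < tau -> lmfun t0 b g) -> lmfun t0 tau g.
Proof.
move=> H.
pose bk k : R := tau - (tau - t0) / k.+1%:R.
have [tt|tt] := leP tau t0.
  apply: (@ae_lmfun _ _ _ (fun=> 0 : R)); first exact: measurable_cst.
  apply: (aeS (ae_set1 tau)) => t /eqP ntau /=; rewrite in_itv/= => /andP[a b].
  by case: ntau; apply/eqP; rewrite eq_le b (le_trans tt a).
have d0 : 0 < tau - t0 by rewrite subr_gt0.
have bkt k : bk k < tau by rewrite ltrBlDr ltrDl divr_gt0.
have t0b k : t0 <= bk k.
  by rewrite lerBrDr -lerBrDl ler_pdivrMr// ler_peMr// ?ler1n// ltW.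
have mU : measurable_fun (\bigcup_k `[t0, bk k]%classic `|` [set tau] : set LR) (g : LR -> R).
  have m1 : measurable ([set tau] : set LR) by rewrite -set_itv1; exact: itv_lebesgue.
  apply/measurable_funU => //.
    by apply: bigcupT_measurable => k; exact: measurable_cc.
  split; last exact: measurable_fun_set1.
  apply/measurable_fun_bigcup => k; first exact: measurable_cc.
  exact: H.
apply: measurable_funS mU.
  apply: measurableU; last by rewrite -set_itv1; exact: itv_lebesgue.
  by apply: bigcupT_measurable => k; exact: measurable_cc.
move=> t /=; rewrite in_itv/= => /andP[t0t]; rewrite le_eqVlt => /predU1P[->|tt']; first by right.
left; have d1 : 0 < tau - t by rewrite subr_gt0.
pose k := Num.truncn ((tau - t0) / (tau - t)).
exists k => //=; rewrite in_itv/= t0t/= lerBrDr -lerBrDl ler_pdivrMr// mulrC -ler_pdivrMr//.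
by apply/ltW; rewrite truncnS_gt.
Qed.

Lemma abs_continuous_vintg a b k (x : R -> 'cV[R]_k) : a <= b -> abs_continuous a b x ->
  vintg a b x.
Proof.
move=> ab /abs_continuous_coord ax i.
have ch := scalar_ac_clamp_continuous ab (ax i).
have E t : a <= t -> t <= b -> x (clamp a b t) i ord0 = x t i ord0.
  by move=> at_ tb; rewrite clamp_id.
apply: (eq_intg E); exact: continuous_intg.
Qed.

End exhaustion.

(** * Trajectories in integral form *)

Section lure_solutions.
Context {R : realType} {n m me p : nat}.
Context (A : 'M[R]_n) (B : 'M[R]_(n, m)) (Be : 'M[R]_(n, me)).
Context (C : 'M[R]_(p, n)) (D : 'M[R]_(p, m)) (De : 'M[R]_(p, me)).
Context (f : R -> 'cV[R]_p -> 'cV[R]_m).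
Context (v : R -> 'cV[R]_me).
Notation LR := (lebesgueType R).
Notation mu := (@completed_lebesgue_measure R).
Implicit Types (x : R -> 'cV[R]_n) (w : R -> 'cV[R]_m).

Definition rhs x w (t : R) : 'cV[R]_n := A *m x t + B *m w t + Be *m v t.
Definition output x w (t : R) : 'cV[R]_p := C *m x t + D *m w t + De *m v t.

(** A trajectory on [a, b] as the pair of its state x and its input w = f(t, y), with the
    differential equation in integral form; [output] gives y back. *)
Record sol (a b : R) x w : Prop := Sol {
  sol_x : vintg a b x;
  sol_w : vintg a b w;
  sol_eq : forall t, a <= t -> t <= b -> x t = x a + vint a t (rhs x w);
  sol_fix : {ae mu, forall t : LR, `[a, b]%classic t -> w t = f t (output x w t)} }.

Context (iv : forall a b : R, 0 <= a -> vintg a b v).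

Lemma rhs_vintg a b x w : 0 <= a -> vintg a b x -> vintg a b w -> vintg a b (rhs x w).
Proof.
move=> a0 ix iw; apply: vintgD; last by apply: vintg_mul; exact: iv.
by apply: vintgD; exact: vintg_mul.
Qed.

Lemma output_vintg a b x w : 0 <= a -> vintg a b x -> vintg a b w -> vintg a b (output x w).
Proof.
move=> a0 ix iw; apply: vintgD; last by apply: vintg_mul; exact: iv.
by apply: vintgD; exact: vintg_mul.
Qed.

Lemma sol_vintg a b x w : 0 <= a -> sol a b x w -> vintg a b (rhs x w).
Proof. by move=> a0 [ix iw _ _]; exact: rhs_vintg. Qed.

Lemma ae_cc_sub a b a' b' (P : R -> Prop) : a <= a' -> b' <= b ->
  {ae mu, forall t : LR, `[a, b]%classic t -> P t} ->
  {ae mu, forall t : LR, `[a', b']%classic t -> P t}.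
Proof. by move=> aa bb H; apply: (aeS H) => t Ht /(subset_cc aa bb)/Ht. Qed.

Lemma sol_sub a b b' x w : b' <= b -> sol a b x w -> sol a b' x w.
Proof.
move=> bb [ix iw ex fx]; split.
- exact: vintgS ix.
- exact: vintgS iw.
- by move=> t at_ tb; apply: ex => //; exact: le_trans bb.
- exact: ae_cc_sub fx.
Qed.

Lemma sol_ext a b x w x' w' : 0 <= a -> a <= b ->
  (forall t, a <= t -> t <= b -> x' t = x t) ->
  {ae mu, forall t : LR, `[a, b]%classic t -> w' t = w t} ->
  sol a b x w -> sol a b x' w'.
Proof.
move=> a0 ab xx ww [ix iw ex fx].
have aex : {ae mu, forall t : LR, `[a, b]%classic t -> x t = x' t}.
  by apply: aeW => t /=; rewrite in_itv/= => /andP[at_ tb]; rewrite xx.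
have aew : {ae mu, forall t : LR, `[a, b]%classic t -> w t = w' t}.
  by apply: (aeS ww) => t H /H ->.
split.
- exact: ae_vintg aex.
- exact: ae_vintg aew.
- move=> t at_ tb; rewrite (xx t at_ tb) (xx a (lexx a) ab) (ex t at_ tb).
  apply: (congr1 (fun z => x a + z)); apply: ae_vint.
    exact/vintg_vmf/(vintgS (lexx a) tb (rhs_vintg a0 ix iw)).
  apply: (ae_cc_sub (lexx a) tb); apply: (ae2 aex aew) => r xr wr rab.
  by rewrite /rhs (xr rab) (wr rab).
- apply: (ae2 fx (ae2 aex aew (fun t (p : _ -> _) (q : _ -> _) h => conj (p h) (q h)))).
  by move=> t fxt H tab; have [xt wt] := H tab; rewrite -wt (fxt tab) /output xt wt.
Qed.

Lemma sol_join a c b x w : 0 <= a -> a <= c -> c <= b ->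
  sol a c x w -> sol c b x w -> sol a b x w.
Proof.
move=> a0 ac cb [ix iw ex fx] [ix' iw' ex' fx'].
have ixab : vintg a b x by move=> i; exact: intg_join ac cb (ix i) (ix' i).
have iwab : vintg a b w by move=> i; exact: intg_join ac cb (iw i) (iw' i).
split => //.
- move=> t at_ tb; have [tc|/ltW ct] := leP t c; first exact: ex.
  rewrite (ex' t ct tb) (ex c ac (lexx c)) -addrA; congr (_ + _).
  by rewrite -(vint_split ac ct)//; exact/(vintgS (lexx a) tb)/rhs_vintg.
- apply: (ae2 fx fx') => t H H' /=; rewrite in_itv/= => /andP[at_ tb].
  have [tc|/ltW ct] := leP t c; [apply: H|apply: H'];
  by rewrite /= in_itv/= ?at_ ?tb ?tc ?ct.
Qed.

Definition paste k (c : R) (x x' : R -> 'cV[R]_k) (t : R) := if t < c then x t else x' t.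

Lemma sol_paste a c b x w x' w' : 0 <= a -> a <= c -> c <= b ->
  sol a c x w -> sol c b x' w' -> x c = x' c ->
  sol a b (paste c x x') (paste c w w').
Proof.
move=> a0 ac cb s1 s2 xc; apply: (@sol_join _ c) => //.
  apply: sol_ext s1 => //.
    move=> t at_; rewrite le_eqVlt => /predU1P[->|tc]; first by rewrite /paste ltxx.
    by rewrite /paste tc.
  apply: (aeS (ae_set1 c)) => t tc /=; rewrite in_itv/= => /andP[_].
  by rewrite /paste le_eqVlt (negbTE tc)/= => ->.
apply: sol_ext s2 => //; first exact: le_trans ac.
  by move=> t ct _; rewrite /paste ltNge ct.
by apply: aeW => t /=; rewrite in_itv/= => /andP[ct _]; rewrite /paste ltNge ct.
Qed.

Lemma sol_abs_continuous a b x w : 0 <= a -> sol a b x w -> abs_continuous a b x.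
Proof. by move=> a0 s; apply: (vftc1_ac (sol_vintg a0 s)); exact: sol_eq s. Qed.

Lemma sol_derive a b x w : 0 <= a -> sol a b x w ->
  {ae mu, forall t : LR, `]a, b[%classic t -> is_derive (t : R) (1 : R) x (rhs x w t)}.
Proof. by move=> a0 s; apply: (vftc1_derive (sol_vintg a0 s)); exact: sol_eq s. Qed.

Lemma tint_cc (t0 : R) (tau : \bar R) a b : `[a, b] `<=` tint t0 tau -> a <= b ->
  t0 <= a /\ (b%:E < tau)%E.
Proof.
move=> sub ab; split.
  by have [] := sub a (_ : `[a, b]%classic a); rewrite /= ?in_itv/= ?lexx.
by have [] := sub b (_ : `[a, b]%classic b); rewrite /= ?in_itv/= ?ab ?lexx.
Qed.


Lemma pre_trajectory_of_sol (t0 : R) (tau : \bar R) x w (y : R -> 'cV[R]_p) :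
  0 <= t0 -> (t0%:E < tau)%E -> Linftyloc nonnegR v ->
  (forall b, t0 <= b -> (b%:E < tau)%E -> sol t0 b x w) ->
  (forall t, y t = output x w t) ->
  pre_trajectory A B Be C D De f t0 tau v x y.
Proof.
move=> t00 t0tau Hv S yE.
have fy : {ae mu, forall t : LR, tint t0 tau t -> f t (y t) = w t}.
  apply: ae_exhaust => b t0b btau; apply: (aeS (sol_fix (S b t0b btau))) => t H /H ->.
  by rewrite yE.
split => //; split.
- move=> a b sub.
  have [ab|ba] := leP a b; last first.
    move=> e e0; exists 1 => // N s t st _ _.
    rewrite big1// => i _; have [h1 [h2 h3]] := st i.
    by have := le_lt_trans (le_trans h1 (le_trans h2 h3)) ba; rewrite ltxx.
  have [t0a btau] := tint_cc sub ab.
  have ax := sol_abs_continuous t00 (S b (le_trans t0a ab) btau).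
  move=> e e0; have [d d0 H] := ax e e0; exists d => // N s t st; apply: H => i.
  by have [h1 [h2 h3]] := st i; split => //; exact: le_trans h1.
- move=> i a b sub; have [ab|ba] := leP a b; last exact: intg_gt.
  have [t0a btau] := tint_cc sub ab.
  have [ix iw _ _] := S b (le_trans t0a ab) btau.
  apply: (@intgS _ t0 b) => //; apply: eq_intg (output_vintg t00 ix iw i) => t _ _.
  by rewrite yE.
- move=> i a b sub; have [ab|ba] := leP a b; last exact: intg_gt.
  have [t0a btau] := tint_cc sub ab.
  have [ix iw _ _] := S b (le_trans t0a ab) btau.
  apply: (@intgS _ t0 b) => //; apply: ae_intg (iw i) _.
  apply: (aeS fy) => t H /=; rewrite in_itv/= => /andP[t0t tb].
  by rewrite H//; split => //; apply: le_lt_trans btau; rewrite lee_fin.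
- have dx : {ae mu, forall t : LR, tint t0 tau t -> t != t0 ->
      is_derive (t : R) (1 : R) x (rhs x w t)}.
    apply: ae_exhaust => b t0b btau.
    apply: (ae2 (sol_derive t00 (S b t0b btau)) (ae_set1 b)) => t H tb.
    rewrite /= in_itv/= => /andP[t0t tb'] tt0; apply: H.
    by rewrite /= in_itv/= !lt_neqAle eq_sym tt0 t0t tb tb'.
  apply: (ae2 (ae2 dx (ae_set1 t0) (fun t (a : _ -> _ -> _) b c => a c b)) fy) => t h1 h2 ht.
  split; first by rewrite (h2 ht); exact: h1.
  by rewrite (h2 ht) yE.
Qed.

Lemma sol_of_pre_trajectory (t0 : R) (tau : \bar R) x (y : R -> 'cV[R]_p) b :
  t0 <= b -> (b%:E < tau)%E -> pre_trajectory A B Be C D De f t0 tau v x y ->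
  sol t0 b x (fun t => f t (y t)).
Proof.
move=> t0b btau [t00 _ _ [Wx Ly Lw eqs]].
have sub : `[t0, b]%classic `<=` tint t0 tau.
  move=> t /=; rewrite in_itv/= => /andP[t0t tb]; split => //.
  by apply: le_lt_trans btau; rewrite lee_fin.
have acx := Wx t0 b sub.
have ix := abs_continuous_vintg t0b acx.
have iw : vintg t0 b (fun t => f t (y t)) by move=> i; exact: (Lw i t0 b sub).
split => //.
- move=> t t0t tb; apply: (vftc2 t0t tb acx); first exact: rhs_vintg.
  apply: (aeS eqs) => r H rab; have [] := H _; last by [].
  apply: sub; move: rab; rewrite /= !in_itv/= => /andP[r1 r2].
  by rewrite !ltW.
- by apply: (aeS eqs) => t H /sub/H [_ {1}->].
Qed.

End lure_solutions.

(** * Global existence and forward completeness *)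

Section gronwall.
Context {R : realType}.
Notation LR := (lebesgueType R).
Notation mu := (@completed_lebesgue_measure R).

(** At the maximum c of g(t) exp(-2 al (t - a)), of value M, the inequality gives
    M E <= H + M (E - 1) / 2 where E = exp(2 al (c - a)) >= 1.  Hence M <= 2 H. *)
Lemma gronwall (a b al H : R) (g : R -> R) : a <= b -> 0 <= al -> 0 <= H ->
  continuous g ->
  (forall t, a <= t -> t <= b -> g t <= H + lint a t (fun r => al * g r)) ->
  forall t, a <= t -> t <= b -> g t <= 2 * H * expR (2 * al * (t - a)).
Proof.
move=> ab al0 H0 cg gH.
pose e t := expR (2 * al * (t - a)).
have e0 t : 0 < e t by exact: expR_gt0.
have ce : continuous (fun t : R => g t / e t).
  move=> t; apply: cvgM; first exact: cg.
  have -> : (fun t => (e t)^-1) = (fun t => expR (- (2 * al * (t - a)))).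
    by apply/funext => s; rewrite expRN.
  rewrite -expRN; apply: continuous_comp; last exact: continuous_expR.
  apply: cvgN; apply: cvgM; first exact: cvg_cst.
  by apply: cvgB; [exact: cvg_id|exact: cvg_cst].
have [c] := EVT_max ab (continuous_subspaceT ce).
rewrite in_itv/= => /andP[ac cb] cM.
set M := g c / e c in cM.
have gM t : a <= t -> t <= b -> g t <= M * e t.
  move=> at_ tb; rewrite -ler_pdivrMr//; apply: cM.
  by rewrite in_itv/= at_.
have ig t : intg a t (fun r => al * g r) by apply: intgZ; exact: continuous_intg.
have [ie le] := lint_expR (2 * al) ac.
have M2 : M <= 2 * H.
  have h1 := gH c ac cb.
  have h2 : lint a c (fun r => al * g r) <= 2^-1 * M * (e c - 1).
    rewrite /e -le -lintZ//; apply: le_lint (ig c) (intgZ _ ie) _.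
    apply: aeW => r /=; rewrite in_itv/= => /andP[ar rc].
    rewrite [leRHS](_ : _ = al * (M * e r)); last by rewrite /e; field.
    by apply: ler_wpM2l => //; apply: gM => //; exact: le_trans cb.
  have h3 : g c = M * e c by rewrite /M divfK// gt_eqF.
  have h4 : 1 <= e c.
    by rewrite /e -expR0 ler_expR mulr_ge0 ?mulr_ge0// subr_ge0.
  have [M0|/ltW M0] := leP M 0; first by apply: le_trans M0 _; rewrite mulr_ge0.
  have : 2^-1 * M <= 2^-1 * M * e c by rewrite ler_peMr// mulr_ge0// invr_ge0.
  lra.
move=> t at_ tb; apply: le_trans (gM t at_ tb) _.
by rewrite ler_pM2r//.
Qed.

End gronwall.

Section existence_and_completeness.
Context {R : realType} {n m me p : nat}.
Context (A : 'M[R]_n) (B : 'M[R]_(n, m)) (Be : 'M[R]_(n, me)).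
Context (C : 'M[R]_(p, n)) (D : 'M[R]_(p, m)) (De : 'M[R]_(p, me)).
Context (f : R -> 'cV[R]_p -> 'cV[R]_m).
Notation LR := (lebesgueType R).
Notation mu := (@completed_lebesgue_measure R).
Context (f_caratheodory : caratheodory_fun f).
Context (A1 : lure_A1 C D De f) (A3 : lure_A3 C D De f).
Context (f_loc_bounded : forall K : set 'cV[R]_p, compact K ->
    exists phi : R -> R,
      [/\ forall t, 0 <= t -> 0 <= phi t,
          L1loc nonnegR phi &
          forall t, 0 <= t ->
            (ereal_sup [set (enorm (f t xi))%:E | xi in K] <= (phi t)%:E)%E]).
Context (f_growth : forall T : set R, compact T -> T `<=` nonnegR ->
    exists rho c : R,
      [/\ 0 < rho, 0 < c, c * opnorm D < 1 &
          {ae lebesgue, forall t : lebesgueType R, T t ->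
            (ereal_sup [set (enorm (f t xi) / enorm xi)%:E
                       | xi in [set xi : 'cV[R]_p | (rho <= enorm xi)%R]]
             <= c%:E)%E}]).
Context (v : R -> 'cV[R]_me) (Hv : Linftyloc nonnegR v).
Notation sol := (sol A B Be C D De f v).
Notation output := (output C D De v).
Notation rhs := (rhs A B Be v).

Let iv (a b : R) : 0 <= a -> vintg a b v := @v_vintg _ _ _ Hv a b.

Lemma lure_residual_v (a b : R) : 0 <= a -> exists res phi K,
  residual a b (fun t => Be *m v t) res phi K /\
  {ae mu, forall t : LR, `[a, b]%classic t -> forall (x : 'cV[R]_n) (w : 'cV[R]_m),
      res t x w = w - f t (C *m x + D *m w + De *m v t)}.
Proof.
move=> a0.
have ib : vintg a b (fun t => Be *m v t) by apply: vintg_mul; exact: iv.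
have [psi [phi [L [K [Hres E]]]]] :=
  lure_residual f_caratheodory A1 A3 f_loc_bounded f_growth Hv a0 ib.
exists (lure_res C D De f v psi L), phi, K; split => //.
by apply: (aeS E) => t H tab x w; rewrite (H tab) addrAC.
Qed.

Lemma local_existence (a b : R) (x0 : 'cV[R]_n) : 0 <= a -> a <= b ->
  exists x w, sol a b x w /\ x a = x0.
Proof.
move=> a0 ab; have [res [phi [K [Hres E]]]] := lure_residual_v b a0.
have [x [w [ix iw xa xE wE]]] := existence ab A B x0 Hres.
exists x, w; split => //; split => //.
- by move=> t at_ tb; rewrite xa; exact: xE.
- apply: (ae2 E wE) => t H1 H2 tab; move: (H2 tab); rewrite (H1 tab).
  by move/eqP; rewrite subr_eq0 => /eqP.
Qed.

(** F j solves on [t0, t0 + j + 1], and F j.+1 prolongs it by a local solution; at a given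
    time the sequence F is stationary. *)
Lemma global_existence (t0 : R) (x0 : 'cV[R]_n) : 0 <= t0 ->
  exists x w, (forall b, t0 <= b -> sol t0 b x w) /\ x t0 = x0.
Proof.
move=> t00.
have /choice[G HG] : forall ax : R * 'cV[R]_n, exists xw : (R -> 'cV[R]_n) * (R -> 'cV[R]_m),
    0 <= ax.1 -> sol ax.1 (ax.1 + 1) xw.1 xw.2 /\ xw.1 ax.1 = ax.2.
  move=> [a xa]; have [a0|a0] := leP 0 a; last by exists (fun=> 0, fun=> 0).
  have a1 : a <= a + 1 by rewrite lerDl.
  have [x [w H]] := local_existence xa a0 a1.
  by exists (x, w).
pose T (j : nat) : R := t0 + j%:R.
have TS j : T j + 1 = T j.+1 by rewrite /T -addrA natr1.
have T0 j : t0 <= T j by rewrite lerDl.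
have Tmono i j : (i <= j)%N -> T i <= T j by move=> ij; rewrite lerD2l ler_nat.
pose F := fix F (j : nat) : (R -> 'cV[R]_n) * (R -> 'cV[R]_m) := match j with
  | 0 => G (t0, x0)
  | j.+1 => let g := G (T j.+1, (F j).1 (T j.+1)) in
            (paste (T j.+1) (F j).1 g.1, paste (T j.+1) (F j).2 g.2) end.
have FS j : sol t0 (T j.+1) (F j).1 (F j).2.
  elim: j => [|j IH].
    by have [] := HG (t0, x0) t00; rewrite /= -TS /T addr0.
  have [] := HG (T j.+1, (F j).1 (T j.+1)) (le_trans t00 (T0 _)).
  rewrite TS /= => s xT; apply: sol_paste => //; exact: Tmono.
have FE i j t : (i <= j)%N -> t < T i.+1 -> ((F j).1 t = (F i).1 t) * ((F j).2 t = (F i).2 t).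
  move=> + tT; elim: j => [|j IH]; first by rewrite leqn0 => /eqP ->.
  rewrite leq_eqVlt => /predU1P[->//|]; rewrite ltnS => ij.
  have tj : t < T j.+1 by apply: lt_le_trans tT _; exact: Tmono.
  by rewrite /= /paste tj; exact: IH.
pose k t := Num.truncn (t - t0).
have tk t : t < T (k t).+1 by rewrite /T -ltrBlDl truncnS_gt.
exists (fun t => (F (k t)).1 t), (fun t => (F (k t)).2 t); split; last first.
  rewrite (_ : k t0 = 0%N); last by rewrite /k subrr truncn0.
  by have [] := HG (t0, x0) t00.
move=> b t0b.
have kb t : t <= b -> (k t <= k b)%N by move=> tb; apply: le_truncn; rewrite lerD2r.
have sb := sol_sub (ltW (tk b)) (FS (k b)).
apply: sol_ext sb => //.
  by move=> t _ tb; rewrite -(FE (k t) (k b))//; exact: kb.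
apply: aeW => t /=; rewrite in_itv/= => /andP[_ tb].
by rewrite -(FE (k t) (k b))//; exact: kb.
Qed.

(** Gronwall's inequality on [t0, b] for all b < tau bounds x on [t0, tau[ by a constant M
    independent of b.  By the growth bound w is then dominated by phi + K M, which is
    integrable up to tau, and the integral equation defines the missing value x tau. *)
Lemma extend_to_end (t0 tau : R) x w : 0 <= t0 -> t0 < tau ->
  (forall b, t0 <= b -> b < tau -> sol t0 b x w) ->
  exists x', sol t0 tau x' w /\ forall t, t < tau -> x' t = x t.
Proof.
move=> t00 t0tau S.
have [res [phi [K [Hres E]]]] := lure_residual_v tau t00.
have K0 := res_K Hres.
set beta := (fun t => Be *m v t) in Hres.
pose h := forcing B beta phi.
have ih : intg t0 tau h := intg_forcing B Hres.
have h0 t : t0 <= t -> t <= tau -> 0 <= h t := @forcing_ge0 _ _ _ _ _ B _ _ _ _ Hres t.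
pose a1 := rate A B K.
have a10 : 0 <= a1 by rewrite /a1 /rate addr_ge0 ?mulr_ge0// /coefA /coefB mulr_ge0.
have wphi b : t0 <= b -> b < tau ->
    {ae mu, forall t : LR, `[t0, b]%classic t -> `|w t| <= phi t + K * `|x t|}.
  move=> t0b btau; have bt := ltW btau.
  apply: (ae2 (sol_fix (S b t0b btau)) (ae_cc_sub (lexx t0) bt E)) => t wt rt tab.
  have := rt tab (x t) (w t); rewrite {2}(wt tab) subrr => r0.
  move: tab; rewrite /= in_itv/= => /andP[t0t tb].
  by apply: (res_bound Hres) => //; [exact: le_trans bt|rewrite r0 normr0].
pose H := `|x t0| + lint t0 tau h.
have H0 : 0 <= H.
  by rewrite addr_ge0// lint_ge0// => t t0t tt; exact: h0.
pose M := 2 * H * expR (2 * a1 * (tau - t0)).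
have xM t : t0 <= t -> t < tau -> `|x t| <= M.
  move=> t0t ttau.
  have s := S t t0t ttau.
  have ax := sol_abs_continuous iv t00 s.
  (* [gronwall] requires continuity on the whole line *)
  pose g r := `|x (clamp t0 t r)|.
  have cg : continuous g.
    have /abs_continuous_coord sx := ax.
    move=> r; apply: cvg_norm; apply/cvg_coordP => i.
    exact: (scalar_ac_clamp_continuous t0t (sx i)).
  have gE r : t0 <= r -> r <= t -> g r = `|x r|.
    by move=> r0 rt; rewrite /g clamp_id.
  have gH r : t0 <= r -> r <= t -> g r <= H + lint t0 r (fun q => a1 * g q).
    move=> t0r rt.
    have rtau : r <= tau by exact: ltW (le_lt_trans rt ttau).
    have ihr : intg t0 r h := intgS (lexx t0) rtau ih.
    have igr : intg t0 r (fun q => a1 * g q) by apply: intgZ; exact: continuous_intg.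
    rewrite (gE r t0r rt) (sol_eq s t0r rt); apply: le_trans (ler_normD _ _) _.
    rewrite /H -addrA lerD2l (lint_split t0r rtau ih).
    have tail : 0 <= lint r tau h.
      by apply: lint_ge0 => q rq qtau; apply: h0 => //; exact: le_trans rq.
    apply: (@le_trans _ _ (lint t0 r h + lint t0 r (fun q => a1 * g q))); last by lra.
    rewrite -lintD//; apply: vint_norm.
    + by apply: (vintgS (lexx t0) rt); exact: (sol_vintg iv t00 s).
    + exact: intgD.
    apply: (aeS (wphi r t0r (le_lt_trans rt ttau))) => q Hw qr; have {}Hw := Hw qr.
    move: qr; rewrite /= in_itv/= => /andP[t0q qr].
    rewrite (gE q t0q (le_trans qr rt)) /h /forcing /a1 /rate.
    have e1 : `|A *m x q| <= coefA A * `|x q| := mulmx_norm_le A (x q).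
    have e2 : `|B *m w q| <= coefB B * `|w q| := mulmx_norm_le B (w q).
    have e3 : coefB B * `|w q| <= coefB B * (phi q + K * `|x q|).
      by apply: ler_wpM2l Hw; rewrite /coefB mulr_ge0.
    have e4 := norm_l1 (Be *m v q).
    apply: le_trans (ler_normD _ _) _; have := ler_normD (A *m x q) (B *m w q).
    move: e1 e2 e3 e4; rewrite /beta mulrDr mulrDl mulrA; lra.
  have := gronwall t0t a10 H0 cg gH t0t (lexx t).
  rewrite (gE t t0t (lexx t)) => /le_trans; apply; rewrite /M.
  apply: ler_wpM2l; first by rewrite mulr_ge0.
  by rewrite ler_expR ler_wpM2l ?mulr_ge0// lerD2r ltW.
have mx : vmf t0 tau x.
  by move=> i; apply: lmfun_exhaust => b t0b btau; exact: (vintg_vmf (sol_x (S b t0b btau))).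
have mw : vmf t0 tau w.
  by move=> i; apply: lmfun_exhaust => b t0b btau; exact: (vintg_vmf (sol_w (S b t0b btau))).
have end_ae (P : R -> Prop) : (forall b, t0 <= b -> b < tau ->
    {ae mu, forall t : LR, `[t0, b]%classic t -> P t}) ->
    {ae mu, forall t : LR, `[t0, tau]%classic t -> P t}.
  move=> HP; apply: (ae2 (ae_exhaust (tau := tau%:E) HP) (ae_set1 tau)) => t Ht tt.
  rewrite /= in_itv/= => /andP[t0t ttau]; apply: Ht; split => //.
  by rewrite lte_fin lt_neqAle tt.
have ix : vintg t0 tau x.
  apply: (vintg_le mx (intg_cst t0 tau M)); apply: end_ae => b t0b btau.
  apply: aeW => t /=; rewrite in_itv/= => /andP[t0t tb]; apply: xM => //.
  exact: le_lt_trans btau.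
have iw : vintg t0 tau w.
  apply: (vintg_le mw (intgD (res_phi Hres) (intg_cst t0 tau (K * M)))).
  apply: end_ae => b t0b btau; apply: (aeS (wphi b t0b btau)) => t Hw tab.
  apply: le_trans (Hw tab) _; rewrite lerD2l ler_wpM2l//.
  move: tab; rewrite /= in_itv/= => /andP[t0t tb]; apply: xM => //.
  exact: le_lt_trans btau.
pose x' t := if t < tau then x t else x t0 + vint t0 tau (rhs x w).
have xx' t : t < tau -> x' t = x t by rewrite /x' => ->.
have aex : {ae mu, forall t : LR, `[t0, tau]%classic t -> x t = x' t}.
  apply: end_ae => b t0b btau; apply: aeW => t /=; rewrite in_itv/= => /andP[_ tb].
  by rewrite xx'//; exact: le_lt_trans btau.
exists x'; split => //; split => //.
- exact: ae_vintg aex.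
- move=> t t0t ttau; rewrite (xx' t0 t0tau).
  have -> : vint t0 t (rhs x' w) = vint t0 t (rhs x w).
    apply/esym/ae_vint; first exact/vintg_vmf/(vintgS (lexx t0) ttau)/rhs_vintg.
    apply: (ae_cc_sub (lexx t0) ttau); apply: (aeS aex) => r xr rab.
    by rewrite /rhs (xr rab).
  move: ttau; rewrite le_eqVlt => /predU1P[->|ttau]; first by rewrite /x' ltxx.
  by rewrite xx'//; exact: (sol_eq (S t t0t ttau) t0t (lexx t)).
- apply: end_ae => b t0b btau; apply: (aeS (sol_fix (S b t0b btau))) => t wt tab.
  rewrite (wt tab) /output xx'//.
  by move: tab; rewrite /= in_itv/= => /andP[_ tb]; exact: le_lt_trans btau.
Qed.

Lemma extend_trajectory (t0 tau : R) x y : t0 < tau ->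
  pre_trajectory A B Be C D De f t0 tau%:E v x y ->
  exists x' y', [/\ pre_trajectory A B Be C D De f t0 +oo%E v x' y',
    forall t, tint t0 tau%:E t -> x' t = x t &
    {ae mu, forall t : LR, tint t0 tau%:E t -> y' t = y t}].
Proof.
move=> t0tau H; have [t00 _ _ [_ _ _ eqs]] := H.
have S b : t0 <= b -> b < tau -> sol t0 b x (fun t => f t (y t)).
  by move=> t0b btau; apply: (sol_of_pre_trajectory iv t0b _ H); rewrite lte_fin.
have [x1 [s1 x1E]] := extend_to_end t00 t0tau S.
have tau0 : 0 <= tau by exact: le_trans (ltW t0tau).
have [x2 [w2 [s2 x2E]]] := global_existence (x1 tau) tau0.
pose x' := paste tau x1 x2; pose w' := paste tau (fun t => f t (y t)) w2.
exists x', (output x' w'); split.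
- apply: (@pre_trajectory_of_sol _ _ _ _ _ A B Be C D De f v iv t0 _ x' w' _ t00 (ltry t0) Hv
    _ (fun=> erefl)).
  move=> b t0b _; have [btau|/ltW taub] := leP b tau.
    apply: sol_sub btau _; apply: (sol_paste iv t00 (ltW t0tau) (lexx tau) s1 (s2 _ (lexx tau))).
    by rewrite x2E.
  by apply: (sol_paste iv t00 (ltW t0tau) taub s1 (s2 _ taub)); rewrite x2E.
- by move=> t [_]; rewrite lte_fin => tt; rewrite /x' /paste tt x1E.
- apply: (aeS eqs) => t Ht tt; have [_ yE] := Ht tt; have [_] := tt.
  by rewrite lte_fin => ttau; rewrite [RHS]yE /output /x' /w' /paste ttau x1E.
Qed.

End existence_and_completeness.


Unset Implicit Arguments.

Theorem corollary4p16 (R : realType) (n m me p : nat)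
  (n_gt0 : (0 < n)%N) (m_gt0 : (0 < m)%N) (me_gt0 : (0 < me)%N)
  (p_gt0 : (0 < p)%N)
  (A : 'M[R]_n) (B : 'M[R]_(n, m)) (Be : 'M[R]_(n, me))
  (C : 'M[R]_(p, n)) (D : 'M[R]_(p, m)) (De : 'M[R]_(p, me))
  (f : R -> 'cV[R]_p -> 'cV[R]_m)
  (f_caratheodory : caratheodory_fun f)
  (A1 : lure_A1 C D De f)
  (A3 : lure_A3 C D De f)
  (f_loc_bounded : forall K : set 'cV[R]_p, compact K ->
    exists phi : R -> R,
      [/\ forall t, 0 <= t -> 0 <= phi t,
          L1loc nonnegR phi &
          forall t, 0 <= t ->
            (ereal_sup [set (enorm (f t xi))%:E | xi in K] <= (phi t)%:E)%E])
  (f_growth : forall T : set R, compact T -> T `<=` nonnegR ->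
    exists rho c : R,
      [/\ 0 < rho, 0 < c, c * opnorm D < 1 &
          {ae lebesgue, forall t : lebesgueType R, T t ->
            (ereal_sup [set (enorm (f t xi) / enorm xi)%:E
                       | xi in [set xi : 'cV[R]_p | (rho <= enorm xi)%R]]
             <= c%:E)%E}]) :
  forward_complete A B Be C D De f /\
  (forall v : R -> 'cV[R]_me, Linftyloc nonnegR v ->
   forall (t0 : R) (x0 : 'cV[R]_n), 0 <= t0 ->
     exists (x : R -> 'cV[R]_n) (y : R -> 'cV[R]_p),
       behaviour A B Be C D De f t0 (+oo%E, v, x, y) /\ x t0 = x0).
Proof.
split; last first.
  move=> v Hv t0 x0 t00.
  have [x [w [S xt0]]] := global_existence A B Be f_caratheodory A1 A3 f_loc_bounded f_growth
    Hv x0 t00.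
  exists x, (output C D De v x w); split => //; split => //.
  have iv a b : 0 <= a -> vintg a b v by move=> a0; exact: (v_vintg Hv b a0).
  apply: (@pre_trajectory_of_sol _ _ _ _ _ A B Be C D De f v iv t0 _ x w _ t00 (ltry t0) Hv
    _ (fun=> erefl)).
  by move=> b t0b _; exact: S.
move=> t0 t00; apply/seteqP; split => -[[[tau v] x] y] /=; last first.
  move=> [-> H]; split=> // -[tau' [x' [y' []]]].
  by rewrite ltNge leey.
move=> [H maxH]; split => //; have [_ t0tau Hv _] := H.
case: tau H t0tau maxH => [tau||//] H t0tau maxH //; exfalso; apply: maxH.
have [x' [y' [H' xE yE]]] := extend_trajectory f_caratheodory A1 A3 f_loc_bounded f_growth Hv
  t0tau H.
by exists +oo%E, x', y'; split => //; exact: ltry.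
Qed.
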